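(* Let $R=N\oplus Q$ be a finite-dimensional complex solvable Leibniz algebra with nilradical $N$, where $Q$ is a vector subspace complementary to $N$. Suppose $\dim Q=\dim(N/N^2)=k$ and $N=\bigoplus_{t=1}^{s}N_t$, where each $N_t$ is a non-split and non-abelian ideal of $N$ with $\dim N_t=n_t$. Then: (1) $R$ admits a basis $\{e_1^t,\dots,e_{k_t^1}^t,e_{k_t^1+1}^t,\dots,e_{k_t}^t,e_{k_t+1}^t,\dots,e_{n_t}^t,x_1^t,\dots,x_{k_t}^t : 1\le t\le s\}$, adapted to $N$ in the sense of the context, such that the table of multiplications of $R$ has the form (all products of basis elements not listed being zero) $$\begin{array}{ll} [e_i^t,e_j^t]=\sum\limits_{p=k_t+1}^{n_t}\gamma_{i,j}^{t,p}e_p^t, & 1\le i,j\le n_t,\ 1\le t\le s,\\ {[e_i^t,x_i^t]}=e_i^t, & 1\le i\le k_t,\ 1\le t\le s,\\ {[x_i^t,e_i^t]}=-e_i^t, & 1\le i\le k_t^1,\ 1\le t\le s,\\ {[e_i^t,x_j^t]}=\alpha_{i,j}^te_i^t, & k_t+1\le i\le n_t,\ 1\le j\le k_t,\ 1\le t\le s,\\ {[x_j^t,e_i^t]}=\sum\limits_{l=1}^{q}\beta_{t,j,i}^{i_l}e_{i_l}^t, & k_t+1\le i\le n_t,\ 1\le j\le k_t,\ 1\le t\le s, \end{array}$$ where $\gamma_{i,j}^{t,p},\beta_{t,j,i}^{i_l}\in\mathbb{C}$, $\alpha_{i,j}^t$ is the number of occurrences of the generator $e_j^t$ in the non-generator basis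 element $e_i^t$, and, for each $t,i$, $\{e_{i_1}^t,\dots,e_{i_q}^t\}$ is the set of all non-generator basis elements of $N_t$ having the same structure as $e_i^t$. (2) $R$ is a unique algebra up to isomorphism (for the given $N$), and it has the form $R=\bigoplus_{t=1}^{s}R_t$ with $R_t=N_t\oplus Q_t$, where $N_t$ is the nilradical of $R_t$ and $Q_t$ is a subspace complementary to $N_t$ in $R_t$.
   Context: All algebras and vector spaces are finite-dimensional over $\mathbb{C}$. A (right) Leibniz algebra is a vector space $L$ with a bilinear bracket satisfying $[[x,y],z]=[[x,z],y]+[x,[y,z]]$ for all $x,y,z\in L$. Put $L^1=L$, $L^{m+1}=[L^m,L]$ and $L^{[1]}=L$, $L^{[m+1]}=[L^{[m]},L^{[m]}]$; $L$ is nilpotent (resp. solvable) if $L^m=0$ (resp. $L^{[m]}=0$) for some $m$. The nilradical is the maximal nilpotent ideal. The right annihilator is $Ann_r(L)=\{x\in L : [y,x]=0\ \text{for all } y\in L\}$. An algebra is non-split if it is not a direct sum of two nonzero ideals. Adapted basis: for each $t$, $\{e_1^t,\dots,e_{n_t}^t\}$ is a basis of $N_t$; $k_t=\dim(N_t/N_t^2)$ and $e_1^t,\dots,e_{k_t}^t$ are generators of $N_t$ (their classes form a basis of $N_t/N_t^2$), ordered so that $\{e_1^t,\dots,e_{k_t^1}^t\}\cap Ann_r(N_t)=\emptyset$ and $\{e_{k_t^1+1}^t,\dots,e_{k_t}^t\}\subset Ann_r(N_t)$; each non-generator basis element $e_i^t$, $k_t+1\le i\le n_t$, lies in $N_t^2$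 and is an iterated bracket $[[\cdots[[e_{i_1}^t,e_{i_2}^t],e_{i_3}^t],\cdots],e_{i_m}^t]$, $m\ge2$, of generators of $N_t$; and the $x_j^t$ ($1\le t\le s$, $1\le j\le k_t$) span a complement of $N$ in $R$. The number $\alpha_{i,j}^t$ is the number of indices $l$ with $i_l=j$ in the word expressing $e_i^t$. Two non-generator basis elements $e_i^t,e_m^t$ have the same structure if $\alpha_{i,p}^t=\alpha_{m,p}^t$ for all $1\le p\le k_t$ (so $q$ depends on $t,i$).
   Formalization: In the conclusion the N_t are replaced by their images under one automorphism of N (and are the N_t themselves whenever all N_t are ideals of R); for arbitrary prescribed N_t the claim fails, e.g. for two Heisenberg algebras with N_1 = <e+z', f, z>. *)

(* Defs.v *)
From HB Require Import structures.
From mathcomp Require Export all_boot all_algebra reals.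
From mathcomp.real_closed Require Export complex.

Set Implicit Arguments.
Unset Strict Implicit.
Unset Printing Implicit Defensive.

Import GRing.Theory.

Local Open Scope ring_scope.

(* Finite-dimensional right Leibniz algebras over a field. *)
HB.mixin Record isLeibniz (K : fieldType) L of Vector K L := {
  lbr : L -> L -> L;
  lbr_linearl : forall y : L, linear (fun x => lbr x y);
  lbr_linearr : forall x : L, linear (lbr x);
  lbr_leibniz : forall x y z : L,
    lbr (lbr x y) z = lbr (lbr x z) y + lbr x (lbr y z)
}.

#[short(type="leibnizType")]
HB.structure Definition Leibniz (K : fieldType) :=
  { L of isLeibniz K L & Vector K L }.

Section Subspaces.

Variables (K : fieldType) (L : leibnizType K).
Implicit Types U V I J : {vspace L}.

(* The product [U, V]: the span of all brackets lbr u v, u \in U, v \in V;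
   see lbrvP. *)
Definition lbrv U V : {vspace L} :=
  <<[seq lbr u v | u <- vbasis U, v <- vbasis V]>>%VS.

Lemma lbrvP U V (W : {vspace L}) :
  reflect (forall u v, u \in U -> v \in V -> lbr u v \in W)
          (lbrv U V <= W)%VS.
Proof.
apply: (iffP span_subvP) => [sW u v Uu Vv | sW _ /allpairsP[[u v] /= [Uu Vv ->]]].
  pose addl y : {linear L -> L} :=
    HB.pack (fun x : L => lbr x y)
      (GRing.isLinear.Build K L L *:%R (fun x => lbr x y) (lbr_linearl y)).
  pose addr x : {linear L -> L} :=
    HB.pack (lbr x : L -> L)
      (GRing.isLinear.Build K L L *:%R (lbr x) (lbr_linearr x)).
  rewrite (coord_vbasis Uu) -[lbr _ v]/(addl v _) linear_sum.
  apply: memv_suml => i _; rewrite linearZ memvZ //= (coord_vbasis Vv).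
  rewrite -[lbr _ _]/(addr _ _) linear_sum.
  apply: memv_suml => j _; rewrite linearZ memvZ //=.
  by apply/sW/allpairs_f; rewrite memt_nth.
by apply: sW; apply: vbasis_mem.
Qed.

Definition lb_ideal I U : Prop :=
  [/\ (I <= U)%VS, (lbrv I U <= I)%VS & (lbrv U I <= I)%VS].

(* lcs U m is U^(m+1) and ders U m is U^[m+1]. *)
Definition lcs U (m : nat) : {vspace L} := iter m (fun V => lbrv V U) U.
Definition ders U (m : nat) : {vspace L} := iter m (fun V => lbrv V V) U.

Definition lb_nilpotent U : Prop := exists m, lcs U m = 0%VS.
Definition lb_solvable U : Prop := exists m, ders U m = 0%VS.
Definition lb_abelian U : Prop := lbrv U U = 0%VS.

Definition lb_nilradical V U : Prop :=
  [/\ lb_ideal V U, lb_nilpotent V &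
      forall I, lb_ideal I U -> lb_nilpotent I -> (I <= V)%VS].

Definition in_Ann_r U (x : L) : Prop :=
  x \in U /\ forall y, y \in U -> lbr y x = 0.

Definition complementary U V W : Prop :=
  (V + W)%VS = U /\ (V :&: W)%VS = 0%VS.

Definition lb_nonsplit U : Prop :=
  forall I J, lb_ideal I U -> lb_ideal J U -> complementary U I J ->
  I = 0%VS \/ J = 0%VS.

Definition ideal_decomposition (s : nat) U (Ut : 'I_s -> {vspace L}) : Prop :=
  [/\ forall t, lb_ideal (Ut t) U, (\sum_t Ut t)%VS = U
    & directv (\sum_t Ut t)].

End Subspaces.

(* An isomorphism between the subalgebras U of L and U' of L' is represented
   by any linear map L -> L' that restricts to one. *)
Definition lb_iso (K : fieldType) (L L' : leibnizType K)
    (U : {vspace L}) (U' : {vspace L'}) (f : 'Hom(L, L')) : Prop :=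
  [/\ (f @: U)%VS = U', {in U &, injective f}
    & {in U &, forall x y, f (lbr x y) = lbr (f x) (f y)}].

Definition lb_isomorphic (K : fieldType) (L L' : leibnizType K)
    (U : {vspace L}) (U' : {vspace L'}) : Prop :=
  exists f : 'Hom(L, L'), lb_iso U U' f.

(* The internal decomposition Mt of U is the image of Nt under an automorphism
   of U, i.e. Nt and Mt are the same decomposition of U up to isomorphism.
   Non-split summands are only unique in this sense, and an extension R of N
   need not normalize a prescribed choice of them: let N be the sum of two
   Heisenberg algebras <e, f, z> + <e', f', z'> and R the sum of their maximal
   solvable extensions. Then N = <e + z', f, z> + <e', f', z'> as well, but no
   vector of the form a (e + z') + b f + c z with a != 0 is a common
   eigenvector of right multiplications by a complement of N. *)
Definition equivalent_decompositions (K : fieldType) (L : leibnizType K)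
    (s : nat) (U : {vspace L}) (Nt Mt : 'I_s -> {vspace L}) : Prop :=
  exists2 phi : 'End(L), lb_iso U U phi & forall t, Mt t = (phi @: Nt t)%VS.

(* R is solvable with nilradical N, Q is a complementary subspace, and
   dim Q = dim (N / N^2) = k. *)
Definition maximal_extension (K : fieldType) (R : leibnizType K)
    (N Q : {vspace R}) (k : nat) : Prop :=
  [/\ lb_solvable (fullv : {vspace R}), lb_nilradical N fullv,
      complementary fullv N Q, \dim Q = k
    & (\dim N - \dim (lbrv N N))%N = k].

Section AdaptedBasis.

Variables (K : fieldType) (R : leibnizType K) (s : nat).

(* Indices start at 0. The basis elements of N_t are indexed by
   'I_(k_t + m_t), so that n_t = k_t + m_t: generators are the left shifts,
   non-generators the right shifts. wd t i is the word of generator indices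
   [:: i_1; ...; i_m] whose left-normed bracket is the i-th non-generator. *)
Record basis_data := BasisData {
  bk1 : 'I_s -> nat;
  bk : 'I_s -> nat;
  bm : 'I_s -> nat;
  be : forall t, 'I_(bk t + bm t) -> R;
  bx : forall t, 'I_(bk t) -> R;
  wd : forall t, 'I_(bm t) -> seq 'I_(bk t)
}.

Variable B : basis_data.

Definition gen t (i : 'I_(bk B t)) : R := be (lshift (bm B t) i).
Definition ngen t (i : 'I_(bm B t)) : R := be (rshift (bk B t) i).

Definition left_normed (ws : seq R) : R :=
  if ws is w :: ws' then foldl (@lbr K R) w ws' else 0.

Definition alpha t (i : 'I_(bm B t)) (j : 'I_(bk B t)) : nat :=
  count_mem j (wd i).

Definition same_structure t (i l : 'I_(bm B t)) : bool :=
  [forall p, alpha i p == alpha l p].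

Definition e_family : seq R :=
  [seq be i | t <- enum 'I_s, i <- enum 'I_(bk B t + bm B t)].
Definition x_family : seq R :=
  [seq bx i | t <- enum 'I_s, i <- enum 'I_(bk B t)].

Definition adapted_summand (Nt : {vspace R}) (t : 'I_s) : Prop :=
  [/\ basis_of Nt [seq be i | i <- enum 'I_(bk B t + bm B t)],
      bk B t = (\dim Nt - \dim (lbrv Nt Nt))%N
        /\ complementary Nt <<[seq gen i | i <- enum 'I_(bk B t)]>>
                            (lbrv Nt Nt),
      (bk1 B t <= bk B t)%N,
      forall i : 'I_(bk B t),
        if (i < bk1 B t)%N then ~ in_Ann_r Nt (gen i) else in_Ann_r Nt (gen i)
    & forall i : 'I_(bm B t),
        [/\ ngen i \in lbrv Nt Nt, (2 <= size (wd i))%N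
          & ngen i = left_normed [seq gen j | j <- wd i]]].

Definition adapted_basis (N : {vspace R}) (Nt : 'I_s -> {vspace R}) : Prop :=
  [/\ basis_of fullv (e_family ++ x_family),
      complementary fullv N <<x_family>>
    & forall t, adapted_summand (Nt t) t].

Definition multiplication_table : Prop :=
  exists (gamma : forall t, 'I_(bk B t + bm B t) -> 'I_(bk B t + bm B t) ->
                            'I_(bm B t) -> K)
         (beta : forall t, 'I_(bk B t) -> 'I_(bm B t) -> 'I_(bm B t) -> K),
    (forall t,
      [/\ forall i j, lbr (be i) (be j)
            = \sum_(p < bm B t) gamma t i j p *: ngen p,
          forall i j : 'I_(bk B t), lbr (gen i) (bx j)
            = if i == j then gen i else 0,
          forall i j : 'I_(bk B t), lbr (bx j) (gen i)
            = if (i == j) && (i < bk1 B t)%N then - gen i else 0,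
          forall (i : 'I_(bm B t)) (j : 'I_(bk B t)), lbr (ngen i) (bx j)
            = (alpha i j)%:R *: ngen i
        & forall (i : 'I_(bm B t)) (j : 'I_(bk B t)), lbr (bx j) (ngen i)
            = \sum_(l < bm B t | same_structure i l) beta t j i l *: ngen l])
    /\ (forall t u, t != u ->
      [/\ forall (i : 'I_(bk B t + bm B t)) (j : 'I_(bk B u + bm B u)),
            lbr (be i) (be j) = 0,
          forall (i : 'I_(bk B t + bm B t)) (j : 'I_(bk B u)),
            lbr (be i) (bx j) = 0
        & forall (i : 'I_(bk B t + bm B t)) (j : 'I_(bk B u)),
            lbr (bx j) (be i) = 0])
    /\ (forall t u (i : 'I_(bk B t)) (j : 'I_(bk B u)),
          lbr (bx i) (bx j) = 0).

End AdaptedBasis.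

(* Main.v *)
(* R acts on N / N^2 by right multiplications; by Lie's theorem this action has
   k weights, and since an element acting nilpotently on N / N^2 lies in N, they
   form a basis of the dual of R / N. An element y0 on which the weights take the
   values k + 1, ..., 2k then splits everything: its generalized 0-eigenspace is
   an abelian complement of N, its eigenvectors in N lift a basis of N / N^2, and
   a dual basis x_j of the complement satisfies [e_i, x_j] = delta_ij e_i. Hence
   N is graded by N^k, and the graded pieces determine the table.

   The projections of N onto the N_t belong to the centroid of N. The existence
   of the left multiplications by the x_j forces centroid elements to be diagonal
   on N / N^2 in the basis e_i (a nonzero off-diagonal coefficient would produce
   a central generator). So each e_i belongs modulo N^2 to a single N_t, and the
   subalgebras M_t generated by the resulting blocks of generators form a
   decomposition which the projections identify with the given one.

   For uniqueness, two such gradings of N have to be conjugate under Aut N. Taking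
   lowest-degree parts, one may assume that the generators of the second one are
   linear combinations of those of the first. The matrices of derivations acting
   linearly on the generators form a Lie algebra containing the diagonal matrices,
   hence an associative algebra; it contains a unit carrying the first set of
   generators to the second, and units lift to automorphisms. *)
From HB Require Import structures.
Require Import Defs.
From mathcomp Require Import boolp perm spectral ring zify.

Set Implicit Arguments.
Unset Strict Implicit.
Unset Printing Implicit Defensive.

Import GRing.Theory Num.Theory.
Local Open Scope ring_scope.

(** * Brackets, derivations and shifted operators *)

(** Right multiplications form a Lie action, left ones do not. The handle on the latter is that [w,
    [y, z] + [z, y]] = 0 for all w. With y = x_i and z = e_i it leaves two cases: [x_i, e_i] = -e_i,
    or e_i is annihilated by all left multiplications. Which case occurs depends on N alone as soon
    as the center of N lies in N^2, and this is what non-split, non-abelian summands provide.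

    In the conjugacy of gradings, the matrix [a] expressing the second generators through the first
    need not lie in the associative algebra, because the two families correspond only up to a
    permutation. A nonzero term of the determinant of the inverse of [a] supplies a permutation, and
    [a] with its rows so permuted does lie in the algebra. Units are lifted by solving a
    differential equation in power series, which avoids matrix logarithms and connectedness
    arguments. *)

Definition lin_closed (K : fieldType) (V : lmodType K) (P : V -> Prop) : Prop :=
  P 0 /\ forall a u v, P u -> P v -> P (a *: u + v).

Lemma eq_coord (K : fieldType) (V : vectType K) (u v : V) :
  (forall i, coord (vbasis fullv) i u = coord (vbasis fullv) i v) -> u = v.
Proof.
move=> euv; rewrite (coord_vbasis (memvf u)) (coord_vbasis (memvf v)).
by apply: eq_bigr => i _; rewrite euv.
Qed.

Ltac vring := apply: eq_coord => ?;
  rewrite ?(linearD, linearN, linearZ, linear0) /=; ring.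

Section LinClosed.
Variables (K : fieldType) (V : vectType K) (P : V -> Prop).
Hypothesis linP : lin_closed P.

Lemma lin_closedZ a u : P u -> P (a *: u).
Proof. by case: linP => P0 PL Pu; rewrite -[_ *: _]addr0; apply: PL. Qed.

Lemma lin_closedD u v : P u -> P v -> P (u + v).
Proof. by case: linP => P0 PL Pu Pv; rewrite -[u]scale1r; apply: PL. Qed.

Lemma lin_closed_sum (I : Type) (r : seq I) (Q : pred I) (F : I -> V) :
  (forall i, Q i -> P (F i)) -> P (\sum_(i <- r | Q i) F i).
Proof. by move=> PF; apply: big_ind => //; [case: linP | exact: lin_closedD]. Qed.

Lemma span_ind (X : seq V) : {in X, forall x, P x} ->
  forall v, v \in <<X>>%VS -> P v.
Proof.
move=> PX v; rewrite -[X]/(tval (in_tuple X)) => /coord_span ->.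
by apply: lin_closed_sum => i _; apply/lin_closedZ/PX/mem_nth.
Qed.

Lemma addv_ind (U W : {vspace V}) : {in U, forall x, P x} ->
  {in W, forall x, P x} -> forall v, v \in (U + W)%VS -> P v.
Proof.
by move=> PU PW v /memv_addP[u Uu [w Ww ->]]; apply: lin_closedD; auto.
Qed.

End LinClosed.

Lemma memv_lin_closed (K : fieldType) (V : vectType K) (U : {vspace V}) :
  lin_closed (fun v => v \in U).
Proof. by split=> [|a u v Uu Uv]; rewrite ?mem0v // memvD ?memvZ. Qed.

Section Bracket.
Variables (K : fieldType) (L : leibnizType K).
Implicit Types (x y z : L) (U V W : {vspace L}).

HB.instance Definition _ x :=
  GRing.isLinear.Build K L L *:%R (lbr x : L -> L) (lbr_linearr x).

Definition rbr y x := lbr x y.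
HB.instance Definition _ y :=
  GRing.isLinear.Build K L L *:%R (rbr y) (lbr_linearl y).

Lemma lbrDl x y z : lbr (x + y) z = lbr x z + lbr y z.
Proof. exact: (linearD (rbr z)). Qed.
Lemma lbrDr x y z : lbr x (y + z) = lbr x y + lbr x z.
Proof. exact: linearD. Qed.
Lemma lbrZl a x y : lbr (a *: x) y = a *: lbr x y.
Proof. exact: (linearZ_LR (rbr y)). Qed.
Lemma lbrZr a x y : lbr x (a *: y) = a *: lbr x y.
Proof. exact: linearZ. Qed.
Lemma lbr0l x : lbr 0 x = 0 :> L.
Proof. exact: (linear0 (rbr x)). Qed.
Lemma lbr0r x : lbr x 0 = 0.
Proof. exact: linear0. Qed.
Lemma lbrNl x y : lbr (- x) y = - lbr x y.
Proof. exact: (linearN (rbr y)). Qed.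
Lemma lbrNr x y : lbr x (- y) = - lbr x y.
Proof. exact: linearN. Qed.
Lemma lbr_suml (I : Type) (r : seq I) (P : pred I) (F : I -> L) y :
  lbr (\sum_(i <- r | P i) F i) y = \sum_(i <- r | P i) lbr (F i) y.
Proof. exact: (linear_sum (rbr y)). Qed.
Lemma lbr_sumr (I : Type) (r : seq I) (P : pred I) (F : I -> L) y :
  lbr y (\sum_(i <- r | P i) F i) = \sum_(i <- r | P i) lbr y (F i).
Proof. exact: linear_sum. Qed.

(** The Leibniz identity solved for the right-nested bracket: right multiplication by a bracket is a
    commutator of right multiplications. It turns all products into left-normed ones. *)
Lemma lbr_lbr x y z : lbr x (lbr y z) = lbr (lbr x y) z - lbr (lbr x z) y.
Proof. by rewrite lbr_leibniz addrAC subrr add0r. Qed.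

Definition adr x : 'End(L) := linfun (rbr x).

Lemma adrE x y : adr x y = lbr y x. Proof. by rewrite lfunE. Qed.

Lemma mem_lbrv U V u v : u \in U -> v \in V -> lbr u v \in lbrv U V.
Proof. by apply: (elimT (lbrvP U V (lbrv U V))). Qed.

Lemma lbrv_ind U V (P : L -> Prop) : lin_closed P ->
  (forall u v, u \in U -> v \in V -> P (lbr u v)) ->
  forall w, w \in lbrv U V -> P w.
Proof.
move=> linP PUV; apply: span_ind => // _ /allpairsP[[u v] /= [Uu Vv ->]].
by apply: PUV; apply: vbasis_mem.
Qed.

Lemma lbrvS U U' V V' : (U <= U')%VS -> (V <= V')%VS ->
  (lbrv U V <= lbrv U' V')%VS.
Proof.
move=> sU sV; apply/lbrvP => u v Uu Vv.
by apply: mem_lbrv; [apply: (subvP sU) | apply: (subvP sV)].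
Qed.

Definition derivation_on U (D : 'End(L)) : Prop :=
  (forall x, x \in U -> D x \in U) /\
  (forall x y, x \in U -> y \in U -> D (lbr x y) = lbr (D x) y + lbr x (D y)).

Lemma adr_derivation x : derivation_on fullv (adr x).
Proof. by split=> [*|y z _ _]; rewrite ?memvf // !adrE lbr_leibniz. Qed.

End Bracket.

Section Kill.
Variables (K : fieldType) (V : vectType K) (D : 'End(V)).
Implicit Types (b c : K) (s t : seq K) (v w : V) (U W : {vspace V}).

Definition shift b : 'End(V) := (D - b *: \1)%VF.
(** The product of the commuting operators [D - b] over the list [s]. Lists of roots stand for split
    polynomials in [D], with concatenation as multiplication. *)
Definition kill s v := foldl (fun w b => shift b w) v s.

Lemma shiftE b v : shift b v = D v - b *: v.
Proof. by rewrite add_lfunE opp_lfunE scale_lfunE id_lfunE. Qed.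

Lemma kill_cat s t v : kill (s ++ t) v = kill t (kill s v).
Proof. exact: foldl_cat. Qed.

Lemma kill_linear s : linear (kill s).
Proof.
elim: s => [|b s IHs] a u v //=; rewrite -IHs; congr kill; exact: linearP.
Qed.
HB.instance Definition _ s :=
  GRing.isLinear.Build K V V *:%R (kill s) (kill_linear s).

Lemma shiftC b c v : shift b (shift c v) = shift c (shift b v).
Proof.
by rewrite !shiftE; vring.
Qed.

Lemma kill_shift s b v : kill s (shift b v) = shift b (kill s v).
Proof. by elim: s v => //= c s IHs v; rewrite shiftC IHs. Qed.

Lemma killC s t v : kill s (kill t v) = kill t (kill s v).
Proof. by elim: s v => //= b s IHs v; rewrite -kill_shift IHs. Qed.

Lemma mem_shift U b v : (forall u, u \in U -> D u \in U) ->
  v \in U -> shift b v \in U.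
Proof. by move=> DU Uv; rewrite shiftE memvB ?memvZ ?DU. Qed.

Lemma mem_kill U s v : (forall u, u \in U -> D u \in U) ->
  v \in U -> kill s v \in U.
Proof.
by move=> DU; elim: s v => //= b s IHs v Uv; apply/IHs/mem_shift.
Qed.

(** Modulo the stable subspace [W], [D] acts on [v] as the scalar [b], so a polynomial in [D] acts
    on [v] as its value at [b]. *)
Lemma kill_eigen W b t v : (forall u, u \in W -> D u \in W) ->
  shift b v \in W -> kill t v - \prod_(c <- t) (b - c) *: v \in W.
Proof.
move=> DW Wv; elim/last_ind: t => [|t c IHt].
  by rewrite big_nil scale1r subrr mem0v.
rewrite -cats1 kill_cat big_cat big_seq1 /=.
set a := \prod_(j <- t) _ in IHt *; set w := kill t v in IHt *.
have -> : shift c w - (a * (b - c)) *: v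
    = shift c (w - a *: v) + a *: shift b v by rewrite !shiftE; vring.
by rewrite memvD ?memvZ // mem_shift.
Qed.

End Kill.

(** * Generalized eigenspaces *)

Section GeneralizedEigenspaces.
Variables (K : fieldType) (V : vectType K) (D : 'End(V)).
Implicit Types (b c : K) (s t : seq K) (v w : V) (U W : {vspace V}).
Implicit Types (A B : pred K).

Notation stable U := (forall u, u \in U -> D u \in U).

(** By induction on [s]: once the other factors are removed, [D] acts on [v] as [b] modulo [W], and
    the product over [t] acts on it both as 0 and as a nonzero scalar. *)
Lemma kill_coprime W s t v : stable W -> {in s, forall b, b \notin t} ->
  kill D t v = 0 -> kill D s v \in W -> v \in W.
Proof.
move=> DW; elim: s v => //= b s IHs v st tv sv.
have Wv : shift D b v \in W.
  apply: IHs => //; first by move=> c sc; rewrite st ?inE ?sc ?orbT.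
  by rewrite kill_shift tv linear0.
have := kill_eigen t DW Wv; rewrite tv sub0r memvN => Wcv.
have nz : \prod_(c <- t) (b - c) != 0.
  rewrite prodf_seq_neq0; apply/allP => c tc; rewrite subr_eq0.
  by apply: contraTneq tc => <-; rewrite st ?mem_head.
by rewrite -[v]scale1r -(mulVf nz) -scalerA memvZ.
Qed.

Lemma kill_disjoint s t v : {in s, forall b, b \notin t} ->
  kill D t v = 0 -> kill D s v = 0 -> v = 0.
Proof.
move=> st tv sv; apply/eqP; rewrite -memv0.
apply: kill_coprime st tv _; last by rewrite sv mem0v.
by move=> u; rewrite memv0 => /eqP ->; rewrite linear0 mem0v.
Qed.

(** If [v] solves [(D - b) v = (D - c) w], then [D - b] maps [v - w] to [(b - c) w]; this passes
    from [t] to [c :: t]. *)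
Lemma kill_shift_surj U b t w : stable U -> b \notin t -> w \in U ->
  kill D t w = 0 -> exists v, [/\ v \in U, shift D b v = w & kill D t v = 0].
Proof.
move=> DU; elim: t w => [|c t IHt] w /=.
  by move=> _ _ ->; exists 0; rewrite mem0v linear0.
rewrite inE negb_or => /andP[nbc bt] Uw tw.
have [v [Uv bv tv]] := IHt _ bt (mem_shift c DU Uw) tw.
exists ((b - c)^-1 *: (v - w)); split; first by rewrite memvZ ?memvB.
  rewrite linearZ linearB /= bv !shiftE.
  have -> : D w - c *: w - (D w - b *: w) = (b - c) *: w by vring.
  by rewrite scalerK // subr_eq0.
by rewrite /= !linearZ !linearB /= kill_shift tv tw !(linear0, addr0).
Qed.

Lemma kill_split A U s v : stable U -> v \in U -> kill D s v = 0 ->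
  exists v1 v2, [/\ v = v1 + v2, v1 \in U /\ v2 \in U,
    kill D [seq b <- s | A b] v1 = 0 & kill D [seq b <- s | ~~ A b] v2 = 0].
Proof.
move=> DU; elim: s v => [|b s IHs] v Uv /=.
  by move=> ->; exists 0, 0; rewrite addr0 mem0v.
move=> /IHs[|w1 [w2 [defw [Uw1 Uw2] sw1 sw2]]]; first exact: mem_shift.
case: ifPn => Ab /=.
  have [|v2 [Uv2 bv2 sv2]] := kill_shift_surj (b := b) DU _ Uw2 sw2.
    by rewrite mem_filter Ab.
  exists (v - v2), v2; rewrite subrK memvB //; split=> //.
  by rewrite linearB /= defw bv2 addrK.
have [|v1 [Uv1 bv1 sv1]] := kill_shift_surj (b := b) DU _ Uw1 sw1.
  by rewrite mem_filter (negPf Ab).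
exists v1, (v - v1); rewrite addrC subrK memvB //; split=> //.
by rewrite linearB /= defw bv1 addrAC subrr add0r.
Qed.

(* v is a sum of generalized eigenvectors of D with eigenvalues in A. *)
Definition spectral A v : Prop := exists2 s, all A s & kill D s v = 0.

Lemma spectral_lin A : lin_closed (spectral A).
Proof.
split=> [|a u v [s As su] [t At tv]]; first by exists [::].
exists (s ++ t); first by rewrite all_cat As.
by rewrite kill_cat !linearP /= su killC tv !(linear0, addr0).
Qed.

Lemma spectralW A B v : {subset A <= B} -> spectral A v -> spectral B v.
Proof. by move=> sAB [s As sv]; exists s; first exact: sub_all As. Qed.

Lemma spectral_disjoint A B v : (forall b, A b -> B b -> False) ->
  spectral A v -> spectral B v -> v = 0.
Proof.
move=> dAB [s /allP As sv] [t /allP Bt tv].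
apply: kill_disjoint tv sv => b sb; apply/negP => tb.
exact: dAB (As _ sb) (Bt _ tb).
Qed.

Lemma spectral_eigen b v A : A b -> D v = b *: v -> spectral A v.
Proof.
move=> Ab Dv; exists [:: b]; first by rewrite /= Ab.
by rewrite /= shiftE Dv subrr.
Qed.

End GeneralizedEigenspaces.

(** [D - (b + c)] applied to [x, y] gives [(D - b) x, y] + [x, (D - c) y], where one of the two
    lists of roots has become shorter; the induction is on their total length. *)
Lemma spectral_lbr (K : fieldType) (L : leibnizType K) (U : {vspace L})
    (D : 'End(L)) (A B AB : pred K) (x y : L) :
  derivation_on U D -> (forall a b, A a -> B b -> AB (a + b)) ->
  x \in U -> y \in U -> spectral D A x -> spectral D B y ->
  spectral D AB (lbr x y).
Proof.
move=> [DU Dlbr] ABab Ux Uy [s As sx] [t Bt ty].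
have [n] := ubnP (size s + size t)%N.
elim: n s t x y Ux Uy As sx Bt ty => // n IHn [|b s] [|c t] x y Ux Uy /=;
  try by move=> _ -> *; rewrite lbr0l; case: (spectral_lin D AB).
  by move=> _ _ _ ->; rewrite lbr0r; case: (spectral_lin D AB).
move=> /andP[Ab As] sx /andP[Bc Bt] ty; rewrite ltnS addnS => ltn.
have lb : shift D (b + c) (lbr x y) = lbr (shift D b x) y + lbr x (shift D c y).
  rewrite !shiftE Dlbr // !lbrDl !lbrDr !lbrNl !lbrNr lbrZl lbrZr; vring.
have: spectral D AB (shift D (b + c) (lbr x y)).
  rewrite lb; apply: (lin_closedD (spectral_lin D AB)).
    apply: (IHn s (c :: t)) => //=; rewrite ?Bc ?Bt // ?mem_shift //.
    by rewrite addnS.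
  by apply: (IHn (b :: s) t) => //=; rewrite ?Ab ?As // ?mem_shift.
move=> [u ABu uxy]; exists (b + c :: u) => //=.
by rewrite ABab.
Qed.

Section ClosedField.
Variables (C : numClosedFieldType) (V : vectType C) (D : 'End(V)).

Lemma exists_eigenvector (U : {vspace V}) :
  (forall u, u \in U -> D u \in U) -> U != 0%VS ->
  exists b v, [/\ v \in U, v != 0 & D v = b *: v].
Proof.
move=> DU; rewrite -dimv_eq0 -lt0n => dU.
pose X := vbasis U; pose M := \matrix_(i < \dim U, j < \dim U) coord X j (D X`_i).
have [b /eigenvalueP[r rM nzr]] := eigenvalue_closed M dU.
pose v := \sum_i r 0 i *: X`_i.
have X_U (i : 'I_(\dim U)) : X`_i \in U by apply: vbasis_mem; rewrite mem_nth ?size_tuple.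
have crd i : coord X i v = r 0 i.
  by rewrite /v coord_sum_free // (basis_free (vbasisP U)).
exists b, v; split; first by apply: memv_suml => i _; rewrite memvZ.
  apply: contraNneq nzr => v0; apply/eqP/rowP => i.
  by rewrite -crd v0 linear0 mxE.
rewrite /v linear_sum scaler_sumr /=.
under eq_bigr do rewrite linearZ /= (coord_vbasis (DU _ (X_U _))) scaler_sumr.
rewrite exchange_big /=; apply: eq_bigr => j _.
rewrite scalerA -[b * _]/(b * r 0 j); have /rowP/(_ j) := rM.
rewrite !mxE => <-; rewrite scaler_suml; apply: eq_bigr => i _.
by rewrite mxE scalerA.
Qed.

Lemma exists_kill (U : {vspace V}) : (forall u, u \in U -> D u \in U) ->
  exists s, forall v, v \in U -> kill D s v = 0.
Proof.
have [n] := ubnP (\dim U); elim: n U => // n IHn U; rewrite ltnS => dU DU.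
have [-> | nzU] := eqVneq U 0%VS.
  by exists [::] => v; rewrite memv0 => /eqP.
have [b [w [Uw nzw Dw]]] := exists_eigenvector DU nzU.
have [|v|s sP] := IHn (shift D b @: U)%VS.
- apply: leq_trans dU; rewrite -(limg_ker_dim (shift D b) U) -[X in (X < _)%N]add0n ltn_add2r.
  rewrite lt0n dimv_eq0; apply: contraNneq nzw => U0; rewrite -memv0 -U0.
  by rewrite memv_cap Uw memv_ker shiftE Dw subrr eqxx.
- move=> /memv_imgP[u Uu ->].
  have -> : D (shift D b u) = shift D b (D u).
    by rewrite !shiftE linearB linearZ.
  by rewrite memv_img ?DU.
by exists (b :: s) => v Uv /=; rewrite sP // memv_img.
Qed.

Lemma spectral_split (A : pred C) (U : {vspace V}) v :
  (forall u, u \in U -> D u \in U) -> v \in U ->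
  exists v1 v2, [/\ v = v1 + v2, v1 \in U /\ v2 \in U,
    spectral D A v1 & spectral D (predC A) v2].
Proof.
move=> DU Uv; have [s /(_ v Uv) sv] := exists_kill DU.
have [v1 [v2 [-> Uv12 v1P v2P]]] := kill_split A DU Uv sv.
exists v1, v2; split=> //; [exists [seq b <- s | A b] | exists [seq b <- s | ~~ A b]] => //;
  exact: filter_all.
Qed.

End ClosedField.

(** * Lie's theorem *)

Lemma hyperplane_avoiding (K : fieldType) (V : vectType K) (W U : {vspace V}) y :
  (W <= U)%VS -> y \in U -> y \notin W ->
  exists H, [/\ (W <= H)%VS, y \notin H & (H + <[y]>)%VS = U].
Proof.
move=> WU Uy Wy; pose Z := (W + <[y]>)%VS.
have ZU : (Z <= U)%VS by rewrite subv_add WU -memvE.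
exists (W + (U :\: Z))%VS; split; first exact: addvSl.
  apply: contra Wy => /memv_addP[w Ww [r rP def_y]].
  suff r0 : r = 0 by rewrite def_y r0 addr0.
  apply/eqP; rewrite -memv0 -(capv_diff U Z) memv_cap rP.
  have -> : r = y - w by rewrite def_y addrAC subrr add0r.
  by rewrite memvB // /Z ?(subvP (addvSl _ _) w) // memvE addvSr.
rewrite -addvA [((U :\: Z) + _)%VS]addvC addvA -/Z addvC addv_diff.
exact/addv_idPl.
Qed.

Section KrylovSpace.
Variables (K : fieldType) (V : vectType K) (Y : 'End(V)) (v : V).

Definition krylov n : {vspace V} := <<traject Y v n>>.

Lemma krylovS n : krylov n.+1 = (krylov n + <[iter n Y v]>)%VS.
Proof. by rewrite /krylov trajectSr -cats1 span_cat span_seq1. Qed.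

Lemma sub_krylov m n : (m <= n)%N -> (krylov m <= krylov n)%VS.
Proof.
move/subnK <-; elim: (n - m)%N => //= d IHd.
by rewrite addSn krylovS; apply: subv_trans IHd (addvSl _ _).
Qed.

Lemma mem_krylov m n : (m < n)%N -> iter m Y v \in krylov n.
Proof.
move/sub_krylov/subvP; apply; rewrite krylovS.
by rewrite (subvP (addvSr _ _)) ?memv_line.
Qed.

Lemma krylov_lfun n w : w \in krylov n -> Y w \in krylov n.+1.
Proof.
apply: (span_ind (P := fun w => Y w \in krylov n.+1)) => [|_ /trajectP[i lt_in ->]].
  by split=> [|a u u' Pu Pu']; rewrite ?linear0 ?mem0v // linearP memvD ?memvZ.
by rewrite -iterS mem_krylov.
Qed.

(** The iterates cannot stay independent, so there is a least m with Y^m v in the span of the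
    earlier ones. The lemma returns m - 1, the index of the last independent iterate; m = 0 means v
    = 0. *)
Lemma krylov_stops : exists n,
  iter n.+1 Y v \in krylov n.+1 /\ iter n Y v \notin krylov n \/ v = 0.
Proof.
have exn : exists n, iter n Y v \in krylov n.
  have [//|nP] := pselect (exists n, iter n Y v \in krylov n).
  have dimZ n : (n <= \dim (krylov n))%N.
    elim: n => // n IHn; apply: leq_ltn_trans IHn _.
    rewrite ltnNge; apply/negP => le_dim; apply: nP; exists n.
    have /eqP -> : krylov n == krylov n.+1 by rewrite eqEdim sub_krylov.
    exact: mem_krylov.
  have := leq_trans (dimZ (\dim {:V}).+1) (dimvS (subvf _)).
  by rewrite ltnn.
case: (ex_minnP exn) => -[|m] mP min_m.
  by exists 0%N; right; move: mP; rewrite /krylov span_nil memv0 => /eqP.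
by exists m; left; split=> //; apply/negP => /min_m; rewrite ltnn.
Qed.

End KrylovSpace.

Section Lie.
Variables (C : numClosedFieldType) (L : leibnizType C) (V : vectType C).
Variable (T : L -> 'End(V)).
Hypothesis linT : forall a x y v, T (a *: x + y) v = a *: T x v + T y v.

Lemma dersS (U H : {vspace L}) m : (H <= U)%VS -> (ders H m <= ders U m)%VS.
Proof. by move=> HU; elim: m => //= m IHm; apply: lbrvS. Qed.

(* Apply T h - lambda h to the first linear relation between the (T y)^i v.
   Its leading coefficient shows that lambda vanishes on brackets [y, h]. *)
Lemma weight_invariant (H : {vspace L}) (W : {vspace V}) (y : L) (v : V)
    (lambda : L -> C) :
  (forall h, h \in H -> lbr y h \in H) ->
  (forall w, w \in W -> T y w \in W) ->
  (forall h w, h \in H -> w \in W ->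
     T (lbr y h) w = T h (T y w) - T y (T h w)) ->
  v \in W -> v != 0 -> (forall h, h \in H -> T h v = lambda h *: v) ->
  exists n, [/\ v \in krylov (T y) v n, (krylov (T y) v n <= W)%VS,
    forall w, w \in krylov (T y) v n -> T y w \in krylov (T y) v n &
    forall w h, w \in krylov (T y) v n -> h \in H -> T h w = lambda h *: w].
Proof.
move=> yH TyW rep Wv nzv hv; set Y := T y; set Z := krylov Y v.
pose vi i := iter i Y v.
have W_vi i : vi i \in W by elim: i => //= i; apply: TyW.
have TYE h i : h \in H -> T h (vi i.+1) = Y (T h (vi i)) + T (lbr y h) (vi i).
  by move=> Hh; rewrite rep //= addrC subrK.
have main i h : h \in H -> exists2 z, z \in Z i &
    T h (vi i.+1) = lambda h *: vi i.+1 + (i.+1%:R * lambda (lbr y h)) *: vi i + z.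
  elim: i h => [|i IHi] h Hh.
    exists 0; rewrite ?mem0v // TYE // !hv ?yH //= linearZ /=; vring.
  have [z Zz Tz] := IHi _ Hh; have [z' Zz' Tz'] := IHi _ (yH _ Hh).
  exists (Y z + (i.+1%:R * lambda (lbr y (lbr y h))) *: vi i + z').
    rewrite !memvD ?krylov_lfun ?memvZ ?mem_krylov //.
    by rewrite (subvP (sub_krylov _ _ (leqnSn i))).
  by rewrite TYE // Tz Tz' -[i.+2%:R]natr1 /=; vring.
have mainW i h : h \in H -> exists2 z, z \in Z i & T h (vi i) = lambda h *: vi i + z.
  case: i => [|i] Hh; first by exists 0; rewrite ?mem0v // hv // addr0.
  have [z Zz ->] := main i h Hh; rewrite -addrA; eexists; last by [].
  by rewrite memvD ?memvZ ?mem_krylov // (subvP (sub_krylov _ _ (leqnSn i))).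
have [n [[vn vnN]|v0]] := krylov_stops Y v; last by rewrite v0 eqxx in nzv.
have lambda0 h : h \in H -> lambda (lbr y h) = 0.
  move=> Hh; have [z Zz Tz] := main n h Hh.
  (* On the Krylov space of length n + 1, [T h - lambda h] lowers the length. As that space is
     stable, this applies to Y^(n+1) v and puts (n + 1) lambda([y, h]) Y^n v into the space of
     length n; in characteristic 0 the value of [lambda] must vanish. *)
  have Zn u0 : u0 \in Z n.+1 -> T h u0 - lambda h *: u0 \in Z n.
    apply: (span_ind (P := fun u => T h u - lambda h *: u \in Z n)).
      split=> [|a u u' Pu Pu']; first by rewrite !linear0 addr0 mem0v.
      have -> : T h (a *: u + u') - lambda h *: (a *: u + u') =
        a *: (T h u - lambda h *: u) + (T h u' - lambda h *: u') by vring.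
      by rewrite memvD ?memvZ.
    move=> _ /trajectP[i lt_in ->]; have [w Zw ->] := mainW i h Hh.
    by rewrite addrAC subrr add0r (subvP (sub_krylov Y v (lt_in : i <= n)%N)).
  have := memvB (Zn _ vn) Zz; rewrite -[iter n.+1 Y v]/(vi n.+1) Tz.
  have -> : forall a b c : V, a + b + c - a - c = b by move=> a b c; vring.
  apply: contraTeq => nz_l; apply: contra vnN => /(memvZ (n.+1%:R * lambda (lbr y h))^-1).
  by rewrite scalerA mulVf ?scale1r // mulf_neq0 // pnatr_eq0.
exists n.+1; split=> [||w|w h].
- exact: (mem_krylov Y v (ltn0Sn n)).
- by apply/span_subvP => _ /trajectP[i _ ->]; apply: W_vi.
- move=> /krylov_lfun; apply/subvP; rewrite krylovS subv_add subvv -memvE.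
  exact: vn.
move=> + Hh; apply: (span_ind (P := fun w => T h w = lambda h *: w)).
  split=> [|a u u' Pu Pu']; first by rewrite linear0 scaler0.
  by rewrite (linearP (T h)) /= Pu Pu' scalerDr !scalerA mulrC.
move=> _ /trajectP[i _ ->]; elim: i h Hh => [|i IHi] h Hh; first exact: hv.
by rewrite TYE // !IHi ?yH // lambda0 // scale0r addr0 linearZ.
Qed.

(** Lie's theorem, by induction on [U] through a hyperplane containing [U, U]. [T] reverses
    products, as right multiplications do, and is required to respect brackets only on [W], so that
    it may be an action compressed to a complement. *)
Lemma lie_eigenvector (U : {vspace L}) (W : {vspace V}) :
  lb_solvable U -> (lbrv U U <= U)%VS -> W != 0%VS ->
  (forall x w, x \in U -> w \in W -> T x w \in W) ->
  (forall x y w, x \in U -> y \in U -> w \in W ->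
     T (lbr x y) w = T y (T x w) - T x (T y w)) ->
  exists2 v, v \in W /\ v != 0 & forall x, x \in U -> exists c, T x v = c *: v.
Proof.
have [n] := ubnP (\dim U); elim: n U W => // n IHn U W; rewrite ltnS => dU.
move=> solU UU nzW UW rep.
have [U0 | nzU] := eqVneq U 0%VS.
  exists (vpick W); first by rewrite memv_pick vpick0.
  move=> x; rewrite U0 memv0 => /eqP ->; exists 0.
  have := linT 1 0 0 (vpick W); rewrite !scale1r addr0 scale0r.
  by move/eqP; rewrite -subr_eq0 opprD addNKr oppr_eq0 => /eqP.
have [y Uy UUy] : exists2 y, y \in U & y \notin lbrv U U.
  apply/subvPn; apply: contra nzU => UleUU; have [m] := solU.
  have /eqP eUU : U == lbrv U U by rewrite -(geq_leqif (dimv_leqif_eq UleUU)) dimvS.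
  suff -> : ders U m = U by move=> ->.
  by elim: m => //= m ->.
have [H [UUH Hy defU]] := hyperplane_avoiding UU Uy UUy.
have HU : (H <= U)%VS by rewrite -defU addvSl.
have sHU := subvP HU.
have yH h : h \in H -> lbr y h \in H.
  by move=> Hh; apply/(subvP UUH)/mem_lbrv => //; apply: sHU.
have [| | | |x w /sHU|x x' w /sHU Ux /sHU|v [Wv nzv] vP] := IHn H W.
- apply: leq_trans dU; rewrite ltn_neqAle dimvS // andbT.
  by apply: contra Hy; rewrite (dimv_leqif_eq HU) => /eqP ->.
- by have [m m0] := solU; exists m; apply/eqP; rewrite -subv0 -m0 dersS.
- exact: subv_trans (lbrvS HU HU) UUH.
- by [].
- exact: UW.
- exact: rep.
have /choice[lambda lambdaP] h : exists c, h \in H -> T h v = c *: v.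
  by have [/vP[c vc]|_] := boolP (h \in H); [exists c | exists 0].
have [w|h w /sHU||||m [Zv ZW YZ hZ]] := @weight_invariant H W y v lambda yH.
- exact: UW.
- by move=> Uh; apply: rep.
- exact: Wv.
- exact: nzv.
- exact: lambdaP.
have [|b [w [Zw nzw Yw]]] := exists_eigenvector YZ.
  by apply: contraNneq nzv => Z0; rewrite -memv0 -Z0.
exists w => [|x]; first by rewrite (subvP ZW).
rewrite -defU => /memv_addP[h Hh [_ /vlineP[a ->] ->]].
exists (a * b + lambda h).
by rewrite addrC linT Yw (hZ w h Zw Hh) scalerDl scalerA.
Qed.

End Lie.

Section RightStable.
Variables (C : numClosedFieldType) (L : leibnizType C).
Hypothesis solL : lb_solvable (fullv : {vspace L}).

Definition rstable (U : {vspace L}) := forall u y, u \in U -> lbr u y \in U.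

(** Lie's theorem for the right action on [U / W]. The quotient is modelled on the complement
    [U :\: W] by following each right multiplication with the projection [pi] along [W]. *)
Lemma exists_weight (W U : {vspace L}) :
  rstable W -> rstable U -> (W <= U)%VS -> W != U ->
  exists u (chi : L -> C), [/\ u \in U, u \notin W, scalar chi &
    forall y, lbr u y - chi y *: u \in W].
Proof.
move=> sW sU WU neWU; pose pi := addv_pi1 U W.
have piW w : w \in W -> pi w = 0.
  move=> Ww; apply/eqP; rewrite -memv0 -(capv_diff U W) memv_cap memv_pi /=.
  have := addv_pi1_pi2 (subvP (addvSr U W) _ Ww) => /(canRL (addrK _)) ->.
  by rewrite memvB ?memv_pi2.
have pi_mod w : w \in U -> w - pi w \in W.
  move=> Uw; have := addv_pi1_pi2 (subvP (addvSl U W) _ Uw) => {1}<-.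
  by rewrite addrAC subrr add0r memv_pi2.
pose T y : 'End(L) := (pi \o adr y)%VF.
have TE y w : T y w = pi (lbr w y) by rewrite comp_lfunE adrE.
have linT a x y w : T (a *: x + y) w = a *: T x w + T y w.
  by rewrite !TE lbrDr lbrZr linearP.
have [| |x w _|x y w _ _|u [UWu nzu] uP] := lie_eigenvector linT (W := (U :\: W)%VS) solL.
- exact: subvf.
- by apply: contra neWU; rewrite diffv_eq0 eqEsubv WU.
- by move=> _; rewrite TE memv_pi.
- move=> UWw; rewrite !TE; have Uw := subvP (diffvSl _ _) _ UWw.
  have pi_pi a b : a \in U -> pi (lbr (pi a) b) = pi (lbr a b).
    by move=> /pi_mod/(sW _ b)/piW; rewrite lbrDl lbrNl linearB => /eqP; rewrite subr_eq0 => /eqP.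
  by rewrite !pi_pi ?sU // -linearB -lbr_lbr.
have Uu := subvP (diffvSl _ _) _ UWu.
pose chi y : C := coord [tuple u] 0 (T y u).
have chiE y : T y u = chi y *: u.
  have [c uc] := uP y (memvf y); rewrite /chi uc linearZ /=.
  have /= -> := @coord_free _ _ 1 [tuple u] 0 0; rewrite ?eqxx ?mulr1 //.
  exact: basis_free (seq1_basis nzu).
exists u, chi; split=> //.
- by apply: contra nzu => Wu; rewrite -memv0 -(capv_diff U W) memv_cap UWu.
- by move=> a x y; rewrite /chi !TE lbrDr lbrZr !linearP.
- by move=> y; rewrite -chiE TE pi_mod ?sU.
Qed.

End RightStable.

(** * Families of vectors and nilpotent algebras *)

Section FamilySpan.
Variables (K : fieldType) (V : vectType K) (I : finType).
Implicit Types (e : I -> V).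

Definition fspan e : {vspace V} := <<codom e>>.

Lemma fspanP e v : reflect (exists c : I -> K, v = \sum_i c i *: e i) (v \in fspan e).
Proof.
apply: (iffP idP) => [|[c ->]]; last first.
  by apply: memv_suml => i _; rewrite memvZ // memv_span // codom_f.
apply: (span_ind (P := fun v => exists c : I -> K, v = \sum_i c i *: e i)).
  split=> [|a _ _ [c ->] [d ->]].
    by exists (fun=> 0); rewrite big1 // => i _; rewrite scale0r.
  exists (fun i => a * c i + d i); rewrite scaler_sumr -big_split /=.
  by apply: eq_bigr => i _; rewrite scalerDl scalerA.
move=> _ /codomP[i ->]; exists (fun j => (j == i)%:R).
rewrite (bigD1 i) //= eqxx scale1r big1 ?addr0 // => j /negPf ->.
by rewrite scale0r.
Qed.

Lemma mem_fspan e i : e i \in fspan e.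
Proof. by rewrite memv_span ?codom_f. Qed.

Lemma fspan_sub e (U : {vspace V}) : (forall i, e i \in U) -> (fspan e <= U)%VS.
Proof. by move=> eU; apply/span_subvP => _ /codomP[i ->]. Qed.

Lemma fspan_ind e (P : V -> Prop) : lin_closed P -> (forall i, P (e i)) ->
  forall v, v \in fspan e -> P v.
Proof. by move=> linP Pe; apply: span_ind => // _ /codomP[i ->]. Qed.

Definition lindep_free e := forall c : I -> K, \sum_i c i *: e i = 0 -> forall i, c i = 0.

Lemma free_codom e : lindep_free e -> free (codom e).
Proof.
move=> free_e; rewrite -[codom e]/(tval (codom_tuple e)); apply/freeP => c c0 m.
rewrite -[m]enum_valK; apply: (free_e (fun j => c (enum_rank j))).
rewrite (reindex _ (onW_bij _ (enum_val_bij I))) /=.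
transitivity (\sum_(j < #|I|) c j *: (codom_tuple e)`_j) => //; apply: eq_bigr => j _.
by rewrite enum_valK nth_codom.
Qed.

Lemma dim_fspan e : lindep_free e -> \dim (fspan e) = #|I|.
Proof. by move=> /free_codom; rewrite -[#|I|](size_codom e) => /eqP. Qed.

Definition fcoord e i v : K := coord (codom_tuple e) (enum_rank i) v.

Lemma fcoord_scalar e i : scalar (fcoord e i).
Proof. by move=> a u v; rewrite /fcoord linearP. Qed.

Lemma fcoordE e c i : lindep_free e -> fcoord e i (\sum_j c j *: e j) = c i.
Proof.
move=> free_e; rewrite /fcoord (reindex _ (onW_bij _ (enum_val_bij I))) /=.
under eq_bigr => j _ do rewrite -(nth_codom 0 e j).
rewrite -[codom e]/(tval (codom_tuple e)).
by rewrite (coord_sum_free (fun j => c (enum_val j))) ?enum_rankK // free_codom.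
Qed.

End FamilySpan.

(** Vectors satisfying [P] are adjoined to 0 until none is left, which the dimension bounds.
    Spectral subspaces and blocks, given as predicates, become subspaces in this way. *)
Lemma lin_closed_vspace (K : fieldType) (V : vectType K) (P : V -> Prop) :
  lin_closed P -> exists U : {vspace V}, forall v, v \in U <-> P v.
Proof.
move=> linP.
suff main n (U : {vspace V}) : (\dim {:V} - \dim U <= n)%N ->
    (forall v, v \in U -> P v) -> exists W : {vspace V}, forall v, v \in W <-> P v.
  apply: (main _ 0%VS (leqnn _)) => v; rewrite memv0 => /eqP ->; exact: linP.1.
elim: n U => [|n IHn] U dU UP.
  exists U => v; split=> [|_]; first exact: UP.
  have /eqP -> : U == fullv by rewrite eqEdim subvf -subn_eq0 -leqn0.
  exact: memvf.
have [PU | /existsNP[v /not_implyP[Pv /negP Uv]]] := pselect (forall v, P v -> v \in U).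
  by exists U => v; split; [apply: UP | apply: PU].
apply: (IHn (U + <[v]>)%VS) => [|w].
  rewrite leq_subLR -ltnS -addSn; move: dU; rewrite leq_subLR => /leq_ltn_trans; apply.
  rewrite ltnS addnS -addSn leq_add2r ltn_neqAle dimvS ?addvSl // andbT.
  apply: contra Uv; rewrite (dimv_leqif_eq (addvSl _ _)) => /eqP ->.
  by rewrite memvE addvSr.
by apply: addv_ind => // _ /vlineP[a ->]; apply: lin_closedZ.
Qed.

Section Nilpotent.
Variables (K : fieldType) (L : leibnizType K) (N : {vspace L}).

Hypothesis NN : (lbrv N N <= N)%VS.

Lemma lcs_sub m : (lcs N m <= N)%VS.
Proof.
elim: m => [|m IHm]; first exact: subvv.
exact: subv_trans (lbrvS IHm (subvv _)) NN.
Qed.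

Lemma lcsS m : (lcs N m.+1 <= lcs N m)%VS.
Proof.
elim: m => [|m IHm] //=.
exact: lbrvS.
Qed.

(** A right factor from N^2 counts twice: the Leibniz identity opens it into two successive right
    factors from N. Here [lcs N m] is N^(m+1). *)
Lemma lbrv_lcs_sq m : (lbrv (lcs N m) (lbrv N N) <= lcs N m.+2)%VS.
Proof.
apply/lbrvP => u v Nu; move: v.
apply: lbrv_ind => [|a b Na Nb].
  split=> [|c v w Pv Pw]; first by rewrite lbr0r mem0v.
  by rewrite lbrDr lbrZr memvD ?memvZ.
by rewrite lbr_lbr memvB // !mem_lbrv.
Qed.

Lemma nilpotent_gen (P G : L -> Prop) : lb_nilpotent N -> lin_closed P ->
  (forall b, b \in N -> exists q, [/\ q \in N, G q, P q & b - q \in lbrv N N]) ->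
  (forall p q, p \in N -> q \in N -> P p -> G q -> P (lbr p q)) ->
  forall v, v \in N -> P v.
Proof.
move=> [M M0] linP genN Plbr.
have step m v : v \in lcs N m ->
    exists p, [/\ p \in lcs N m, P p & v - p \in lcs N m.+1].
  elim: m v => [|m IHm] v.
    by move=> /genN[q [Nq _ Pq bq]]; exists q.
  apply: (lbrv_ind (P := fun v =>
      exists p, [/\ p \in lcs N m.+1, P p & v - p \in lcs N m.+2]))
    => [|a b /IHm[p [Np Pp ap]] /genN[q [Nq Gq Pq bq]]].
    split=> [|a u w [p [Np Pp up]] [q [Nq Pq vq]]].
      by exists 0; rewrite subr0 !mem0v; split=> //; exact: linP.1.
    exists (a *: p + q); split; first by rewrite memvD ?memvZ.
      exact: linP.2.
    have -> : a *: u + w - (a *: p + q) = a *: (u - p) + (w - q) by vring.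
    by rewrite memvD ?memvZ.
  exists (lbr p q); split; first exact: mem_lbrv.
    by apply: Plbr => //; apply: (subvP (lcs_sub m)).
  have Nb : b \in N by rewrite -(subrK q b) memvD // (subvP NN).
  have -> : lbr a b - lbr p q = lbr (a - p) b + lbr p (b - q).
    by rewrite lbrDl lbrDr lbrNl lbrNr; vring.
  by rewrite memvD ?(mem_lbrv ap) //; apply/(subvP (lbrv_lcs_sq m))/mem_lbrv.
have main d v : (d <= M)%N -> v \in lcs N (M - d) -> P v.
  elim: d v => [|d IHd] v.
    by rewrite subn0 M0 memv0 => _ /eqP ->; exact: linP.1.
  move=> ltd /step[p [_ Pp]]; rewrite -subSn // subSS => /IHd Pvp.
  by rewrite -(subrK p v); apply: lin_closedD => //; apply: Pvp; apply: ltnW.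
by move=> v Nv; apply: (main M) => //; rewrite subnn.
Qed.

End Nilpotent.

Lemma derivation_sq (K : fieldType) (L : leibnizType K) (N : {vspace L}) D u :
  derivation_on N D -> u \in lbrv N N -> D u \in lbrv N N.
Proof.
move=> [DN Dlbr]; apply: (lbrv_ind (P := fun u => D u \in lbrv N N)).
  by split=> [|a v w Pv Pw]; rewrite ?linear0 ?mem0v // linearP memvD ?memvZ.
by move=> a b Na Nb; rewrite Dlbr // memvD // mem_lbrv ?DN.
Qed.

(** The eigenvalues on N are sums of eigenvalues on N / N^2, so they stay in a set [A] closed under
    addition. *)
Lemma nilpotent_spectral (C : numClosedFieldType) (L : leibnizType C)
    (N : {vspace L}) (D : 'End(L)) (A : pred C) s :
  (lbrv N N <= N)%VS -> lb_nilpotent N -> derivation_on N D -> all A s ->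
  (forall a b, A a -> A b -> A (a + b)) ->
  (forall v, v \in N -> kill D s v \in lbrv N N) ->
  forall v, v \in N -> spectral D A v.
Proof.
move=> NN nilN derD As AD sN.
apply: (nilpotent_gen (G := spectral D A) NN) => //; first exact: spectral_lin.
  move=> b /[dup] Nb /(spectral_split A derD.1)[v1 [v2 [-> [Nv1 Nv2] Av1 [t At tv2]]]].
  exists v1; split=> //; rewrite addrAC subrr add0r.
  apply: kill_coprime tv2 (sN _ Nv2); first by move=> u; apply: derivation_sq.
  by move=> c sc; apply: contraL (allP As _ sc) => /(allP At).
by move=> p q Np Nq Ap Aq; apply: spectral_lbr derD _ Np Nq Ap Aq.
Qed.

Section Generators.
Variables (K : fieldType) (L : leibnizType K) (N : {vspace L}).
Hypothesis NN : (lbrv N N <= N)%VS.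
Hypothesis nilN : lb_nilpotent N.

Record generates k (e : 'I_k -> L) : Prop := Generates {
  gn_mem : forall i, e i \in N;
  gn_gen : (fspan e + lbrv N N)%VS = N
}.

Lemma generates_ind k (e : 'I_k -> L) (P : L -> Prop) : generates e ->
  lin_closed P -> (forall i, P (e i)) ->
  (forall v i, v \in N -> P v -> P (lbr v (e i))) -> forall v, v \in N -> P v.
Proof.
move=> [eN gen] linP Pe Pve.
apply: (nilpotent_gen (G := fun q => q \in fspan e) NN nilN) => //.
  move=> b; rewrite -{1}gen => /memv_addP[q Eq [w NNw ->]].
  exists q; rewrite addrAC subrr add0r; split=> //.
    by apply: (subvP (fspan_sub eN)).
  exact: fspan_ind Eq.
move=> p q Np _ Pp; apply: (fspan_ind (P := fun q => P (lbr p q))) => [|i].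
  split=> [|a u v Pu Pv]; first by rewrite lbr0r; exact: linP.1.
  by rewrite lbrDr lbrZr; exact: linP.2.
exact: Pve.
Qed.

End Generators.

(** * Weights and the nilradical *)

Section Weights.
Variables (C : numClosedFieldType) (L : leibnizType C).
Hypothesis solL : lb_solvable (fullv : {vspace L}).
Implicit Types (U W I N : {vspace L}) (chi : L -> C).

(** [chi] is the weight of the right multiplications on the class of [u] modulo [W]. *)
Definition weight_mod W u chi : Prop :=
  [/\ rstable W, u \notin W, scalar chi & forall y, lbr u y - chi y *: u \in W].

Lemma rstable0 : rstable (0%VS : {vspace L}).
Proof. by move=> u y; rewrite !memv0 => /eqP ->; rewrite lbr0l. Qed.

Lemma rstable_adr U y u : rstable U -> u \in U -> adr y u \in U.
Proof. by move=> sU Uu; rewrite adrE sU. Qed.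

Lemma rstable_lbrv U I : rstable U -> rstable I -> rstable (lbrv U I).
Proof.
move=> sU sI u y; apply: (lbrv_ind (P := fun u => lbr u y \in lbrv U I)).
  split=> [|a v w Pv Pw]; first by rewrite lbr0l mem0v.
  by rewrite lbrDl lbrZl memvD ?memvZ.
by move=> v z Uv Iz; rewrite lbr_leibniz memvD ?mem_lbrv ?sU ?sI.
Qed.

Lemma rstable_weight W u chi : weight_mod W u chi -> rstable (W + <[u]>)%VS.
Proof.
move=> [sW _ _ uP] _ y /memv_addP[w Ww [_ /vlineP[a ->] ->]].
rewrite lbrDl lbrZl -(subrK (chi y *: u) (lbr u y)) scalerDr addrA memv_add //.
  by rewrite memvD ?memvZ ?sW.
by rewrite !memvZ ?memv_line.
Qed.

Lemma weight_exists W U : rstable W -> rstable U -> (W <= U)%VS -> W != U ->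
  exists u chi, [/\ weight_mod W u chi, u \in U, (W + <[u]> <= U)%VS &
    \dim (W + <[u]>) = (\dim W).+1].
Proof.
move=> sW sU WU neWU; have [u [chi [Uu Wu linchi uP]]] := exists_weight solL sW sU WU neWU.
exists u, chi; split=> //; first by rewrite subv_add WU -memvE.
rewrite dimv_disjoint_sum ?dim_vline.
  by rewrite (contraNneq _ Wu) ?addn1 // => ->; rewrite mem0v.
apply/eqP; rewrite -subv0; apply/subvP => w; rewrite memv_cap => /andP[Ww /vlineP[a def_w]].
have [->|nza] := eqVneq w 0; first exact: mem0v.
case/negP: Wu; rewrite -[u]scale1r -(@mulVf _ a) -?scalerA -?def_w ?memvZ //.
by apply: contraNneq nza => a0; rewrite def_w a0 scale0r.
Qed.

(** On a line of the quotient the right multiplications by [y] and [z] are scalars, hence commute,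
    and [y, z] acts as their commutator. *)
Lemma weight_lbr W u chi y z : weight_mod W u chi -> chi (lbr y z) = 0.
Proof.
move=> [sW Wu linchi uP]; apply/eqP; apply: contraNT Wu => nz.
suff: chi (lbr y z) *: u \in W by move/(memvZ (chi (lbr y z))^-1); rewrite scalerK.
have H a b : lbr (lbr u a) b - (chi a * chi b) *: u \in W.
  have := memvD (sW _ b (uP a)) (memvZ (chi a) (uP b)).
  by rewrite lbrDl lbrNl lbrZl scalerBr scalerA addrA subrK.
have := memvB (memvB (H y z) (H z y)) (uP (lbr y z)).
rewrite lbr_lbr [chi z * chi y]mulrC.
by have -> : forall a b c d : L, a - c - (b - c) - (a - b - d) = d by move=> a b c d; vring.
Qed.

Lemma weights_nilpotent I : rstable I ->
  (forall W u chi, weight_mod W u chi -> forall y, y \in I -> chi y = 0) ->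
  lb_nilpotent I.
Proof.
move=> sI I0.
(* Climb from [W] by adding one weight vector at a time. The last subspace before [U] works: the
   weight of [U] over it vanishes on [I], so brackets with [I] fall into it. *)
have proper W U : rstable W -> rstable U -> (W <= U)%VS -> W != U ->
    exists W', [/\ (W' <= U)%VS, W' != U & (lbrv U I <= W')%VS].
  have [n] := ubnP (\dim U - \dim W); elim: n W => // n IHn W.
  rewrite ltnS => ltn sW sU WU neWU.
  have [u [chi [wu Uu W1U dW1]]] := weight_exists sW sU WU neWU.
  have [defU | neW1] := eqVneq (W + <[u]>)%VS U; last first.
    apply: IHn neW1 => //; last exact: rstable_weight wu.
    rewrite dW1 subnS prednK // subn_gt0 ltn_neqAle dimvS // andbT.
    by apply: contra neWU; rewrite (dimv_leqif_eq WU).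
  exists W; split=> //; apply/lbrvP => v y; rewrite -defU.
  move=> /memv_addP[w Ww [_ /vlineP[a ->] ->]] Iy.
  have [_ _ _ /(_ y)] := wu; rewrite (I0 _ _ _ wu _ Iy) scale0r subr0 => uy.
  by rewrite lbrDl lbrZl memvD ?sW // memvZ.
have main U : rstable U -> exists m, iter m (fun V => lbrv V I) U = 0%VS.
  have [n] := ubnP (\dim U); elim: n U => // n IHn U; rewrite ltnS => dU sU.
  have [U0 | nzU] := eqVneq U 0%VS; first by exists 0%N.
  have [|W [WU neWU UIW]] := proper _ _ rstable0 sU (sub0v _); first by rewrite eq_sym.
  have [||m m0] := IHn (lbrv U I); last by exists m.+1; rewrite iterSr.
    apply: leq_trans dU; apply: leq_ltn_trans (dimvS UIW) _.
    rewrite ltn_neqAle dimvS // andbT.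
    by apply: contra neWU; rewrite (dimv_leqif_eq WU).
  exact: rstable_lbrv.
exact: main sI.
Qed.

Lemma lbrv_full_nilradical N : lb_nilradical N fullv -> forall x y, lbr x y \in N.
Proof.
move=> [_ _ maxN] x y; have: (lbrv (fullv : {vspace L}) fullv <= N)%VS.
  apply: maxN; first by split; rewrite ?subvf // lbrvS ?subvf.
  apply: weights_nilpotent => [u z _|W u chi wu]; first by rewrite mem_lbrv ?memvf.
  move=> v; apply: (lbrv_ind (P := fun v => chi v = 0)).
    have [_ _ linchi _] := wu; split=> [|a v1 v2 P1 P2].
      have := linchi (-1) 0 0; rewrite scaler0 addr0 mulN1r.
      by rewrite addNr.
    by rewrite linchi P1 P2 mulr0 addr0.
  by move=> a b _ _; apply: weight_lbr wu.
by move/subvP; apply; rewrite mem_lbrv ?memvf.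
Qed.

(** Brackets lie in [N], where [y] acts nilpotently; so [y] acts nilpotently on the whole algebra
    and its weights vanish. *)
Lemma nil_weight N y W u chi : (forall x y, lbr x y \in N) ->
  (forall v, v \in N -> spectral (adr y) (pred1 0) v) ->
  weight_mod W u chi -> chi y = 0.
Proof.
move=> LN Ny [sW Wu linchi uP]; apply: contraNeq Wu => nz.
have [s s0 su] := Ny _ (LN u y).
apply: (@kill_coprime _ _ (adr y) W [:: chi y] (0 :: s)).
- by move=> w; apply: rstable_adr.
- move=> _ /[!inE] /eqP ->; rewrite negb_or nz /=.
  by apply: contra nz => /(allP s0).
- by rewrite /= shiftE scale0r subr0 adrE.
- by rewrite /= shiftE adrE uP.
Qed.

(** [N + <[y]>] is an ideal because it contains all brackets, and it is nilpotent because all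
    weights vanish on it; maximality of [N] absorbs [y]. *)
Lemma mem_nilradical N y : lb_nilradical N fullv ->
  (forall v, v \in N -> spectral (adr y) (pred1 0) v) -> y \in N.
Proof.
move=> nilN Ny; have LN := lbrv_full_nilradical nilN.
have [[_ idNl idNr] [M M0] maxN] := nilN.
suff: (N + <[y]> <= N)%VS by rewrite subv_add -memvE => /andP[].
have sub_ideal U : (lbrv U fullv <= N + <[y]>)%VS /\ (lbrv fullv U <= N + <[y]>)%VS.
  by split; apply: subv_trans (addvSl _ _); apply/lbrvP => *; apply: LN.
apply: maxN; first by split; [exact: subvf | exact: (sub_ideal _).1 | exact: (sub_ideal _).2].
apply: weights_nilpotent => [u z _|W u chi wu x].
  by rewrite (subvP (addvSl _ _)).
move=> /memv_addP[n Nn [_ /vlineP[a ->] ->]].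
have [_ _ linchi _] := wu; rewrite addrC linchi (nil_weight LN Ny wu) mulr0 add0r.
apply: (nil_weight LN _ wu) => v Nv; exists (nseq M 0); first by rewrite all_nseq /= eqxx orbT.
suff: kill (adr n) (nseq M 0) v \in lcs N M by rewrite M0 memv0 => /eqP.
elim: M {M0} => //= M IHM.
by rewrite kill_shift shiftE scale0r subr0 adrE mem_lbrv.
Qed.

(** The weights along a flag from [W] to [U], with multiplicity. Each of them is also attained, for
    each single [x], by an honest eigenvector in [U], which may depend on [x]. *)
Lemma flag_weights W U : rstable W -> rstable U -> (W <= U)%VS ->
  exists chis : seq (L -> C), [/\ size chis = (\dim U - \dim W)%N,
    forall chi, List.In chi chis -> scalar chi,
    forall x v, v \in U -> kill (adr x) [seq chi x | chi <- chis] v \in W &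
    forall x chi, List.In chi chis ->
      exists v, [/\ v \in U, v != 0 & lbr v x = chi x *: v]].
Proof.
have [n] := ubnP (\dim U - \dim W); elim: n W => // n IHn W.
rewrite ltnS => ltn sW sU WU.
have [<- | neWU] := eqVneq W U; first by exists [::]; rewrite subnn; split.
have [u [chi [wu Uu W1U dW1]]] := weight_exists sW sU WU neWU.
have sW1 := rstable_weight wu.
have lt_dim : (\dim W < \dim U)%N.
  rewrite ltn_neqAle dimvS // andbT.
  by apply: contra neWU; rewrite (dimv_leqif_eq WU).
have [|chis [szc linc killc eigc]] := IHn _ _ sW1 sU W1U.
  by rewrite dW1 subnS prednK // subn_gt0.
have W1W x v : v \in (W + <[u]>)%VS -> shift (adr x) (chi x) v \in W.
  move=> /memv_addP[w Ww [_ /vlineP[a ->] ->]]; have [_ _ _ uP] := wu.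
  rewrite linearD memvD //=; last by rewrite linearZ; apply: memvZ; rewrite /= shiftE adrE.
  by apply: mem_shift => // v1; apply: rstable_adr.
exists (chi :: chis); split.
- by rewrite /= szc dW1 subnS prednK // subn_gt0.
- by move=> chi' [<-|]; [case: wu | apply: linc].
- by move=> x v Uv; rewrite /= kill_shift; apply/W1W/killc.
move=> x chi' [<-|]; last exact: eigc.
(* [adr x - chi x] sends [W + <[u]>] into [W], whose dimension is smaller by one, so it has a kernel
   there. *)
have: ((W + <[u]>) :&: lker (shift (adr x) (chi x)))%VS != 0%VS.
  rewrite -dimv_eq0 -lt0n -(ltn_add2r (\dim (shift (adr x) (chi x) @: (W + <[u]>)))).
  rewrite add0n limg_ker_dim dW1 ltnS dimvS //.
  by apply/subvP => _ /memv_imgP[v vP ->]; apply: W1W.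
set K := (_ :&: _)%VS => nzK; have := memv_pick K.
rewrite memv_cap memv_ker shiftE adrE subr_eq0 => /andP[W1v /eqP vx].
by exists (vpick K); split; rewrite ?vpick0 ?(subvP W1U).
Qed.

End Weights.

(** * Frames *)

Record frame (K : fieldType) (L : leibnizType K) (N : {vspace L}) (k : nat)
    (e x : 'I_k -> L) : Prop := Frame {
  fr_nil : lb_nilpotent N;
  fr_lbr : forall y z, lbr y z \in N;
  fr_mem : forall i, e i \in N;
  fr_gen : (fspan e + lbrv N N)%VS = N;
  fr_free : forall c : 'I_k -> K, \sum_i c i *: e i \in lbrv N N -> forall i, c i = 0;
  fr_ex : forall i j, lbr (e i) (x j) = (i == j)%:R *: e i;
  fr_xx : forall i j, lbr (x i) (x j) = 0;
  fr_sum : (N + fspan x)%VS = fullv;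
  fr_xfree : forall c : 'I_k -> K, \sum_i c i *: x i \in N -> forall i, c i = 0
}.

Section ExistsFrame.
Variables (C : numClosedFieldType) (L : leibnizType C).

Definition natgeq m : pred C := fun b => `[< exists2 n : nat, (m <= n)%N & b = n%:R >].

Lemma natgeqP m n : natgeq m n%:R = (m <= n)%N.
Proof.
apply/asboolP/idP => [[p mp /eqP]|mn]; last by exists n.
by rewrite eqr_nat => /eqP ->.
Qed.

Lemma natgeqD m n a b : natgeq m a -> natgeq n b -> natgeq (m + n) (a + b).
Proof.
move=> /asboolP[p mp ->] /asboolP[q nq ->].
by rewrite -natrD natgeqP leq_add.
Qed.

Lemma exists_frame (N Q : {vspace L}) k :
  maximal_extension N Q k -> exists e x : 'I_k -> L, frame N e x.
Proof.
move=> [solL nilradN [sumNQ capNQ] dQ dNN].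
have LN := lbrv_full_nilradical solL nilradN.
have [_ nilN _] := nilradN.
have sN : rstable N by move=> u y _; apply: LN.
have NN : (lbrv N N <= N)%VS by apply/lbrvP.
have sNN : rstable (lbrv N N) by apply: rstable_lbrv.
have dL : \dim {:L} = (\dim N + k)%N.
  by rewrite -dQ -sumNQ dimv_disjoint_sum.
have derN (y : L) : derivation_on N (adr y).
  by split=> [u Nu|u v _ _]; [apply: rstable_adr | rewrite !adrE lbr_leibniz].
have derL (y : L) : derivation_on fullv (adr y) by exact: adr_derivation.
have dkNN : (\dim (lbrv N N) + k = \dim N)%N by rewrite -dNN subnKC // dimvS.
have [chis [szc linc killc eigc]] := flag_weights solL sNN sN NN.
rewrite dNN in szc.
pose chi (i : 'I_k) := nth (fun=> 0) chis i.
have chi_in i : List.In (chi i) chis.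
  have: (i < size chis)%N by rewrite szc.
  rewrite /chi; elim: (chis) (nat_of_ord i) => // c s IHs [|m] /=; first by left.
  by rewrite ltnS => /IHs; right.
have chi_map y : [seq c y | c <- chis] = [seq chi i y | i <- enum 'I_k].
  apply: (@eq_from_nth _ 0) => [|m]; rewrite !size_map -?enumT ?size_enum_ord //.
  move=> ltm; rewrite (nth_map (fun=> 0)) //; rewrite szc in ltm.
  by rewrite (nth_map (Ordinal ltm)) ?size_enum_ord // /chi nth_enum_ord.
have nil0 y : (forall i, chi i y = 0) -> y \in N.
  move=> chi0; apply: (mem_nilradical solL nilradN) => v Nv.
  apply: (nilpotent_spectral (s := [seq c y | c <- chis])) Nv => //.
    by rewrite chi_map; apply/allP => _ /mapP[i _ ->]; rewrite /= chi0.
  by move=> a b /eqP -> /eqP ->; rewrite /= addr0.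
  by move=> w; apply: killc.
pose chiv y : 'rV[C]_k := \row_i chi i y.
have chiv_lin : linear chiv.
  by move=> a u v; apply/rowP => i; rewrite !mxE (linc _ (chi_in i)).
pose chiL : {linear L -> 'rV[C]_k} :=
  HB.pack chiv (GRing.isLinear.Build C L 'rV[C]_k *:%R chiv chiv_lin).
pose f : 'Hom(L, 'rV[C]_k) := linfun chiL.
have kerf : (lker f <= N)%VS.
  apply/subvP => y; rewrite memv_ker lfunE => /eqP/rowP f0.
  by apply: nil0 => i; have := f0 i; rewrite !mxE.
(* The common kernel of the k weights lies in N, so they take all k-tuples of values. The values k +
   1, ..., 2k are distinct and nonzero, and a sum of two of them is at least 2k + 2: the eigenvalues
   on N^2 are separated from those on N / N^2. *)
have [y0 y0P] : exists y0, forall i : 'I_k, chi i y0 = (k.+1 + i)%:R.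
  have: (\row_(i < k) (k.+1 + i)%:R : 'rV[C]_k) \in limg f.
    suff /eqP -> : limg f == fullv by apply: memvf.
    rewrite eqEdim subvf dimvf dim_matrix mul1r.
    have := limg_ker_dim f fullv; rewrite capfv dL => /esym H.
    by rewrite -(leq_add2l (\dim N)) H leq_add2r dimvS.
  move=> /memv_imgP[y _ def_y]; exists y => i.
  by move/rowP/(_ i): def_y; rewrite lfunE !mxE.
pose a (i : 'I_k) : C := (k.+1 + i)%:R.
have a_inj i j : a i = a j -> i = j.
  by move/eqP; rewrite eqr_nat eqn_add2l => /eqP/val_inj.
pose D := adr y0.
have spN v : v \in N -> spectral D (natgeq k.+1) v.
  apply: (nilpotent_spectral (s := [seq c y0 | c <- chis]) NN nilN (derN y0)) => //.
    by rewrite chi_map; apply/allP => _ /mapP[i _ ->]; rewrite y0P natgeqP leq_addr.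
  move=> b c kb kc; have /asboolP[p mp ->] := natgeqD kb kc.
    by rewrite natgeqP; lia.
  by move=> w; apply: killc.
have spNN v : v \in lbrv N N -> spectral D (natgeq (k.+1 + k.+1)) v.
  apply: lbrv_ind; first exact: spectral_lin.
  move=> u w Nu Nw; apply: (spectral_lbr (derN y0)) Nu Nw (spN _ Nu) (spN _ Nw).
  exact: natgeqD.
have [Q' QP] := lin_closed_vspace (spectral_lin D (pred1 0)).
have QN v : v \in Q' -> v \in N -> v = 0.
  move=> /QP Qv /spN; apply: spectral_disjoint Qv => b /eqP ->.
  by rewrite -[0]/(0%:R) natgeqP.
(* A bracket of generalized 0-eigenvectors is again one, and it lies in N, on which all eigenvalues
   are at least k + 1. *)
have QQ u v : u \in Q' -> v \in Q' -> lbr u v = 0.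
  move=> /QP Qu /QP Qv; apply: QN => //; apply/QP.
  apply: (spectral_lbr (derL y0)) (memvf _) (memvf _) Qu Qv.
  by move=> b c /eqP -> /eqP ->; rewrite /= addr0.
(* Right multiplication by [y0] maps everything into N, so the part of a vector with nonzero
   eigenvalues lies in N. *)
have NQ : (N + Q')%VS = fullv.
  apply/eqP; rewrite eqEsubv subvf; apply/subvP => v Lv.
  have [v1 [v2 [-> _ v1P [t t0 tv2]]]] := spectral_split (pred1 0) (derL y0).1 Lv.
  rewrite addrC memv_add //; last exact/QP.
  apply: (@kill_coprime _ _ D N [:: 0] t) => //=.
  - by move=> u; apply: rstable_adr.
  - by move=> b /[!inE] /eqP ->; apply/negP => /(allP t0); rewrite /= eqxx.
  - by rewrite shiftE scale0r subr0 adrE LN.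
have dQ' : \dim Q' = k.
  apply/eqP; rewrite -(eqn_add2l (\dim N)) -dL -NQ dimv_disjoint_sum //.
  apply/eqP; rewrite -subv0; apply/subvP => v; rewrite memv_cap => /andP[Nv Qv].
  by rewrite memv0 (QN _ Qv Nv).
have /fin_all_exists[e eP] i : exists v, [/\ v \in N, v != 0 & D v = a i *: v].
  have [v [Nv nzv Dv]] := eigc y0 _ (chi_in i).
  by exists v; split; rewrite // adrE Dv y0P.
have eN i : e i \in N by case: (eP i).
have e0 i : e i != 0 by case: (eP i).
have eD i : D (e i) = a i *: e i by case: (eP i).
have esp i (A : pred C) : A (a i) -> spectral D A (e i).
  by move=> Aai; apply: spectral_eigen (eD i).
have free_e c : \sum_i c i *: e i \in lbrv N N -> forall i, c i = 0.
  move=> /spNN sp i; have /eqP : c i *: e i = 0; last first.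
    by rewrite scaler_eq0 (negPf (e0 i)) orbF => /eqP.
  apply: (@spectral_disjoint _ _ D (pred1 (a i)) (predC (pred1 (a i)))).
  - by move=> b /= /eqP ->; rewrite eqxx.
  - by apply/(lin_closedZ (spectral_lin _ _))/esp; rewrite /= eqxx.
  have -> : c i *: e i = \sum_j c j *: e j + (-1) *: (\sum_(j | j != i) c j *: e j).
    by rewrite (bigD1 i) //= scaleN1r addrK.
  apply: (lin_closedD (spectral_lin D _)).
    apply: spectralW sp => _ /asboolP[p leP ->]; rewrite !inE eqr_nat.
    by have := ltn_ord i; lia.
  apply/(lin_closedZ (spectral_lin _ _))/(lin_closed_sum (spectral_lin _ _)) => j nij.
  apply/(lin_closedZ (spectral_lin _ _))/esp => /=.
  by apply: contra nij => /eqP/a_inj ->.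
have lfree_e : lindep_free e by move=> c c0; apply: free_e; rewrite c0 mem0v.
have gen_e : (fspan e + lbrv N N)%VS = N.
  apply/eqP; rewrite eqEdim subv_add fspan_sub // NN /=.
  rewrite dimv_disjoint_sum; first by rewrite dim_fspan // card_ord addnC dkNN.
  apply/eqP; rewrite -subv0; apply/subvP => v; rewrite memv_cap memv0.
  move=> /andP[/fspanP[c ->] /free_e c0].
  by rewrite big1 // => i _; rewrite c0 scale0r.
(* The generalized eigenspace of [a i] in N is the line of [e i], since N^2 contributes only
   eigenvalues above 2k. Elements of [Q'] preserve it and therefore act diagonally on the [e i]. *)
have line_e i v : v \in N -> spectral D (pred1 (a i)) v -> exists b, v = b *: e i.
  rewrite -{1}gen_e => /memv_addP[_ /fspanP[c ->] [w NNw ->]] sp.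
  exists (c i); apply/eqP; rewrite -subr_eq0; apply/eqP.
  apply: (@spectral_disjoint _ _ D (pred1 (a i)) (predC (pred1 (a i)))).
  - by move=> b /= /eqP ->; rewrite eqxx.
  - apply: (lin_closedD (spectral_lin D _)) sp _; rewrite -scaleNr.
    by apply/(lin_closedZ (spectral_lin _ _))/esp; rewrite /= eqxx.
  rewrite (bigD1 i) //=.
  have -> : forall p q r : L, p + q + r - p = q + r by move=> p q r; vring.
  apply: (lin_closedD (spectral_lin D _)).
    apply: (lin_closed_sum (spectral_lin _ _)) => j nij.
    apply/(lin_closedZ (spectral_lin _ _))/esp => /=.
    by apply: contra nij => /eqP/a_inj ->.
  apply: spectralW (spNN _ NNw) => _ /asboolP[p leP ->]; rewrite !inE eqr_nat.
  by have := ltn_ord i; lia.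
pose d i y := fcoord e i (lbr (e i) y).
have dP i y : y \in Q' -> lbr (e i) y = d i y *: e i.
  move=> Qy; have [|b def_b] := line_e i (lbr (e i) y) (LN _ _).
    apply: (spectral_lbr (derL y0)) (memvf _) (memvf _) (esp i (pred1 (a i)) _) ((QP y).1 Qy).
      by move=> b c /eqP -> /eqP ->; rewrite /= addr0.
    by rewrite /= eqxx.
  rewrite /d def_b; congr (_ *: _).
  have -> : b *: e i = \sum_j (if j == i then b else 0) *: e j.
    by rewrite (bigD1 i) //= eqxx big1 ?addr0 // => j /negPf ->; rewrite scale0r.
  by rewrite fcoordE // eqxx.
pose dv y : 'rV[C]_k := \row_i d i y.
have dv_lin : linear dv.
  by move=> b u v; apply/rowP => i; rewrite !mxE /d lbrDr lbrZr fcoord_scalar.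
pose dL' : {linear L -> 'rV[C]_k} :=
  HB.pack dv (GRing.isLinear.Build C L 'rV[C]_k *:%R dv dv_lin).
pose g : 'Hom(L, 'rV[C]_k) := linfun dL'.
(* An element of [Q'] annihilating all [e i] acts nilpotently on N and so lies in N. Hence the
   diagonal action of [Q'], of dimension k, is faithful, and a dual basis [x] exists. *)
have kerg : (Q' :&: lker g)%VS = 0%VS.
  apply/eqP; rewrite -subv0; apply/subvP => y; rewrite memv_cap memv_ker lfunE.
  move=> /andP[Qy /eqP/rowP g0]; rewrite memv0; apply/eqP/QN => //.
  have d0 i : lbr (e i) y = 0.
    by rewrite dP //; have := g0 i; rewrite !mxE => ->; rewrite scale0r.
  apply: (mem_nilradical solL nilradN) => v.
  apply: (nilpotent_spectral (s := [:: 0])) => //=; first by rewrite eqxx.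
    by move=> b c /eqP -> /eqP ->; rewrite /= addr0.
  move=> w; rewrite -{1}gen_e shiftE scale0r subr0 adrE.
  move=> /memv_addP[_ /fspanP[c ->] [w' NNw' ->]].
  rewrite lbrDl memvD //; last exact: sNN.
  rewrite lbr_suml memv_suml // => i _.
  by rewrite lbrZl d0 scaler0 mem0v.
have img_g : (g @: Q')%VS = fullv.
  apply/eqP; rewrite eqEdim subvf /= limg_dim_eq // dQ' dimvf dim_matrix mul1r //.
have /fin_all_exists[x xP] j : exists y, y \in Q' /\ forall i, d i y = (i == j)%:R.
  have: (\row_(i < k) (i == j)%:R : 'rV[C]_k) \in (g @: Q')%VS by rewrite img_g memvf.
  move=> /memv_imgP[y Qy /rowP def_y]; exists y; split=> // i.
  by have := def_y i; rewrite lfunE !mxE.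
have Qx j : x j \in Q' by case: (xP j).
have ex i j : lbr (e i) (x j) = (i == j)%:R *: e i by rewrite dP // (xP j).2.
have free_x c : \sum_i c i *: x i \in N -> forall i, c i = 0.
  move=> /QN x0 i; have := x0 (memv_suml _ _) => {}x0.
  have: lbr (e i) (\sum_j c j *: x j) = 0.
    by rewrite x0 ?lbr0r // => j _; rewrite memvZ.
  rewrite lbr_sumr (bigD1 i) //= big1 => [|j nij].
    rewrite lbrZr ex eqxx scale1r addr0 => /eqP.
    by rewrite scaler_eq0 (negPf (e0 i)) orbF => /eqP.
  by rewrite lbrZr ex eq_sym (negPf nij) scale0r scaler0.
have span_x : fspan x = Q'.
  apply/eqP; rewrite eqEdim fspan_sub //= dQ' dim_fspan ?card_ord //.
  by move=> c c0; apply: free_x; rewrite c0 mem0v.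
exists e, x; split=> //; last by rewrite span_x.
by move=> i j; apply: QQ.
Qed.

End ExistsFrame.

(** * Homogeneous elements of a generated nilpotent algebra *)

Section Generated.
Variables (C : numClosedFieldType) (L : leibnizType C) (N : {vspace L}).
Hypothesis NN : (lbrv N N <= N)%VS.
Hypothesis nilN : lb_nilpotent N.

Lemma mem_lbrN u v : u \in N -> v \in N -> lbr u v \in N.
Proof. by move=> Nu Nv; rewrite (subvP NN) ?mem_lbrv. Qed.

(** Compatibility with right factors [e i] suffices: a right factor [v, e_i] is opened by the
    Leibniz identity into two successive right factors. *)
Lemma hom_of_generators k (e : 'I_k -> L) (f : 'End(L)) : generates N e ->
  (forall v i, v \in N -> f (lbr v (e i)) = lbr (f v) (f (e i))) ->
  {in N &, forall u v, f (lbr u v) = lbr (f u) (f v)}.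
Proof.
move=> gen fe u v Nu Nv; move: v Nv u Nu; apply: (generates_ind NN nilN gen).
- split=> [u _|a v w Pv Pw u Nu]; first by rewrite !(lbr0r, linear0).
  by rewrite lbrDr lbrZr !linearP /= Pv // Pw // lbrDr lbrZr.
- by move=> i u Nu; apply: fe.
move=> v i Nv Pv u Nu; rewrite fe // !lbr_lbr linearB /= fe ?mem_lbrN // Pv //.
by rewrite Pv ?fe ?mem_lbrN //; case: gen.
Qed.

Lemma derivation_comm (D E : 'End(L)) : derivation_on N D -> derivation_on N E ->
  derivation_on N ((D \o E) - (E \o D))%VF.
Proof.
move=> [DN Dlbr] [EN Elbr]; split=> [u Nu|u v Nu Nv].
  by rewrite add_lfunE opp_lfunE !comp_lfunE memvB ?DN ?EN ?DN.
rewrite !add_lfunE !opp_lfunE !comp_lfunE Dlbr // Elbr // !linearD /=.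
by rewrite !Dlbr ?Elbr ?DN ?EN ?DN // ?(lbrDl, lbrDr, lbrNl, lbrNr); vring.
Qed.

Lemma derivation_lin : lin_closed (derivation_on N).
Proof.
split=> [|a D E [DN Dlbr] [EN Elbr]].
  by split=> [u _|u v _ _]; rewrite !zero_lfunE ?mem0v // lbr0l lbr0r addr0.
split=> [u Nu|u v Nu Nv].
  by rewrite add_lfunE scale_lfunE memvD ?memvZ ?DN ?EN.
rewrite !add_lfunE !scale_lfunE Dlbr // Elbr //.
by rewrite !lbrDl !lbrDr !lbrZl !lbrZr; vring.
Qed.

Section Degree.
Variables (k : nat) (e : 'I_k -> L) (D : 'End(L)).
Hypothesis gen : generates N e.
Hypothesis derD : derivation_on N D.
Hypothesis De : forall i, D (e i) = e i.

Definition homog m v := v \in N /\ D v = m%:R *: v.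

Lemma lcs_derivation m u : u \in lcs N m -> D u \in lcs N m.
Proof.
elim: m u => [|m IHm] u; first exact: derD.1.
apply: (lbrv_ind (P := fun u => D u \in lcs N m.+1)).
  by split=> [|a v w Pv Pw]; rewrite ?linear0 ?mem0v // linearP memvD ?memvZ.
move=> v w mv Nw; have Nv := subvP (lcs_sub NN m) _ mv.
by rewrite derD.2 // memvD // mem_lbrv ?IHm ?derD.1.
Qed.

(** [D] is the identity on N / N^2, so by the derivation rule it acts as m + 1 on N^(m+1) /
    N^(m+2). *)
Lemma shift_lcs m u : u \in lcs N m -> shift D m.+1%:R u \in lcs N m.+1.
Proof.
have lin n : lin_closed (fun u => shift D n%:R u \in lcs N n).
  by split=> [|a v w Pv Pw]; rewrite ?linear0 ?mem0v // linearP memvD ?memvZ.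
have shift1 w : w \in N -> shift D 1 w \in lbrv N N.
  rewrite -{1}(gn_gen gen) => /memv_addP[v Ev [n NNn ->]].
  rewrite linearD memvD //=.
    apply: (fspan_ind (lin 1%N)) Ev => i.
    by rewrite shiftE De scale1r subrr mem0v.
  by rewrite shiftE memvB ?memvZ // (lcs_derivation (m := 1)).
elim: m u => [|m IHm] u; first exact: shift1.
apply: (lbrv_ind (lin m.+2)) => v w mv Nw; have Nv := subvP (lcs_sub NN m) _ mv.
have -> : shift D m.+2%:R (lbr v w) =
    lbr (shift D m.+1%:R v) w + lbr v (shift D 1 w).
  rewrite !shiftE derD.2 // !lbrDl !lbrDr !lbrNl !lbrNr !lbrZl !lbrZr.
  by rewrite -[m.+2%:R]natr1; vring.
apply: memvD; first by rewrite mem_lbrv ?IHm.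
by apply: (subvP (lbrv_lcs_sq N m)); rewrite mem_lbrv ?shift1.
Qed.

Lemma shift_homog m n v : homog m v -> shift D n%:R v = (m%:R - n%:R) *: v.
Proof. by move=> [_ Dv]; rewrite shiftE Dv scalerBl. Qed.

Lemma homog_shift_lcs m l v : homog m v -> m != l.+1 -> v \in lcs N l -> v \in lcs N l.+1.
Proof.
move=> hv nml /shift_lcs; rewrite (shift_homog _ hv) => /(memvZ (m%:R - l.+1%:R)^-1).
by rewrite scalerK // subr_eq0 eqr_nat.
Qed.

Lemma homog_lcs m l v : homog m v -> (l < m)%N -> v \in lcs N l.
Proof.
move=> hv; elim: l => [|l IHl] ltl; first by case: hv.
by apply: homog_shift_lcs hv _ (IHl _); [rewrite gtn_eqF | apply: ltnW].
Qed.

(** The scalar [m] differs from the one by which [D] acts on each further layer of the series, so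
    [v] sinks through all of them. *)
Lemma homog_lcs0 m l v : homog m v -> v \in lcs N l -> (m <= l)%N -> v = 0.
Proof.
move=> hv lv ml; have [c c0] := nilN.
have: v \in lcs N (l + c).
  elim: c {c0} => [|c IHc]; first by rewrite addn0.
  rewrite addnS; apply: homog_shift_lcs hv _ IHc.
  by rewrite ltn_eqF // ltnS (leq_trans ml) ?leq_addr.
move=> /(subvP (_ : lcs N (l + c) <= lcs N c)%VS); rewrite c0 memv0 => H; apply/eqP/H.
by elim: l {lv ml H} => [|l IHl]; rewrite ?add0n ?c0 // (subv_trans (lcsS NN _)).
Qed.

Lemma homog_lbr m n u v : homog m u -> homog n v -> homog (m + n) (lbr u v).
Proof.
move=> [Nu Du] [Nv Dv]; split; first exact: mem_lbrN.
by rewrite derD.2 // Du Dv lbrZl lbrZr natrD scalerDl.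
Qed.

Lemma homog_lin m : lin_closed (homog m).
Proof.
split=> [|a u v [Nu Du] [Nv Dv]]; first by split; rewrite ?mem0v // linear0 scaler0.
split; first by rewrite memvD ?memvZ.
by rewrite linearP /= Du Dv scalerDr !scalerA mulrC.
Qed.

Lemma homog_e i : homog 1 (e i).
Proof. by split; [case: gen | rewrite De scale1r]. Qed.

Variable c : nat.
Hypothesis Nc : lcs N c = 0%VS.

Lemma homog_gtn m v : homog m v -> (c < m)%N -> v = 0.
Proof. by move=> hv /(homog_lcs hv); rewrite Nc memv0 => /eqP. Qed.

Lemma homog_split v : v \in N -> exists2 w : nat -> L,
  (forall m, homog m (w m)) & v = \sum_(m < c.+1) w m.
Proof.
move: v; apply: (generates_ind NN nilN gen) => [|i|v i Nv [w wP ->]].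
- split=> [|a _ _ [w wP ->] [w' wP' ->]].
    exists (fun=> 0); first by move=> m; exact: (homog_lin m).1.
    by rewrite big1.
  exists (fun m => a *: w m + w' m); first by move=> m; apply: (homog_lin m).2.
  by rewrite scaler_sumr -big_split.
- have [c0|c_gt0] := posnP c.
    have := Nc; rewrite c0 /= => N0; have := gn_mem gen i; rewrite N0 memv0 => /eqP ->.
    exists (fun=> 0); first by move=> m; exact: (homog_lin m).1.
    by rewrite big1.
  exists (fun m => if m == 1%N then e i else 0).
    by move=> m; case: eqP => [->|_]; [exact: homog_e | exact: (homog_lin m).1].
  have lt1 : (1 < c.+1)%N by [].
  by rewrite (bigD1 (Ordinal lt1)) //= big1 ?addr0 // => j; rewrite -val_eqE /= => /negPf ->.
exists (fun m => if m is m'.+1 then lbr (w m') (e i) else 0).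
  move=> [|m]; first exact: (homog_lin 0).1.
  by rewrite -addn1; apply: homog_lbr (homog_e i).
rewrite [RHS]big_ord_recl /= add0r big_ord_recr /= lbrDl lbr_suml.
rewrite [lbr (w c) _]((homog_gtn (m := c + 1))) ?addr0 ?addn1 //.
by rewrite -addn1; apply: homog_lbr (homog_e i).
Qed.

Definition other_degrees m : seq C := [seq n%:R | n <- iota 0 c.+1 & n != m].
(** The Lagrange polynomial of [m] for the nodes 0, ..., c, evaluated at [D]; for [m] at most [c] it
    projects N onto its part of degree [m]. *)
Definition degree_proj m : 'End(L) :=
  (\prod_(b <- other_degrees m) (m%:R - b))^-1 *: linfun (kill D (other_degrees m)).

Lemma degree_projE m n v : homog n v -> (n <= c)%N ->
  degree_proj m v = if n == m then v else 0.
Proof.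
move=> hv nc; rewrite /degree_proj scale_lfunE lfunE /=.
have := @kill_eigen _ _ D 0 n%:R (other_degrees m) v _ _; rewrite (shift_homog _ hv) subrr scale0r.
case: hv => Nv Dv.
rewrite mem0v memv0 subr_eq0 => H; rewrite (eqP (H _ isT)) => [|u]; last first.
  by rewrite memv0 => /eqP ->; rewrite linear0 mem0v.
case: eqVneq => [->|nnm].
  rewrite scalerK // prodf_seq_neq0; apply/allP => _ /mapP[l + ->].
  by rewrite mem_filter subr_eq0 eqr_nat eq_sym => /andP[].
suff -> : \prod_(b <- other_degrees m) (n%:R - b) = 0 by rewrite scale0r scaler0.
apply/eqP; rewrite prodf_seq_eq0; apply/hasP; exists n%:R; last by rewrite subrr eqxx.
by apply: map_f; rewrite mem_filter nnm mem_iota.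
Qed.

Lemma degree_proj_homog m v : (m <= c)%N -> v \in N -> homog m (degree_proj m v).
Proof.
move=> mc /homog_split[w wP ->]; rewrite linear_sum /=.
apply: (lin_closed_sum (homog_lin m)) => n _.
by rewrite (degree_projE m (wP n)) -1?ltnS //; case: eqP => [<-|_]; [|exact: (homog_lin m).1].
Qed.

Lemma sum_degree_proj v : v \in N -> \sum_(m < c.+1) degree_proj m v = v.
Proof.
move=> /homog_split[w wP ->].
apply: eq_bigr => m _; rewrite linear_sum /= (bigD1 m) //= (degree_projE m (wP m)) -1?ltnS // eqxx.
rewrite big1 ?addr0 // => n nm; rewrite (degree_projE m (wP n)) -1?ltnS //.
by rewrite val_eqE (negPf nm).
Qed.

Lemma degree_proj_lcs m l v : (m <= l)%N -> (m <= c)%N -> v \in lcs N l -> degree_proj m v = 0.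
Proof.
move=> ml mc lv; have Nv := subvP (lcs_sub NN l) _ lv.
apply: (homog_lcs0 (degree_proj_homog mc Nv) (l := l)) => //.
rewrite scale_lfunE lfunE memvZ // mem_kill // => u; exact: lcs_derivation.
Qed.

Lemma sub_degree_proj m v : (0 < m <= c)%N -> v \in lcs N m.-1 -> v - degree_proj m v \in lcs N m.
Proof.
case/andP=> m0 mc lv; have Nv := subvP (lcs_sub NN m.-1) _ lv.
have ltm : (m < c.+1)%N by [].
rewrite -{1}(sum_degree_proj Nv) (bigD1 (Ordinal ltm)) //= addrAC subrr add0r.
apply: memv_suml => n; rewrite -val_eqE /= => nnm.
have nc : (n <= c)%N by rewrite -ltnS.
have [nm|mn] := ltnP n m; last first.
  by apply: homog_lcs (degree_proj_homog nc Nv) _; rewrite ltn_neqAle eq_sym nnm.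
by rewrite (degree_proj_lcs (l := m.-1)) ?mem0v // -ltnS prednK.
Qed.

End Degree.
End Generated.

(** * Weights in a frame *)

(** The form in which the hypotheses on the summands are used, see [decomposition_center]; in a
    frame it forbids central generators. *)
Definition center_in_sq (K : fieldType) (L : leibnizType K) (N : {vspace L}) : Prop :=
  forall z, z \in N -> (forall v, v \in N -> lbr z v = 0 /\ lbr v z = 0) ->
  z \in lbrv N N.

Section FrameTheory.
Variables (C : numClosedFieldType) (L : leibnizType C) (N : {vspace L}) (k : nat).
Variables (e x : 'I_k -> L).
Hypothesis F : frame N e x.

Let eN := fr_mem F.
Let LN := fr_lbr F.

Lemma frame_sub : (lbrv N N <= N)%VS.
Proof. by apply/lbrvP => *; apply: LN. Qed.

Lemma frame_generates : generates N e.
Proof. by split; [apply: eN | apply: fr_gen F]. Qed.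

Lemma frame_ind (P : L -> Prop) : lin_closed P -> (forall i, P (e i)) ->
  (forall v i, v \in N -> P v -> P (lbr v (e i))) -> forall v, v \in N -> P v.
Proof.
exact: (generates_ind frame_sub (fr_nil F) frame_generates).
Qed.

Lemma capNx : (N :&: fspan x)%VS = 0%VS.
Proof.
apply/eqP; rewrite -subv0; apply/subvP => v; rewrite memv_cap memv0.
move=> /andP[Nv /fspanP[c def_v]]; rewrite def_v in Nv *.
by rewrite big1 // => j _; rewrite (fr_xfree F Nv) scale0r.
Qed.

Lemma frame_e_notin i : e i \notin lbrv N N.
Proof.
apply/negP => NNe; suff: (i == i)%:R = 0 :> C by rewrite eqxx; apply/eqP/oner_neq0.
apply: (fr_free F (c := fun j => (j == i)%:R)).
rewrite (bigD1 i) //= eqxx scale1r big1 ?addr0 // => j /negPf ->.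
by rewrite scale0r.
Qed.

Lemma frame_e_neq0 i : e i != 0.
Proof. by apply: contraNneq (frame_e_notin i) => ->; rewrite mem0v. Qed.

(** Right multiplication by this element is the Euler derivation of N: each homogeneous element is
    multiplied by its degree in the generators. *)
Definition euler := \sum_j x j.

Lemma lbr_euler i : lbr (e i) euler = e i.
Proof.
rewrite lbr_sumr (bigD1 i) //= (fr_ex F) // eqxx scale1r big1 ?addr0 // => j nij.
by rewrite (fr_ex F) eq_sym (negPf nij) scale0r.
Qed.

Lemma adr_derivationN y : derivation_on N (adr y).
Proof. by split=> [u Nu|u v _ _]; rewrite !adrE // -lbr_leibniz. Qed.

Lemma lcs_eigen0 m n v : v \in lcs N m -> lbr v euler = n%:R *: v -> (n <= m)%N -> v = 0.
Proof.
move=> mv vn; have Nv := subvP (lcs_sub frame_sub m) _ mv.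
have De i : adr euler (e i) = e i by rewrite adrE lbr_euler.
apply: (homog_lcs0 frame_sub (fr_nil F) frame_generates (adr_derivationN _) De) mv.
by split; rewrite ?adrE.
Qed.

Lemma degree1 v : v \in N -> lbr v euler = v -> v \in fspan e.
Proof.
rewrite -{1}(fr_gen F) => /memv_addP[q /fspanP[c ->] [w NNw ->]] vE.
suff -> : w = 0 by rewrite addr0; apply/fspanP; exists c.
apply: (lcs_eigen0 (m := 1) (n := 1)) => //; rewrite scale1r.
move: vE; rewrite lbrDl lbr_suml.
under eq_bigr do rewrite lbrZl lbr_euler.
exact: addrI.
Qed.

Lemma weight_line v i : v \in N -> (forall j, lbr v (x j) = (i == j)%:R *: v) ->
  exists c, v = c *: e i.
Proof.
move=> Nv wv; have: v \in fspan e.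
  apply: degree1 => //; rewrite lbr_sumr (bigD1 i) //= wv eqxx scale1r.
  by rewrite big1 ?addr0 // => j nij; rewrite wv eq_sym (negPf nij) scale0r.
move=> /fspanP[c def_v]; exists (c i).
have := wv i; rewrite eqxx scale1r => {1}<-; rewrite def_v lbr_suml (bigD1 i) //=.
rewrite lbrZl (fr_ex F) eqxx scale1r big1 ?addr0 // => j nij.
by rewrite lbrZl (fr_ex F) (negPf nij) scale0r scaler0.
Qed.

Definition weighted (al : 'I_k -> nat) v := forall j, lbr v (x j) = (al j)%:R *: v.

Lemma weighted_lbr al be u v : weighted al u -> weighted be v ->
  weighted (fun j => al j + be j)%N (lbr u v).
Proof.
move=> wu wv j; rewrite lbr_leibniz wu wv lbrZl lbrZr natrD.
by rewrite scalerDl.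
Qed.

Lemma weighted_e i : weighted (fun j => i == j) (e i).
Proof. by move=> j; rewrite (fr_ex F). Qed.

(** Components of different multidegree are independent. The prescribed weight is cut out one [x j]
    at a time, the remaining terms having other eigenvalues. *)
Lemma weight_sep (I : finType) (v : I -> L) (al : I -> 'I_k -> nat) be :
  (forall r, weighted (al r) (v r)) -> \sum_r v r = 0 ->
  \sum_(r | [forall j, al r j == be j]) v r = 0.
Proof.
move=> wv v0.
have step (P : pred I) j : \sum_(r | P r) v r = 0 ->
    \sum_(r | P r && (al r j == be j)) v r = 0.
  move=> P0; pose S (Q : pred nat) := \sum_(r | P r && Q (al r j)) v r.
  have sp (Q : pred nat) (A : pred C) : (forall n, Q n -> A n%:R) ->
      spectral (adr (x j)) A (S Q).
    move=> QA; apply: (lin_closed_sum (spectral_lin _ _)) => r /andP[_ Qr].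
    by apply: spectral_eigen (QA _ Qr) _; rewrite adrE wv.
  apply: (@spectral_disjoint _ _ (adr (x j)) (pred1 (be j)%:R) (predC (pred1 (be j)%:R))).
  - by move=> b /= /eqP ->; rewrite eqxx.
  - by apply: (sp (pred1 (be j))) => n /eqP -> /=; rewrite eqxx.
  have -> : \sum_(r | P r && (al r j == be j)) v r = (-1) *: S (predC (pred1 (be j))).
    apply/eqP; rewrite scaleN1r -subr_eq0 opprK; apply/eqP; rewrite -[RHS]P0.
    by rewrite [RHS](bigID (fun r => al r j == be j)).
  apply/(lin_closedZ (spectral_lin _ _))/sp => n /=.
  by apply: contra; rewrite eqr_nat.
have main js : \sum_(r | all (fun j => al r j == be j) js) v r = 0.
  elim: js => [|j js IHjs]; first by rewrite -[RHS]v0.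
  by rewrite -[RHS](step _ j IHjs); apply: eq_bigl => r; rewrite /= andbC.
rewrite -[RHS](main (enum 'I_k)); apply: eq_bigl => r.
apply/forallP/allP => [H j _|H j]; first exact: H.
by apply: H; rewrite mem_enum.
Qed.

Lemma lbr_symr z y1 y2 : lbr z (lbr y1 y2 + lbr y2 y1) = 0 :> L.
Proof. by rewrite lbrDr !lbr_lbr -opprB addNr. Qed.

Lemma adl_x_line i j : exists c, lbr (x j) (e i) = c *: e i.
Proof.
apply: weight_line => // l.
by rewrite lbr_leibniz (fr_xx F) lbr0l add0r (fr_ex F) lbrZr.
Qed.

(** As [e_i, x_j] = 0, the element [x_j, e_i] = c e_i is annihilated by all left multiplications;
    bracketing with x_j once more gives c^2 = 0. *)
Lemma adl_x_neq i j : i != j -> lbr (x j) (e i) = 0.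
Proof.
move=> nij; have [c cP] := adl_x_line i j; apply/eqP; rewrite cP.
rewrite scaler_eq0 (negPf (frame_e_neq0 i)) orbF; apply/negPn/negP => nzc.
have: lbr (x j) (lbr (x j) (e i) + lbr (e i) (x j)) = 0 by exact: lbr_symr.
rewrite (fr_ex F) (negPf nij) scale0r addr0 cP lbrZr cP => /eqP.
by rewrite !scaler_eq0 !(negPf nzc) (negPf (frame_e_neq0 i)).
Qed.

(** With [x_i, e_i] = c e_i, the vector (c + 1) e_i equals [x_i, e_i] + [e_i, x_i], which all left
    multiplications annihilate. *)
Lemma adl_x_cases i : lbr (x i) (e i) = - e i \/ forall z, lbr z (e i) = 0.
Proof.
have [c cP] := adl_x_line i i.
have symm z : (c + 1) *: lbr z (e i) = 0.
  rewrite -lbrZr scalerDl scale1r -cP.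
  have := lbr_symr z (x i) (e i).
  by rewrite (fr_ex F) eqxx scale1r.
have [c1|nz] := eqVneq (c + 1) 0.
  by left; rewrite cP -[c](addrK 1) c1 sub0r scaleN1r.
by right=> z; apply/eqP; have /eqP := symm z; rewrite scaler_eq0 (negPf nz).
Qed.

Lemma adl_ind z : (forall i, lbr z (e i) = 0) -> forall v, v \in N -> lbr z v = 0.
Proof.
move=> ze; apply: frame_ind => [||v i Nv zv] //.
  by split=> [|a u v zu zv]; rewrite ?lbr0r // lbrDr lbrZr zu zv scaler0 addr0.
by rewrite lbr_lbr zv ze !lbr0l subrr.
Qed.

Lemma adr_ind z : (forall i, lbr (e i) z = 0) -> (forall i, lbr z (e i) = 0) ->
  forall v, v \in N -> lbr v z = 0.
Proof.
move=> ez ze; apply: frame_ind => [||v i Nv zv] //.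
  by split=> [|a u v zu zv]; rewrite ?lbr0l // lbrDl lbrZl zu zv scaler0 addr0.
by rewrite lbr_leibniz zv lbr0l ez lbr0r addr0.
Qed.

Hypothesis ZN : center_in_sq N.

Lemma generator_not_central i :
  (forall j, lbr (e i) (e j) = 0) -> (forall j, lbr (e j) (e i) = 0) -> False.
Proof.
move=> ei ie; apply: (negP (frame_e_notin i)); apply: ZN => // v Nv.
by split; [apply: adl_ind | apply: adr_ind].
Qed.

Definition annr i : bool := `[< in_Ann_r N (e i) >].

(** If e_i were in Ann_r(N) with [x_i, e_i] = -e_i, expanding 0 = [x_i, [e_l, e_i]] would give
    [e_i, e_l] = 0 for all l and make e_i a central generator. So N alone decides between the cases
    of [adl_x_cases]. *)
Lemma lbr_xe i j : lbr (x j) (e i) = if (i == j) && ~~ annr i then - e i else 0.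
Proof.
case: eqVneq => [<-|/adl_x_neq //] /=.
rewrite /annr; have [[_ annN]|nann] /= := asboolP (in_Ann_r N (e i)); last first.
  by have [//|ann] := adl_x_cases i; case: nann; split.
have [xe|//] := adl_x_cases i.
case: (@generator_not_central i) => l; last exact: annN.
have := lbr_lbr (x i) (e l) (e i); rewrite annN // lbr0r.
have [c ->] := adl_x_line l i; rewrite lbrZl annN // scaler0 sub0r xe lbrNl opprK.
by move=> <-.
Qed.

(* A nonzero off-diagonal coefficient of a centroid element at (i, j) makes
   e j commute with every generator, and x j then forces e j to be central. *)
Lemma centroid_diag (p : 'End(L)) : (forall v, v \in N -> p v \in N) ->
  (forall u v, u \in N -> v \in N -> lbr (p u) v = lbr u (p v)) ->
  exists c : 'I_k -> C, forall i, p (e i) - c i *: e i \in lbrv N N.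
Proof.
move=> pN plbr.
have /fin_all_exists[a aP] i : exists a : 'I_k -> C,
    p (e i) - \sum_j a j *: e j \in lbrv N N.
  have := pN _ (eN i); rewrite -{1}(fr_gen F).
  move=> /memv_addP[_ /fspanP[a ->] [w NNw ->]]; exists a.
  by rewrite addrAC subrr add0r.
have we i l : weighted (fun j => (i == j) + (l == j))%N (lbr (e i) (e l)).
  exact: weighted_lbr (weighted_e i) (weighted_e l).
have deg2 i l : lbr (lbr (e i) (e l)) euler = 2%:R *: lbr (e i) (e l).
  by rewrite lbr_leibniz !lbr_euler scaler_nat mulr2n.
have eqn i l : \sum_j a i j *: lbr (e j) (e l) = \sum_j a l j *: lbr (e i) (e j).
  apply/eqP; rewrite -subr_eq0; apply/eqP/(lcs_eigen0 (m := 2) (n := 2)) => //; last first.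
    rewrite lbrDl lbrNl !lbr_suml scalerBr !scaler_sumr.
    by congr (_ - _); apply: eq_bigr => j _; rewrite lbrZl deg2 !scalerA mulrC.
  have pe := plbr _ _ (eN i) (eN l).
  have -> : \sum_j a i j *: lbr (e j) (e l) - \sum_j a l j *: lbr (e i) (e j) =
    lbr (e i) (p (e l) - \sum_j a l j *: e j) - lbr (p (e i) - \sum_j a i j *: e j) (e l).
    rewrite lbrDr lbrDl pe lbrNl lbrNr lbr_suml lbr_sumr.
    under eq_bigr do rewrite -lbrZl.
    under [\sum_j a l j *: _]eq_bigr do rewrite -lbrZr.
    by vring.
  rewrite memvB //; last by rewrite mem_lbrv.
  by apply: (subvP (lbrv_lcs_sq N 0)); rewrite mem_lbrv.
(* Write w_j for the weight of e_j and compare the terms of weight w_m + w_l. On the left only j = m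
   contributes; on the right the weights are w_i + w_j with i different from m, so l = i and j = m
   are required. [B] is the bracket or its opposite. *)
have offdiag (B : 'I_k -> 'I_k -> L) (b d : 'I_k -> C) i l m : m != i ->
    (forall i l, weighted (fun j => (i == j) + (l == j))%N (B i l)) ->
    \sum_j b j *: B j l = \sum_j d j *: B i j ->
    (l != i -> b m *: B m l = 0) /\ (l = i -> b m *: B m i = d m *: B i m).
  move=> nmi wB /eqP; rewrite -subr_eq0 -sumrN => /eqP.
  under [X in _ + X = _]eq_bigr do rewrite -scaleNr.
  move=> eqB.
  pose v (r : 'I_k + 'I_k) := match r with inl j => b j *: B j l | inr j => - d j *: B i j end.
  pose al (r : 'I_k + 'I_k) (j : 'I_k) :=
    match r with inl j' => (j' == j) + (l == j) | inr j' => (i == j) + (j' == j) end%N.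
  have wv r : weighted (al r) (v r).
    by case: r => r j /=; rewrite lbrZl wB !scalerA mulrC.
  have := weight_sep (fun j => (m == j) + (l == j))%N wv.
  rewrite !big_sumType /= eqB => /(_ erefl).
  rewrite (big_pred1 m) => [|j]; last first.
    apply/forallP/eqP => [/(_ m)|-> //]; rewrite eqxx eqn_add2r.
    by case: (j =P m).
  move=> sum0; split=> [nli|eli].
    move: sum0; rewrite big_pred0 ?addr0 // => j; apply/negP => /forallP/(_ i).
    by rewrite eqxx (negPf nmi) (negPf nli); case: eqP.
  move: sum0; rewrite {}eli (big_pred1 m) => [/eqP|j]; last first.
    apply/forallP/eqP => [/(_ m)|-> p' /=]; last by rewrite addnC.
    by rewrite eqxx addnC eqn_add2r; case: (j =P m).
  by rewrite scaleNr subr_eq0 => /eqP.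
exists (fun i => a i i) => i; have := aP i; rewrite (bigD1 i) //= big1 ?addr0 //.
move=> m nmi; suff -> : a i m = 0 by rewrite scale0r.
apply/eqP/negPn/negP => nza.
have off1 l := offdiag (fun p q => lbr (e p) (e q)) (a i) (a l) i l m nmi we (eqn i l).
have off2 l := offdiag (fun p q => lbr (e q) (e p)) (a i) (a l) i l m nmi _ (esym (eqn l i)).
have ml l : l != i -> lbr (e m) (e l) = 0.
  move=> nli; have /eqP := (off1 l).1 nli.
  by rewrite scaler_eq0 (negPf nza) => /eqP.
have w2 r q : weighted (fun j => (r == j) + (q == j))%N (lbr (e q) (e r)).
  by move=> j; rewrite addnC we.
have lm l : l != i -> lbr (e l) (e m) = 0.
  move=> nli; have /eqP := (off2 w2 l).1 nli.
  by rewrite scaler_eq0 (negPf nza) => /eqP.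
have mi : lbr (e m) (e i) = lbr (e i) (e m).
  exact: scalerI nza _ _ ((off1 i).2 erefl).
have im0 : lbr (e i) (e m) = 0.
  have [xm|//] := adl_x_cases m; have := lbr_symr (x m) (e i) (e m).
  rewrite mi lbrDr -mulr2n lbr_lbr adl_x_neq 1?eq_sym // lbr0l sub0r xm lbrNl opprK mi.
  by move/eqP; rewrite -scaler_nat scaler_eq0 pnatr_eq0 => /eqP.
apply: (@generator_not_central m) => l; have [->|nli] := eqVneq l i.
- by rewrite mi.
- exact: ml.
- exact: im0.
- exact: lm.
Qed.

End FrameTheory.

(** * Decompositions into ideals *)

Section Decomposition.
Variables (K : fieldType) (L : leibnizType K) (N : {vspace L}) (s : nat).
Variable (Nt : 'I_s -> {vspace L}).
Hypothesis hN : ideal_decomposition N Nt.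

Lemma summand_sub t : (Nt t <= N)%VS.
Proof. by case: hN => /(_ t)[]. Qed.

Lemma dim_decomposition : \dim N = (\sum_t \dim (Nt t))%N.
Proof. by have [_ <- /directvP ->] := hN. Qed.

Lemma summand_lbrl t u v : u \in Nt t -> v \in N -> lbr u v \in Nt t.
Proof. by case: hN => /(_ t)[_ sl _] _ _ Nu Nv; apply/(subvP sl)/mem_lbrv. Qed.

Lemma summand_lbrr t u v : u \in N -> v \in Nt t -> lbr u v \in Nt t.
Proof. by case: hN => /(_ t)[_ _ sr] _ _ Nu Nv; apply/(subvP sr)/mem_lbrv. Qed.

Lemma summand_cross t u v w : t != u -> v \in Nt t -> w \in Nt u -> lbr v w = 0.
Proof.
move=> ntu tv uw; have [_ _ /directv_sumP/(_ t erefl) dx] := hN.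
apply/eqP; rewrite -memv0 -dx memv_cap.
have Nv := subvP (summand_sub t) _ tv; have Nw := subvP (summand_sub u) _ uw.
rewrite summand_lbrl //= (subvP (sumv_sup u _ (subvv _))) ?summand_lbrr //.
by rewrite eq_sym.
Qed.

Definition proj_summand t : 'End(L) := sumv_pi (\sum_t Nt t)%VS t.
Notation pi := proj_summand.

Lemma mem_proj t v : pi t v \in Nt t.
Proof. exact: memv_sum_pi. Qed.

Lemma sum_proj v : v \in N -> \sum_t pi t v = v.
Proof. by case: hN => _ <- _; apply: sumv_pi_sum. Qed.

Lemma projN t v : v \in N -> pi t v \in N.
Proof. by move=> _; apply: (subvP (summand_sub t)); apply: mem_proj. Qed.

Lemma proj_sum (w : 'I_s -> L) t : (forall u, w u \in Nt u) -> pi t (\sum_u w u) = w t.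
Proof.
move=> wN; have [_ defN /directv_sum_unique uniqN] := hN.
have Nw : \sum_u w u \in N by rewrite -defN memv_sumr // => u _; apply: wN.
have := sum_proj Nw => /eqP; rewrite uniqN ?inE => [/forallP/(_ t)/implyP/(_ isT)/eqP //||].
  by move=> u _; apply: mem_proj.
by move=> u _; apply: wN.
Qed.

Lemma proj_id t v : v \in Nt t -> pi t v = v.
Proof.
move=> tv; have {1}-> : v = \sum_u (if u == t then v else 0).
  by rewrite -big_mkcond /= big_pred1_eq.
rewrite proj_sum ?eqxx // => u; case: eqP => [-> //|_]; exact: mem0v.
Qed.

Lemma proj_neq t u v : t != u -> v \in Nt u -> pi t v = 0.
Proof.
move=> ntu uv; have -> : v = \sum_t (if t == u then v else 0).
  by rewrite -big_mkcond /= big_pred1_eq.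
rewrite proj_sum ?(negPf ntu) // => w; case: eqP => [-> //|_]; exact: mem0v.
Qed.

Lemma proj_lbrl t u v : u \in N -> v \in N -> pi t (lbr u v) = lbr (pi t u) v.
Proof.
move=> Nu Nv; rewrite -{1}(sum_proj Nu) lbr_suml.
by rewrite (proj_sum (w := fun t => lbr (pi t u) v)) // => w; rewrite summand_lbrl ?mem_proj.
Qed.

Lemma proj_lbrr t u v : u \in N -> v \in N -> pi t (lbr u v) = lbr u (pi t v).
Proof.
move=> Nu Nv; rewrite -{1}(sum_proj Nv) lbr_sumr.
by rewrite (proj_sum (w := fun t => lbr u (pi t v))) // => w; rewrite summand_lbrr ?mem_proj.
Qed.

Lemma proj_lbr t u v : u \in N -> v \in N -> pi t (lbr u v) = lbr (pi t u) (pi t v).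
Proof.
move=> Nu Nv; rewrite -(proj_id (mem_proj t (lbr u v))).
by rewrite proj_lbrl // proj_lbrr ?projN.
Qed.

Lemma proj_sq t v : v \in lbrv N N -> pi t v \in lbrv N N.
Proof.
apply: (lbrv_ind (P := fun v => pi t v \in lbrv N N)).
  by split=> [|a u w Pu Pw]; rewrite ?linear0 ?mem0v // linearP memvD ?memvZ.
by move=> a b Na Nb; rewrite proj_lbrl // mem_lbrv ?projN.
Qed.

Lemma summand_ideal t I : lb_ideal I (Nt t) -> lb_ideal I N.
Proof.
move=> [It Il Ir]; have sub := subvP It.
split; first exact: subv_trans It (summand_sub t).
  apply/lbrvP => u v Iu Nv; rewrite -(sum_proj Nv) lbr_sumr (bigD1 t) //= big1 ?addr0.
    by rewrite (subvP Il) // mem_lbrv ?mem_proj.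
  move=> w nwt; apply: summand_cross (sub _ Iu) (mem_proj w v).
  by rewrite eq_sym.
apply/lbrvP => v u Nv Iu; rewrite -(sum_proj Nv) lbr_suml (bigD1 t) //= big1 ?addr0.
  by rewrite (subvP Ir) // mem_lbrv ?mem_proj.
by move=> w nwt; apply: summand_cross nwt (mem_proj w v) (sub _ Iu).
Qed.

(** The component of a central element in N_t is central there. If it lay outside N_t^2, its line
    and a hyperplane containing N_t^2 but not that line would be ideals splitting N_t; non-splitness
    leaves only a zero hyperplane, and then N_t is abelian. *)
Lemma decomposition_center : (forall t, lb_nonsplit (Nt t)) ->
  (forall t, ~ lb_abelian (Nt t)) -> center_in_sq N.
Proof.
move=> nonsplit nonab z Nz zC; rewrite -(sum_proj Nz) memv_suml // => t _.
pose zt := pi t z; have tz : zt \in Nt t by apply: mem_proj.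
have ztC v : v \in Nt t -> lbr zt v = 0 /\ lbr v zt = 0.
  move=> tv; have Nv := subvP (summand_sub t) _ tv; have [zv vz] := zC v Nv.
  by rewrite -proj_lbrl // -proj_lbrr // zv vz linear0.
have [/(subvP (lbrvS (summand_sub t) (summand_sub t))) //|nzt] := boolP (zt \in lbrv (Nt t) (Nt t)).
have NNt : (lbrv (Nt t) (Nt t) <= Nt t)%VS.
  by apply/lbrvP => u v tu tv; rewrite summand_lbrl // (subvP (summand_sub t)).
have [H [NNH Hz defN]] := hyperplane_avoiding NNt tz nzt.
have HN : (H <= Nt t)%VS by rewrite -defN addvSl.
have [||||] := nonsplit t <[zt]>%VS H.
- split; first by rewrite -memvE.
    by apply/lbrvP => _ v /vlineP[a ->] tv; rewrite lbrZl (ztC v tv).1 scaler0 mem0v.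
  by apply/lbrvP => v _ tv /vlineP[a ->]; rewrite lbrZr (ztC v tv).2 scaler0 mem0v.
- by split=> //; apply: subv_trans NNH; apply: lbrvS.
- split; first by rewrite addvC.
  apply/eqP; rewrite -subv0; apply/subvP => v; rewrite memv_cap.
  move=> /andP[/vlineP[a ->]]; have [->|nza] := eqVneq a 0; first by rewrite scale0r !mem0v.
  by move=> /(memvZ a^-1); rewrite scalerK // (negPf Hz).
- move=> z0; case/negP: nzt; have := memv_line zt; rewrite z0 memv0 => /eqP ->.
  exact: mem0v.
by move=> H0; case: (nonab t); apply/eqP; rewrite -subv0 -H0.
Qed.

End Decomposition.

(** An endomorphism onto modulo N^2 is onto by nilpotency, hence bijective by dimension. *)
Lemma generating_hom_bij (K : fieldType) (L : leibnizType K) (N : {vspace L}) (f : 'End(L)) :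
  (lbrv N N <= N)%VS -> lb_nilpotent N -> (forall v, v \in N -> f v \in N) ->
  {in N &, forall u v, f (lbr u v) = lbr (f u) (f v)} ->
  (forall b, b \in N -> exists2 q, q \in N & b - f q \in lbrv N N) ->
  lb_iso N N f.
Proof.
move=> NN nilN fN flbr fgen.
have imf : (f @: N)%VS = N.
  apply/eqP; rewrite eqEsubv; apply/andP; split.
    by apply/subvP => _ /memv_imgP[v Nv ->]; apply: fN.
  apply/subvP; apply: (nilpotent_gen (G := fun q => q \in (f @: N)%VS) NN nilN).
  - exact: memv_lin_closed.
  - by move=> b /fgen[q Nq bq]; exists (f q); rewrite fN // memv_img.
  move=> p q _ _ /memv_imgP[u Nu ->] /memv_imgP[v Nv ->].
  by rewrite -flbr // memv_img // (subvP NN) ?mem_lbrv.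
split=> // u v Nu Nv fuv; apply/eqP; rewrite -subr_eq0 -memv0.
have <- : (N :&: lker f)%VS = 0%VS.
  apply/eqP; rewrite -dimv_eq0; have /eqP := limg_ker_dim f N.
  by rewrite imf -[X in _ == X]add0n eqn_add2r.
by rewrite memv_cap memvB // memv_ker linearB /= fuv subrr.
Qed.

Lemma lb_iso_inv (K : fieldType) (L L' : leibnizType K) (U : {vspace L})
    (U' : {vspace L'}) (f : 'Hom(L, L')) : (lbrv U U <= U)%VS -> lb_iso U U' f ->
  exists g : 'Hom(L', L), [/\ lb_iso U' U g, {in U, cancel f g} & {in U', cancel g f}].
Proof.
move=> UU [imf injf flbr]; pose h := (f \o projv U)%VF.
have imh : limg h = U' by rewrite limg_comp limg_proj.
pose g := (projv U \o h^-1)%VF.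
have gU y : g y \in U by rewrite comp_lfunE memv_proj.
have gK : {in U', cancel g f}.
  by move=> y; rewrite -imh => /limg_lfunVK; rewrite !comp_lfunE.
have fU y : y \in U -> f y \in U' by move=> Uy; rewrite -imf memv_img.
have fK : {in U, cancel f g} by move=> y Uy; apply: injf; rewrite ?gU ?gK ?fU.
exists g; split=> //; split.
- apply/eqP; rewrite eqEsubv; apply/andP; split; apply/subvP.
    by move=> _ /memv_imgP[y _ ->].
  by move=> y Uy; rewrite -(fK y Uy) memv_img // fU.
- exact: can_in_inj gK.
move=> y z Uy Uz; apply: injf => //; first by rewrite (subvP UU) ?mem_lbrv.
rewrite flbr // !gK //; rewrite -imf; apply/memv_imgP.
exists (lbr (g y) (g z)); first by rewrite (subvP UU) ?mem_lbrv.
by rewrite flbr // !gK.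
Qed.

(** * Blocks of generators *)

Section Blocks.
Variables (C : numClosedFieldType) (L : leibnizType C) (N : {vspace L}) (k s : nat).
Variables (e x : 'I_k -> L) (blk : 'I_k -> 'I_s).
Hypothesis F : frame N e x.
Hypothesis eblk : forall i j, blk i != blk j -> lbr (e i) (e j) = 0.

Let eN := fr_mem F.
Let LN := fr_lbr F.

(** Described by annihilation instead of generation: closure under brackets then follows from the
    Leibniz identity, and independence of the blocks shows that nothing beyond the generated
    subalgebra is obtained. *)
Definition inblock t v := [/\ v \in N, forall j, blk j != t -> lbr v (x j) = 0
  & forall j, blk j != t -> lbr v (e j) = 0].

Lemma inblock_lin t : lin_closed (inblock t).
Proof.
split=> [|a u v [Nu ux ue] [Nv vx ve]].
  by split=> [|j _|j _]; rewrite ?mem0v ?lbr0l.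
split=> [|j njt|j njt]; first by rewrite memvD ?memvZ.
  by rewrite lbrDl lbrZl ux // vx // scaler0 addr0.
by rewrite lbrDl lbrZl ue // ve // scaler0 addr0.
Qed.

(* The subalgebra generated by the e i with blk i = t, see block_ind. *)
Definition block t : {vspace L} := projT1 (cid (lin_closed_vspace (inblock_lin t))).

Lemma blockP t v : v \in block t <-> inblock t v.
Proof. by rewrite /block; case: cid => U /= UP. Qed.

Lemma block_sub t : (block t <= N)%VS.
Proof. by apply/subvP => v /blockP[]. Qed.

Lemma mem_block_e i : e i \in block (blk i).
Proof.
apply/blockP; split=> // j nji; last by rewrite eblk // eq_sym.
have nij : i != j by apply: contraNneq nji => ->.
by rewrite (fr_ex F) (negPf nij) scale0r.
Qed.

Lemma lbr_x_e_cross i j : blk j != blk i -> lbr (x j) (e i) = 0.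
Proof. by move=> nji; rewrite (adl_x_neq F) //; apply: contraNneq nji => ->. Qed.

Lemma block_lbr t u v : u \in block t -> v \in block t -> lbr u v \in block t.
Proof.
move=> /blockP[Nu ux ue] /blockP[Nv vx ve]; apply/blockP; split=> // j njt.
  by rewrite lbr_leibniz ux // vx // lbr0l lbr0r addr0.
by rewrite lbr_leibniz ue // ve // lbr0l lbr0r addr0.
Qed.

Lemma block_lbr_x t v j : v \in block t -> lbr v (x j) \in block t.
Proof.
move=> /blockP[Nv vx ve]; apply/blockP; split=> // l nlt.
  by rewrite lbr_leibniz vx // (fr_xx F) lbr0l lbr0r addr0.
have [c xe] := adl_x_line F l j.
by rewrite lbr_leibniz ve // xe lbrZr ve // lbr0l scaler0 addr0.
Qed.

Definition block_euler t := \sum_(j | blk j == t) x j.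

Lemma lbr_block_euler t u v : v \in block u ->
  lbr v (block_euler t) = if t == u then lbr v (euler x) else 0.
Proof.
move=> /blockP[_ vx _]; case: eqVneq => [->|ntu]; rewrite !lbr_sumr.
  rewrite [RHS](bigID (fun j => blk j == u)) /= [X in _ = _ + X]big1 ?addr0 //.
by rewrite big1 // => j /eqP ejt; rewrite vx // ejt.
Qed.

(** Right multiplication by [block_euler t] reduces the relation to [w_t, euler] = 0; so w_t has
    degree 0, where N contains only 0. *)
Lemma block_indep (w : 'I_s -> L) : (forall t, w t \in block t) ->
  \sum_t w t = 0 -> forall t, w t = 0.
Proof.
move=> wM w0 t; have Nw : w t \in N by apply: (subvP (block_sub t)).
apply: (lcs_eigen0 F (m := 0) (n := 0)) => //; rewrite scale0r.
have := congr1 (fun v => lbr v (block_euler t)) w0.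
rewrite lbr0l lbr_suml (bigD1 t) //= (lbr_block_euler _ (wM t)) eqxx.
rewrite big1 ?addr0 // => u nut.
by rewrite (lbr_block_euler _ (wM u)) eq_sym (negPf nut).
Qed.

Lemma block_split v : v \in N -> exists w : 'I_s -> L,
  (forall t, w t \in block t) /\ v = \sum_t w t.
Proof.
move: v; apply: (frame_ind F) => [|i|v i Nv [w [wM ->]]].
- split=> [|a _ _ [w [wM ->]] [w' [wM' ->]]].
    by exists (fun=> 0); split=> [t|]; rewrite ?mem0v // big1.
  exists (fun t => a *: w t + w' t); split=> [t|]; first by rewrite memvD ?memvZ.
  by rewrite scaler_sumr -big_split.
- exists (fun t => if t == blk i then e i else 0); split=> [t|].
    by case: eqP => [->|_]; rewrite ?mem0v ?mem_block_e.
  by rewrite -big_mkcond /= big_pred1_eq.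
exists (fun t => lbr (w t) (e i)); split=> [t|]; last by rewrite lbr_suml.
have [<-|nit] := eqVneq (blk i) t; first by rewrite block_lbr // mem_block_e.
by have /blockP[_ _ ->] := wM t; rewrite ?mem0v.
Qed.

(** The induction runs over N, splitting elements into blocks and carrying [P] along on the
    component in block [t]; independence identifies that component with [v]. *)
Lemma block_ind t (P : L -> Prop) : lin_closed P ->
  (forall i, blk i = t -> P (e i)) ->
  (forall v i, blk i = t -> v \in block t -> P v -> P (lbr v (e i))) ->
  forall v, v \in block t -> P v.
Proof.
move=> linP Pe Pve v Mv.
have: exists w : 'I_s -> L, [/\ forall u, w u \in block u, v = \sum_u w u & P (w t)].
  have := subvP (block_sub t) _ Mv; move: {Mv}v.
  apply: (frame_ind F) => [|i|v i Nv [w [wM -> Pwt]]].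
  - split=> [|a _ _ [w [wM -> Pw]] [w' [wM' -> Pw']]].
      by exists (fun=> 0); split=> [u||]; rewrite ?mem0v ?big1 //; exact: linP.1.
    exists (fun t => a *: w t + w' t); split=> [u||]; first by rewrite memvD ?memvZ.
      by rewrite scaler_sumr -big_split.
    exact: linP.2.
  - exists (fun t => if t == blk i then e i else 0); split=> [u||].
    + by case: eqP => [->|_]; rewrite ?mem0v ?mem_block_e.
    + by rewrite -big_mkcond /= big_pred1_eq.
    by case: eqP => [/esym/Pe//|_]; exact: linP.1.
  exists (fun t => lbr (w t) (e i)); split=> [u||]; last first.
  - have [eit|nit] := eqVneq (blk i) t; first exact: Pve.
    by have /blockP[_ _ ->] := wM t; rewrite //; exact: linP.1.
  - by rewrite lbr_suml.
  have [<-|niu] := eqVneq (blk i) u; first by rewrite block_lbr // mem_block_e.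
  by have /blockP[_ _ ->] := wM u; rewrite ?mem0v.
move=> [w [wM def_v Pwt]].
suff -> : v = w t by [].
pose w' u := w u - (if u == t then v else 0).
have /(_ t) : forall u, w' u = 0.
  apply: block_indep => [u|]; first by rewrite memvB //; case: eqP => [->|]; rewrite ?mem0v.
  by rewrite sumrB -def_v -big_mkcond /= big_pred1_eq subrr.
by rewrite /w' eqxx => /eqP; rewrite subr_eq0 => /eqP.
Qed.

Lemma block_lbr_lin u : lin_closed (fun v => lbr u v = 0 :> L).
Proof.
by split=> [|a v w uv uw]; rewrite ?lbr0r // lbrDr lbrZr uv uw scaler0 addr0.
Qed.

Lemma block_x_cross t j v : blk j != t -> v \in block t -> lbr (x j) v = 0.
Proof.
move=> njt; move: v; apply: block_ind => [|i eit|v i eit Mv xv].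
- exact: block_lbr_lin.
- by rewrite lbr_x_e_cross // eit.
by rewrite lbr_lbr xv [lbr (x j) (e i)]lbr_x_e_cross ?eit // !lbr0l subrr.
Qed.

Lemma block_x_lbr t j v : v \in block t -> lbr (x j) v \in block t.
Proof.
move=> Mv; have [njt|njt] := boolP (blk j != t); first by rewrite (block_x_cross njt Mv) mem0v.
have /blockP[Nv vx ve] := Mv; apply/blockP; split=> // l nlt.
  by rewrite lbr_leibniz (fr_xx F) vx // lbr0l lbr0r addr0.
rewrite lbr_leibniz ve // lbr_x_e_cross ?lbr0l ?lbr0r ?addr0 //.
by rewrite (eqP (negPn njt)) eq_sym.
Qed.

Lemma block_cross t u v w : t != u -> v \in block t -> w \in block u -> lbr v w = 0.
Proof.
move=> ntu /blockP[_ _ ve]; move: w; apply: block_ind => [|i eiu|w i eiu Mw vw].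
- exact: block_lbr_lin.
- by rewrite ve // eiu eq_sym.
by rewrite lbr_lbr vw ve ?eiu 1?eq_sym // !lbr0l subrr.
Qed.

Lemma block_decomposition : ideal_decomposition N block.
Proof.
split=> [t||].
- split; first exact: block_sub.
    apply/lbrvP => u v Mu /block_split[w [wM ->]].
    rewrite lbr_sumr (bigD1 t) //= big1 ?addr0 ?block_lbr // => l nlt.
    by apply: block_cross Mu (wM l); rewrite eq_sym.
  apply/lbrvP => v u /block_split[w [wM ->]] Mu.
  rewrite lbr_suml (bigD1 t) //= big1 ?addr0 ?block_lbr // => l nlt.
  exact: block_cross (wM l) Mu.
- apply/eqP; rewrite eqEsubv; apply/andP; split.
    by apply/subv_sumP => t _; apply: block_sub.
  by apply/subvP => v /block_split[w [wM ->]]; apply: memv_sumr => t _.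
apply/directv_sum_independent => w wM w0 t _.
by apply: block_indep => // u; apply: wM.
Qed.

Lemma block_gen t v : v \in block t ->
  exists2 c : 'I_k -> C, (forall i, blk i != t -> c i = 0) &
    v - \sum_i c i *: e i \in lbrv (block t) (block t).
Proof.
move: v; apply: block_ind => [|i eit|v i eit Mv _].
- split=> [|a u v [c c0 uc] [d d0 vd]].
    exists (fun=> 0) => //; rewrite big1 ?subr0 ?mem0v // => i _.
    by rewrite scale0r.
  exists (fun i => a * c i + d i) => [i nit|]; first by rewrite c0 // d0 // mulr0 addr0.
  under eq_bigr do rewrite scalerDl -scalerA.
  rewrite big_split /= -scaler_sumr.
  have -> : forall p q : L, a *: u + v - (a *: p + q) = a *: (u - p) + (v - q).
    by move=> p q; vring.
  by rewrite memvD ?memvZ.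
- exists (fun j => (j == i)%:R) => [j njt|].
    suff /negPf -> : j != i by []. 
    by apply: contraNneq njt => ->; rewrite eit.
  rewrite (bigD1 i) //= eqxx scale1r big1 ?addr0 ?subrr ?mem0v // => j /negPf ->.
  by rewrite scale0r.
exists (fun=> 0) => //; rewrite big1 ?subr0 => [|j _]; last by rewrite scale0r.
by rewrite mem_lbrv // -eit mem_block_e.
Qed.

End Blocks.

(** * Comparison of the blocks with a given decomposition *)

Section AdaptedBlocks.
Variables (C : numClosedFieldType) (L : leibnizType C) (N : {vspace L}) (k s : nat).
Variables (e x : 'I_k -> L) (Nt : 'I_s -> {vspace L}).
Hypothesis F : frame N e x.
Hypothesis ZN : center_in_sq N.
Hypothesis hN : ideal_decomposition N Nt.

Let eN := fr_mem F.
Let LN := fr_lbr F.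
Let NN := frame_sub F.
Notation pi := (proj_summand Nt).

Lemma scale_e_sq i a : a *: e i \in lbrv N N -> a = 0.
Proof.
move=> Na; apply/eqP; apply: contraNT (frame_e_notin F i) => nza.
by have := memvZ a^-1 Na; rewrite scalerK.
Qed.

(** The diagonal coefficients of the projections on N / N^2 sum to 1 over [t], and products of
    distinct ones vanish because the projections are orthogonal; so for each [i] exactly one is
    nonzero, and it is 1. *)
Lemma exists_block_index : exists blk : 'I_k -> 'I_s, forall i,
  pi (blk i) (e i) - e i \in lbrv N N /\
  forall t, t != blk i -> pi t (e i) \in lbrv N N.
Proof.
have /fin_all_exists[c cP] t : exists c : 'I_k -> C,
    forall i, pi t (e i) - c i *: e i \in lbrv N N.
  apply: (centroid_diag F ZN) => [v|u v Nu Nv]; first exact: projN.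
  by rewrite -(proj_lbrl hN) // (proj_lbrr hN).
have sum_c i : \sum_t c t i = 1.
  apply/eqP; rewrite eq_sym -subr_eq0; apply/eqP/(@scale_e_sq i).
  have: \sum_t (pi t (e i) - c t i *: e i) \in lbrv N N.
    by apply: memv_suml => t _; apply: cP.
  by rewrite sumrB (sum_proj hN) // -scaler_suml scalerBl scale1r.
have orth i t u : t != u -> c t i * c u i = 0.
  move=> ntu; apply: (@scale_e_sq i).
  have := proj_sq hN u (cP t i).
  have nut : u != t by rewrite eq_sym.
  rewrite linearB /= (proj_neq hN nut (mem_proj _ _ _)) sub0r linearZ memvN => H.
  have := memvB H (memvZ (c t i) (cP u i)).
  by rewrite scalerBr opprB addrCA subrr addr0 scalerA.
have /fin_all_exists[blk blkP] i : exists t, c t i != 0.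
  have [/existsP//|] := boolP [exists t, c t i != 0].
  rewrite negb_exists => /forallP c0; have := sum_c i.
  rewrite big1 => [/esym/eqP|t _]; first by rewrite oner_eq0.
  exact/eqP/negPn.
have c0 i t : t != blk i -> c t i = 0.
  move=> nt; have /eqP := orth i _ _ nt.
  by rewrite mulf_eq0 (negPf (blkP i)) orbF => /eqP.
exists blk => i; split=> [|t nt]; last by have := cP t i; rewrite c0 // scale0r subr0.
have := cP (blk i) i; have := sum_c i.
by rewrite (bigD1 (blk i)) //= big1 ?addr0 => [->|t]; rewrite ?scale1r //; apply: c0.
Qed.

Variable blk : 'I_k -> 'I_s.
Hypothesis blkP : forall i, pi (blk i) (e i) - e i \in lbrv N N /\
  forall t, t != blk i -> pi t (e i) \in lbrv N N.

(* The bracket has degree 2, but each of its components lies in N^3. *)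
Lemma block_index_cross i j : blk i != blk j -> lbr (e i) (e j) = 0.
Proof.
move=> nij; apply: (lcs_eigen0 F (m := 2) (n := 2)) => //; last first.
  by rewrite lbr_leibniz !(lbr_euler F) scaler_nat mulr2n.
rewrite -(sum_proj hN (LN (e i) (e j))) memv_suml // => t _.
rewrite (proj_lbr hN) //; have [ti|nti] := eqVneq t (blk i).
  apply: (subvP (lbrv_lcs_sq N 0)); rewrite mem_lbrv ?(projN hN) //.
  by apply: (blkP j).2; rewrite ti.
by rewrite mem_lbrv ?(projN hN) //; apply: (blkP i).2.
Qed.

Notation M := (block N e x blk).
Let hM : ideal_decomposition N M := block_decomposition F block_index_cross.
Notation rho := (proj_summand M).

(** Projects block [t] into N_t. It is the identity on N / N^2, hence an automorphism of N; its
    inverse identifies the given summands with the blocks. *)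
Definition straighten : 'End(L) := \sum_t (pi t \o rho t)%VF.

Lemma straightenE v : straighten v = \sum_t pi t (rho t v).
Proof. by rewrite sum_lfunE; apply: eq_bigr => t _; rewrite comp_lfunE. Qed.

Lemma straighten_block t v : v \in M t -> straighten v = pi t v.
Proof.
move=> Mv; rewrite straightenE (bigD1 t) //= (proj_id hM) // big1 ?addr0 // => u nut.
by rewrite (proj_neq hM nut Mv) linear0.
Qed.

Lemma straighten_iso : lb_iso N N straighten.
Proof.
apply: generating_hom_bij => //; first exact: fr_nil F.
- move=> v _; rewrite straightenE memv_suml // => t _.
  by rewrite (subvP (summand_sub hN t)) ?mem_proj.
- move=> u v Nu Nv; rewrite !straightenE.
  rewrite lbr_suml; apply: eq_bigr => t _.
  rewrite lbr_sumr (bigD1 t) //= [X in _ + X]big1 ?addr0.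
    by rewrite (proj_lbr hM) // (proj_lbr hN) // (projN hM).
  move=> l nlt; apply: (summand_cross hN (t := t) (u := l)); rewrite ?mem_proj //.
  by rewrite eq_sym.
move=> b; rewrite -{1}(fr_gen F) => /memv_addP[_ /fspanP[c ->] [w NNw ->]].
exists (\sum_i c i *: e i); first by rewrite memv_suml // => i _; rewrite memvZ.
rewrite linear_sum addrAC -sumrB /= memvD // memv_suml // => i _.
rewrite linearZ /= (straighten_block (mem_block_e F block_index_cross i)) -scalerBr memvZ //.
by rewrite -memvN opprB; apply: (blkP i).1.
Qed.

Lemma blocks_equivalent : equivalent_decompositions N Nt M.
Proof.
have [g [gP gK Kg]] := lb_iso_inv NN straighten_iso.
exists g => // t; apply/eqP; rewrite eqEsubv; apply/andP; split; apply/subvP => v.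
  move=> Mv; have Nv := subvP (summand_sub hM t) _ Mv.
  by rewrite -(gK v Nv) memv_img // (straighten_block Mv) mem_proj.
move=> /memv_imgP[n Nn ->]; have Nn' := subvP (summand_sub hN t) _ Nn.
have Ngn : g n \in N by case: gP => <- _ _; rewrite memv_img.
rewrite -(sum_proj hM Ngn); have := Kg n Nn'; rewrite straightenE => sum_n.
have gn0 u : u != t -> rho u (g n) = 0.
  move=> nut; have := proj_sum hN (w := fun t => pi t (rho t (g n))) u.
  rewrite sum_n (proj_neq hN nut Nn) => /(_ (fun _ => mem_proj _ _ _))/esym pi0.
  have rhoN l w : rho l w \in N by rewrite (subvP (summand_sub hM l)) ?mem_proj.
  have [_ inj _] := straighten_iso; apply: inj; rewrite ?mem0v ?rhoN //.
  by rewrite (straighten_block (mem_proj M u (g n))) pi0 linear0.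
by rewrite (bigD1 t) //= big1 ?addr0 ?mem_proj.
Qed.

(** Projections onto ideals of the whole algebra commute with right multiplication by x_j, so
    [pi t (e i)] is a multiple of e_i. For t other than [blk i] it lies in N^2 and thus vanishes,
    which puts e_i into the given summand. *)
Lemma blocks_of_ideals : (forall t, lb_ideal (Nt t) fullv) -> forall t, M t = Nt t.
Proof.
move=> idN.
have pi_x t v j : v \in N -> pi t (lbr v (x j)) = lbr (pi t v) (x j).
  move=> Nv; rewrite -{1}(sum_proj hN Nv) lbr_suml.
  rewrite (proj_sum hN (w := fun t => lbr (pi t v) (x j))) // => u.
  by case: (idN u) => _ sr _; rewrite (subvP sr) ?mem_lbrv ?mem_proj ?memvf.
have pi_e i t : t != blk i -> pi t (e i) = 0.
  move=> nti; have [|j|c pc] := weight_line F (v := pi t (e i)) (i := i).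
  - by rewrite (subvP (summand_sub hN t)) ?mem_proj.
  - by rewrite -pi_x // (fr_ex F) linearZ.
  have := (blkP i).2 t nti; rewrite pc => /scale_e_sq ->; exact: scale0r.
have eNt i : e i \in Nt (blk i).
  rewrite -(sum_proj hN (eN i)) (bigD1 (blk i)) //= big1 ?addr0 ?mem_proj //.
  by move=> t; apply: pi_e.
have MN t : (M t <= Nt t)%VS.
  apply/subvP; apply: (block_ind F block_index_cross) => [|i <-|v i eit Mv Nv] //.
    exact: memv_lin_closed.
  by rewrite (summand_lbrl hN).
move=> t; apply/eqP; rewrite eqEsubv MN; apply/subvP => n Nn.
have Nn' := subvP (summand_sub hN t) _ Nn.
rewrite -(proj_id hN Nn) -{1}(sum_proj hM Nn') (proj_sum hN (w := fun t => rho t n)).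
  exact: mem_proj.
by move=> u; rewrite (subvP (MN u)) ?mem_proj.
Qed.

End AdaptedBlocks.

(** * Words in the generators *)

(** A basis drawn from a possibly infinite family, to be applied to the words in the generators;
    spanning is expressed as minimality of [U]. *)
Lemma exists_image_basis (K : fieldType) (V : vectType K) (I : eqType)
    (f : I -> V) (Q : pred I) (U : {vspace V}) :
  (forall i, Q i -> f i \in U) ->
  (forall W : {vspace V}, (forall i, Q i -> f i \in W) -> (U <= W)%VS) ->
  exists2 r : seq I, all Q r & basis_of U [seq f i | i <- r].
Proof.
move=> fU minU.
suff main n (r : seq I) : (\dim U - size r <= n)%N -> all Q r -> free [seq f i | i <- r] ->
    exists2 r : seq I, all Q r & basis_of U [seq f i | i <- r].
  by apply: (main _ [::] (leqnn _)) => //; apply: nil_free.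
elim: n r => [|n IHn] r dr Qr fr.
  exists r => //; rewrite basisEfree fr size_map -subn_eq0 -leqn0 dr andbT.
  by apply/span_subvP => _ /mapP[i /(allP Qr) Qi ->]; apply: fU.
have [sub|/existsNP[i /not_implyP[Qi /negP nfi]]] :=
    pselect (forall i, Q i -> f i \in <<[seq f i | i <- r]>>%VS).
  exists r => //; rewrite /basis_of fr andbT eqEsubv minU // andbT.
  by apply/span_subvP => _ /mapP[i /(allP Qr) Qi ->]; apply: fU.
apply: (IHn (i :: r)); rewrite /= ?Qi ?free_cons ?nfi //.
by move: dr; rewrite subnS; case: (_ - _)%N.
Qed.

Section Words.
Variables (K : fieldType) (L : leibnizType K).

Lemma left_normed_rcons (r : seq L) y : r != [::] ->
  left_normed (rcons r y) = lbr (left_normed r) y.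
Proof. by case: r => //= z r _; rewrite -cats1 foldl_cat. Qed.

End Words.

Section Table.
Variables (C : numClosedFieldType) (L : leibnizType C) (N : {vspace L}) (k s : nat).
Variables (e x : 'I_k -> L) (blk : 'I_k -> 'I_s).
Hypothesis F : frame N e x.
Hypothesis eblk : forall i j, blk i != blk j -> lbr (e i) (e j) = 0.

Notation M := (block N e x blk).

Definition block_nann t := [seq i <- enum 'I_k | (blk i == t) && ~~ annr N e i].
Definition block_ann t := [seq i <- enum 'I_k | (blk i == t) && annr N e i].
Definition block_gens t := block_nann t ++ block_ann t.
Notation nb t := (size (block_gens t)).

Definition idx t (j : 'I_(nb t)) : 'I_k := tnth (in_tuple (block_gens t)) j.

Lemma mem_block_gens t i : (i \in block_gens t) = (blk i == t).
Proof.
rewrite mem_cat mem_filter mem_enum mem_filter mem_enum !andbT.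
by case: (blk i == t) => //; case: (annr N e i).
Qed.

Lemma block_gens_uniq t : uniq (block_gens t).
Proof.
rewrite cat_uniq; apply/and3P; split; try exact/filter_uniq/enum_uniq.
apply/hasPn => i.
rewrite mem_filter => /andP[/andP[_ ann] _].
by rewrite mem_filter ann andbF.
Qed.

Lemma idx_inj t : injective (@idx t).
Proof. exact/tuple_uniqP/block_gens_uniq. Qed.

Lemma blk_idx t (j : 'I_(nb t)) : blk (idx j) = t.
Proof. by apply/eqP; rewrite -mem_block_gens mem_tnth. Qed.

Lemma idx_surj i : exists j : 'I_(nb (blk i)), i = idx j.
Proof.
have: i \in in_tuple (block_gens (blk i)) by rewrite mem_block_gens.
by move=> /tnthP[j ij]; exists j.
Qed.

Lemma annr_idx t (j : 'I_(nb t)) : annr N e (idx j) = ~~ (j < size (block_nann t))%N.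
Proof.
rewrite /idx (tnth_nth (idx j)) /= nth_cat; case: ltnP => [ltj|lej] /=.
  have := mem_nth (idx j) ltj; rewrite mem_filter => /andP[/andP[_ +] _].
  exact: negbTE.
have: (j - size (block_nann t) < size (block_ann t))%N.
  by rewrite ltn_subLR // -size_cat.
by move/(mem_nth (idx j)); rewrite mem_filter => /andP[/andP[_ ->] _].
Qed.

Lemma sum_nb : (\sum_t nb t = k)%N.
Proof.
rewrite -[RHS]card_ord -sum1_card (partition_big blk predT) //=.
apply: eq_bigr => t _; rewrite sum1_card -(card_uniqP (block_gens_uniq t)).
by apply: eq_card => i; rewrite mem_block_gens.
Qed.

Definition word t (w : seq 'I_(nb t)) : L := left_normed [seq e (idx j) | j <- w].

Lemma word_rcons t (w : seq 'I_(nb t)) j : w != [::] ->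
  word (rcons w j) = lbr (word w) (e (idx j)).
Proof. by move=> nw; rewrite /word map_rcons left_normed_rcons //; case: w nw. Qed.

Lemma mem_idx t (j : 'I_(nb t)) : e (idx j) \in M t.
Proof. by rewrite -{2}(blk_idx j) (mem_block_e F). Qed.

Lemma word_block t (w : seq 'I_(nb t)) : word w \in M t.
Proof.
elim/last_ind: w => [|w j IHw]; first exact: mem0v.
have [->|nw] := eqVneq w [::]; first exact: mem_idx.
by rewrite word_rcons // (block_lbr F) // mem_idx.
Qed.

Lemma word_sq t (w : seq 'I_(nb t)) : (2 <= size w)%N -> word w \in lbrv (M t) (M t).
Proof.
case/lastP: w => // w j; rewrite size_rcons => lt1.
by rewrite word_rcons ?mem_lbrv ?word_block ?mem_idx //; case: w lt1.
Qed.

Lemma word_weighted t (w : seq 'I_(nb t)) :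
  weighted x (fun i => count_mem i [seq idx j | j <- w]) (word w).
Proof.
move=> i; elim/last_ind: w => [|w j IHw]; first by rewrite lbr0l scaler0.
have [->|nw] := eqVneq w [::].
  by rewrite /= addn0 [LHS](fr_ex F).
rewrite word_rcons // lbr_leibniz IHw (fr_ex F) lbrZl lbrZr -scalerDl.
by rewrite map_rcons -cats1 count_cat natrD /= addn0.
Qed.

Lemma count_idx t (w : seq 'I_(nb t)) j :
  count_mem (idx j) [seq idx j | j <- w] = count_mem j w.
Proof. by rewrite count_map; apply: eq_count => l; rewrite /= (inj_eq (@idx_inj t)). Qed.

(** The induction hypothesis has to quantify over all [W]: a bracket with a generator lies in [W]
    when its left factor lies in the preimage of [W], which again contains all nonempty words. *)
Lemma word_span t (W : {vspace L}) :
  (forall w : seq 'I_(nb t), w != [::] -> word w \in W) -> (M t <= W)%VS.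
Proof.
pose P v := forall W : {vspace L},
  (forall w : seq 'I_(nb t), w != [::] -> word w \in W) -> v \in W.
have main v : v \in M t -> P v.
  apply: (block_ind F eblk) => [|i eit {}W wW|u i eit Mu Pu {}W wW].
  - split=> [{}W _|a u v' Pu Pv {}W wW]; first exact: mem0v.
    by rewrite memvD ?memvZ ?Pu ?Pv.
  - move: (idx_surj i); rewrite eit => -[j ->].
    exact: (wW [:: j]).
  move: (idx_surj i); rewrite eit => -[j ->].
  have: u \in (adr (e (idx j)) @^-1: W)%VS.
    by apply: Pu => w nw; rewrite -memv_preim adrE -word_rcons // wW // -size_eq0 size_rcons.
  by rewrite -memv_preim adrE.
by move=> wW; apply/subvP => v /main; apply.
Qed.

Lemma word_sq_span t (W : {vspace L}) :
  (forall w : seq 'I_(nb t), (2 <= size w)%N -> word w \in W) -> (lbrv (M t) (M t) <= W)%VS.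
Proof.
move=> wW; have ueW i u : blk i = t -> u \in M t -> lbr u (e i) \in W.
  move=> eit; move: (idx_surj i); rewrite eit => -[j ->] Mu.
  have: u \in (adr (e (idx j)) @^-1: W)%VS.
    apply: (subvP (word_span _)) Mu => w nw.
    by rewrite -memv_preim adrE -word_rcons // wW // size_rcons ltnS lt0n size_eq0.
  by rewrite -memv_preim adrE.
apply/lbrvP => u v Mu Mv; move: v Mv u Mu.
apply: (block_ind F eblk) => [|i eit u Mu|v i eit Mv Wv u Mu].
- split=> [u _|a v v' Pv Pv' u Mu]; first by rewrite lbr0r mem0v.
  by rewrite lbrDr lbrZr memvD ?memvZ ?Pv ?Pv'.
- exact: ueW.
have Me : e i \in M t by rewrite -eit (mem_block_e F).
by rewrite lbr_lbr memvB ?ueW ?Wv // (block_lbr F).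
Qed.

Lemma gens_free t (c : 'I_(nb t) -> C) :
  \sum_j c j *: e (idx j) \in lbrv N N -> forall j, c j = 0.
Proof.
move=> Nc j; pose d i := \sum_(l | idx l == i) c l.
suff: d (idx j) = 0.
  by rewrite /d (big_pred1 j) // => l; rewrite /= (inj_eq (@idx_inj t)).
apply: (fr_free F (c := d)).
suff -> : \sum_i d i *: e i = \sum_j c j *: e (idx j) by [].
rewrite [RHS](partition_big (@idx t) predT) //=; apply: eq_bigr => i _.
by rewrite scaler_suml; apply: eq_bigr => l /eqP ->.
Qed.

Lemma exists_basis_words : exists ws : forall t, seq (seq 'I_(nb t)),
  forall t, all (fun w => 2 <= size w)%N (ws t) /\
    basis_of (lbrv (M t) (M t)) [seq word w | w <- ws t].
Proof.
apply: (@fin_all_exists _ _ (fun t (ws : seq (seq 'I_(nb t))) =>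
  all (fun w => 2 <= size w)%N ws /\ basis_of (lbrv (M t) (M t)) [seq word w | w <- ws])) => t.
have [ws Qws bws] := exists_image_basis (@word_sq t) (@word_sq_span t).
by exists ws.
Qed.

End Table.

(** * The adapted basis *)

Section AdaptedBasis.
Variables (C : numClosedFieldType) (L : leibnizType C) (N : {vspace L}) (k s : nat).
Variables (e x : 'I_k -> L) (blk : 'I_k -> 'I_s).
Hypothesis F : frame N e x.
Hypothesis eblk : forall i j, blk i != blk j -> lbr (e i) (e j) = 0.

Let eN := fr_mem F.
Notation M := (block N e x blk).
Let hM : ideal_decomposition N M := block_decomposition F eblk.
Notation nb t := (size (block_gens N e blk t)).

Variable ws : forall t, seq (seq 'I_(nb t)).
Hypothesis wsP : forall t, all (fun w => 2 <= size w)%N (ws t) /\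
  basis_of (lbrv (M t) (M t)) [seq word w | w <- ws t].

Definition block_basis : basis_data L s := {|
  bk1 := fun t => size (block_nann N e blk t);
  bk := fun t => nb t;
  bm := fun t => size (ws t);
  be := fun t i => match split i with
    | inl j => e (idx j)
    | inr l => word (tnth (in_tuple (ws t)) l)
    end;
  bx := fun t j => x (idx j);
  wd := fun t l => tnth (in_tuple (ws t)) l
|}.
Notation B := block_basis.

Lemma block_basis_gen t (j : 'I_(nb t)) : @gen _ _ _ B t j = e (idx j).
Proof. by rewrite /gen /= -[lshift _ j]/(unsplit (inl j)) unsplitK. Qed.

Lemma block_basis_ngen t (l : 'I_(size (ws t))) :
  @ngen _ _ _ B t l = word (tnth (in_tuple (ws t)) l).
Proof. by rewrite /ngen /= -[rshift _ l]/(unsplit (inr l)) unsplitK. Qed.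

Lemma block_basis_beP t i : (exists j, @be _ _ _ B t i = @gen _ _ _ B t j) \/
  (exists l, @be _ _ _ B t i = @ngen _ _ _ B t l).
Proof.
rewrite -[ i]splitK; case: (split i) => [j|l]; [left; exists j | right; exists l] => //.
Qed.

Lemma block_basis_be t i : @be _ _ _ B t i \in M t.
Proof.
case: (block_basis_beP i) => [[j ->]|[l ->]].
  by rewrite block_basis_gen (mem_idx F eblk).
by rewrite block_basis_ngen (word_block F eblk).
Qed.

Lemma size_wd t (l : 'I_(size (ws t))) : (2 <= size (@wd _ _ _ B t l))%N.
Proof. by have [/allP + _] := wsP t; apply; apply: mem_tnth. Qed.

Lemma block_basis_ngen_sq t l : @ngen _ _ _ B t l \in lbrv (M t) (M t).
Proof. by rewrite block_basis_ngen (word_sq F eblk) // size_wd. Qed.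

Lemma block_basis_span_ngen t : fspan (@ngen _ _ _ B t) = lbrv (M t) (M t).
Proof.
have [_ /span_basis <-] := wsP t; apply/eqP; rewrite eqEsubv; apply/andP; split.
  apply: fspan_sub => l; rewrite block_basis_ngen memv_span // map_f //.
  exact: mem_tnth.
apply/span_subvP => _ /mapP[w /(@tnthP _ _ (in_tuple (ws t)))[l ->] ->].
by rewrite -block_basis_ngen mem_fspan.
Qed.

Lemma block_sq_sub t : (lbrv (M t) (M t) <= lbrv N N)%VS.
Proof. by apply: lbrvS; apply: block_sub. Qed.

Lemma block_basis_span_gen t : fspan (@gen _ _ _ B t) = fspan (fun j : 'I_(nb t) => e (idx j)).
Proof. by congr (fspan _); apply/funext => j; apply: block_basis_gen. Qed.

Lemma block_basis_complementary t :
  complementary (M t) (fspan (@gen _ _ _ B t)) (lbrv (M t) (M t)).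
Proof.
rewrite block_basis_span_gen; split.
  apply/eqP; rewrite eqEsubv; apply/andP; split.
    rewrite subv_add fspan_sub => [|j]; last exact: (mem_idx F eblk).
    by apply/lbrvP => u v; apply: (block_lbr F).
  apply/subvP => v Mv; have [c c0 vc] := block_gen F eblk Mv.
  rewrite -(subrK (\sum_i c i *: e i) v) addrC memv_add //.
  apply: memv_suml => i _; have [eit|nit] := eqVneq (blk i) t; last first.
    by rewrite c0 // scale0r mem0v.
  move: (idx_surj N e blk i); rewrite eit => -[j ->].
  by rewrite memvZ // (mem_fspan (fun j : 'I_(nb t) => e (idx j))).
apply/eqP; rewrite -subv0; apply/subvP => v; rewrite memv_cap memv0.
move=> /andP[/fspanP[c ->] /(subvP (@block_sq_sub t))/(gens_free F) c0].
by rewrite big1 // => j _; rewrite c0 scale0r.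
Qed.

Lemma block_basis_lindep t : lindep_free (@gen _ _ _ B t).
Proof.
move=> c; under eq_bigr do rewrite block_basis_gen.
by move=> c0; apply: (gens_free F); rewrite c0 mem0v.
Qed.

Lemma bk_block t : nb t = (\dim (M t) - \dim (lbrv (M t) (M t)))%N.
Proof.
have [defM cap0] := block_basis_complementary t.
rewrite -{1}defM dimv_disjoint_sum // addnK dim_fspan ?card_ord //.
exact: block_basis_lindep.
Qed.

Lemma dim_block t : \dim (M t) = (nb t + size (ws t))%N.
Proof.
have [defM cap0] := block_basis_complementary t.
rewrite -{1}defM dimv_disjoint_sum // dim_fspan ?card_ord; last exact: block_basis_lindep.
by have [_ /andP[/eqP <- /eqP ->]] := wsP t; rewrite size_map.
Qed.

Lemma block_basis_span t : (M t <= fspan (@be _ _ _ B t))%VS.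
Proof.
have [<- _] := block_basis_complementary t.
rewrite subv_add -block_basis_span_ngen; apply/andP.
by split; apply: fspan_sub => j; apply: (mem_fspan (@be _ _ _ B t)).
Qed.

Lemma block_basis_adapted_summand t : @adapted_summand _ _ _ B (M t) t.
Proof.
split.
- rewrite basisEdim size_map size_enum_ord /= dim_block leqnn andbT.
  exact: block_basis_span.
- split; first exact: bk_block.
  exact: block_basis_complementary.
- by rewrite /= size_cat leq_addr.
- move=> j; rewrite block_basis_gen; have := annr_idx j.
  case: ifP => _ /=; rewrite /annr => /asboolP ann.
    move=> [_ annM]; apply: ann; split=> // y Ny.
    have [w [wM ->]] := block_split F eblk Ny; rewrite lbr_suml big1 // => u _.
    have [->|nut] := eqVneq u t; first exact: annM.
    apply: (block_cross F eblk (t := u) (u := t)) => //; exact: (mem_idx F eblk).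
  by split=> [|y /(subvP (block_sub _ _ _ _ _))]; [exact: (mem_idx F eblk) | apply ann.2].
- move=> l; split; [exact: block_basis_ngen_sq | exact: size_wd | ].
  rewrite block_basis_ngen /word; congr left_normed.
  by apply: eq_map => j; rewrite block_basis_gen.
Qed.

Lemma mem_x_family j : x j \in x_family B.
Proof.
have [l ->] := idx_surj N e blk j.
by apply/allpairsPdep; exists (blk j), l; rewrite !mem_enum.
Qed.

Lemma block_basis_x_family : <<x_family B>>%VS = fspan x.
Proof.
apply/eqP; rewrite eqEsubv; apply/andP; split.
  apply/span_subvP => _ /allpairsPdep[t [j [_ _ ->]]]; exact: (mem_fspan x).
by apply: fspan_sub => j; rewrite memv_span ?mem_x_family.
Qed.

Lemma block_basis_adapted : adapted_basis B N M.
Proof.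
have free_x : lindep_free x.
  by move=> c c0; apply: (fr_xfree F); rewrite c0 mem0v.
split.
- rewrite basisEdim; apply/andP; split.
    rewrite span_cat block_basis_x_family -(fr_sum F) addvS //.
    have [_ <- _] := hM; apply/subv_sumP => t _.
    apply: subv_trans (block_basis_span t) _; apply: fspan_sub => i.
    apply/memv_span/allpairsPdep; exists t, i; split; by rewrite ?mem_enum.
  rewrite size_cat !size_allpairs_dep -(fr_sum F) dimv_disjoint_sum ?(capNx F) //.
  rewrite dim_fspan // card_ord (dim_decomposition hM).
  rewrite leq_add //.
    rewrite sumnE big_map big_enum /=; apply: leq_sum => t _.
    by rewrite size_enum_ord dim_block.
  rewrite sumnE big_map big_enum /= -[leqRHS](sum_nb N e blk).
  by apply: leq_sum => t _; rewrite size_enum_ord.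
- by rewrite block_basis_x_family; split; [exact: fr_sum F | exact: capNx F].
exact: block_basis_adapted_summand.
Qed.

Lemma block_basis_be_sq t i j :
  lbr (@be _ _ _ B t i) (@be _ _ _ B t j) \in fspan (@ngen _ _ _ B t).
Proof. by rewrite block_basis_span_ngen mem_lbrv ?block_basis_be. Qed.

Lemma same_structureE t (i l : 'I_(size (ws t))) :
  @same_structure _ _ _ B t i l =
  [forall j, count_mem j [seq idx p | p <- @wd _ _ _ B t l] ==
             count_mem j [seq idx p | p <- @wd _ _ _ B t i]].
Proof.
apply/forallP/forallP => H j; last first.
  by have := H (idx j); rewrite !count_idx eq_sym.
have [bj|nbj] := eqVneq (blk j) t.
  move: (idx_surj N e blk j); rewrite bj => -[p ->].
  by rewrite !count_idx eq_sym; apply: H.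
have c0 (w : seq 'I_(nb t)) : count_mem j [seq idx p | p <- w] = 0%N.
  rewrite count_map -(count_pred0 w); apply: eq_count => p /=.
  by apply: contraNF nbj => /eqP <-; rewrite blk_idx.
by rewrite !c0.
Qed.

(** Since [x_j, x_p] = 0, left multiplication by x_j commutes with right multiplication by every
    x_p. It therefore preserves multidegree, and in the expansion along words only those with the
    same letter counts remain. *)
Lemma block_basis_adl_ngen t (j : 'I_(nb t)) (i : 'I_(size (ws t))) :
  exists b : 'I_(size (ws t)) -> C, lbr (x (idx j)) (@ngen _ _ _ B t i) =
    \sum_(l | @same_structure _ _ _ B t i l) b l *: @ngen _ _ _ B t l.
Proof.
pose v := lbr (x (idx j)) (@ngen _ _ _ B t i).
have adl_sq u : u \in lbrv (M t) (M t) -> lbr (x (idx j)) u \in lbrv (M t) (M t).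
  apply: (lbrv_ind (P := fun u => lbr (x (idx j)) u \in lbrv (M t) (M t))).
    split=> [|a u1 u2 P1 P2]; first by rewrite lbr0r mem0v.
    by rewrite lbrDr lbrZr memvD ?memvZ.
  by move=> a b Ma Mb; rewrite lbr_lbr memvB // mem_lbrv // (block_x_lbr F eblk).
have := adl_sq _ (block_basis_ngen_sq i); rewrite -/v.
rewrite -block_basis_span_ngen => /fspanP[b def_v]; exists b; rewrite -/v.
pose f (o : 'I_1 + 'I_(size (ws t))) :=
  match o with inl _ => - v | inr l => b l *: @ngen _ _ _ B t l end.
pose al (o : 'I_1 + 'I_(size (ws t))) p := count_mem p
  [seq idx p | p <- @wd _ _ _ B t (match o with inl _ => i | inr l => l end)].
have wng l : weighted x
    (fun p => count_mem p [seq idx p | p <- @wd _ _ _ B t l]) (@ngen _ _ _ B t l).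
  by rewrite block_basis_ngen; apply: (word_weighted F).
have wf o : weighted x (al o) (f o).
  move=> p; case: o => [o|l] /=; last by rewrite lbrZl wng !scalerA mulrC.
  by rewrite lbrNl lbr_leibniz (fr_xx F) lbr0l add0r wng lbrZr scalerN.
have := weight_sep (al (inl ord0)) wf.
rewrite !big_sumType big_ord1 /= -def_v addNr => /(_ erefl) /eqP.
rewrite big_ord1_cond /=; case: ifP => [_|/forallP[] //].
rewrite addrC subr_eq0 => /eqP <-; apply: eq_bigl => l.
by rewrite same_structureE.
Qed.

End AdaptedBasis.

(** * The table of multiplications and the blocks of the extension *)

Section MultiplicationTable.
Variables (C : numClosedFieldType) (L : leibnizType C) (N : {vspace L}) (k s : nat).
Variables (e x : 'I_k -> L) (blk : 'I_k -> 'I_s).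
Hypothesis F : frame N e x.
Hypothesis ZN : center_in_sq N.
Hypothesis eblk : forall i j, blk i != blk j -> lbr (e i) (e j) = 0.
Notation M := (block N e x blk).
Notation nb t := (size (block_gens N e blk t)).

Lemma block_basis_table (ws : forall t, seq (seq 'I_(nb t))) :
  (forall t, all (fun w => 2 <= size w)%N (ws t) /\
    basis_of (lbrv (M t) (M t)) [seq word w | w <- ws t]) ->
  multiplication_table (block_basis x ws).
Proof.
move=> wsP; set B := block_basis x ws.
have beM t i : @be _ _ _ B t i \in M t by apply: block_basis_be.
have /fin_all_exists[gamma gammaP] t : exists gamma : 'I_(bk B t + bm B t) ->
    'I_(bk B t + bm B t) -> 'I_(bm B t) -> C,
    forall i j, lbr (@be _ _ _ B t i) (@be _ _ _ B t j) =
      \sum_(p < bm B t) gamma i j p *: @ngen _ _ _ B t p.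
  apply: (@fin_all_exists _ _ (fun i (g : _ -> _ -> C) => forall j,
    lbr (@be _ _ _ B t i) (@be _ _ _ B t j) = \sum_p g j p *: @ngen _ _ _ B t p)) => i.
  apply: (@fin_all_exists _ _ (fun j (g : _ -> C) =>
    lbr (@be _ _ _ B t i) (@be _ _ _ B t j) = \sum_p g p *: @ngen _ _ _ B t p)) => j.
  exact/fspanP/(block_basis_be_sq F eblk wsP).
have /fin_all_exists[beta betaP] t : exists beta : 'I_(bk B t) -> 'I_(bm B t) ->
    'I_(bm B t) -> C,
    forall j i, lbr (@bx _ _ _ B t j) (@ngen _ _ _ B t i) =
      \sum_(l | @same_structure _ _ _ B t i l) beta j i l *: @ngen _ _ _ B t l.
  apply: (@fin_all_exists _ _ (fun j (b : _ -> _ -> C) => forall i,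
    lbr (@bx _ _ _ B t j) (@ngen _ _ _ B t i) =
      \sum_(l | @same_structure _ _ _ B t i l) b i l *: @ngen _ _ _ B t l)) => j.
  apply: (@fin_all_exists _ _ (fun i (b : _ -> C) =>
    lbr (@bx _ _ _ B t j) (@ngen _ _ _ B t i) =
      \sum_(l | @same_structure _ _ _ B t i l) b l *: @ngen _ _ _ B t l)) => i.
  exact: (block_basis_adl_ngen F eblk wsP).
exists gamma, beta; split; last split.
- move=> t; split=> // i j.
  + rewrite block_basis_gen (fr_ex F) (inj_eq (@idx_inj _ _ _ _ _ _ _ t)).
    by case: eqP; rewrite ?scale1r ?scale0r.
  + rewrite block_basis_gen (lbr_xe F ZN) (inj_eq (@idx_inj _ _ _ _ _ _ _ t)).
    by rewrite annr_idx negbK.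
  rewrite block_basis_ngen (word_weighted F); congr (_%:R *: _).
  exact: count_idx.
- move=> t u ntu; split=> i j.
  + by apply: (block_cross F eblk ntu); apply: beM.
  + by have /blockP[_ -> //] := beM t i; rewrite blk_idx eq_sym.
  by apply: (block_x_cross F eblk (t := t)) => //; rewrite blk_idx eq_sym.
by move=> t u i j; apply: (fr_xx F).
Qed.

Definition xspan t : {vspace L} := fspan (fun j : 'I_(nb t) => x (idx j)).
Definition extended_block t : {vspace L} := (M t + xspan t)%VS.
Notation R := extended_block.

Lemma extended_block_ind t (P : L -> Prop) : lin_closed P ->
  (forall v, v \in M t -> P v) -> (forall j, blk j = t -> P (x j)) ->
  forall v, v \in R t -> P v.
Proof.
move=> linP PM Px; apply: addv_ind => // v.
by apply: fspan_ind => // j; apply: Px; apply: blk_idx.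
Qed.

Lemma fullv_block_ind (P : L -> Prop) : lin_closed P ->
  (forall t v, v \in M t -> P v) -> (forall j, P (x j)) -> forall v, P v.
Proof.
move=> linP PM Px v; have: v \in (N + fspan x)%VS by rewrite (fr_sum F) memvf.
apply: addv_ind => // u; last exact: fspan_ind.
by move=> /(block_split F eblk)[w [wM ->]]; apply: (lin_closed_sum linP) => t _; apply: (PM t).
Qed.

Lemma mem_extended_x j : x j \in R (blk j).
Proof.
have [l ->] := idx_surj N e blk j; rewrite (subvP (addvSr _ _)) //.
by rewrite blk_idx (mem_fspan (fun j : 'I_(nb (blk j)) => x (idx j))).
Qed.

Lemma mem_lin_lbrl (W : {vspace L}) u : lin_closed (fun v => lbr v u \in W).
Proof.
split=> [|a v w Pv Pw]; first by rewrite lbr0l mem0v.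
by rewrite lbrDl lbrZl memvD ?memvZ.
Qed.

Lemma mem_lin_lbrr (W : {vspace L}) u : lin_closed (fun v => lbr u v \in W).
Proof.
split=> [|a v w Pv Pw]; first by rewrite lbr0r mem0v.
by rewrite lbrDr lbrZr memvD ?memvZ.
Qed.

Lemma extended_block_lbr t u v : u \in R t ->
  (lbr u v \in M t /\ lbr v u \in M t).
Proof.
move=> Ru; split; move: v.
  apply: fullv_block_ind => [|w v Mv|j]; first exact: mem_lin_lbrr.
  - move: u Ru; apply: extended_block_ind => [|u Mu|j ejt]; first exact: mem_lin_lbrl.
      have [etw|ntw] := eqVneq t w; first by rewrite (block_lbr F) // etw.
      by rewrite (block_cross F eblk ntw Mu Mv) mem0v.
    have [etw|ntw] := eqVneq t w; first by rewrite etw (block_x_lbr F eblk).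
    by rewrite (block_x_cross F eblk (t := w)) ?mem0v // ejt.
  move: u Ru; apply: extended_block_ind => [|u Mu|l elt]; first exact: mem_lin_lbrl.
    exact: (block_lbr_x F).
  by rewrite (fr_xx F) mem0v.
apply: fullv_block_ind => [|w v Mv|j]; first exact: mem_lin_lbrl.
- move: u Ru; apply: extended_block_ind => [|u Mu|j ejt]; first exact: mem_lin_lbrr.
    have [etw|ntw] := eqVneq w t; first by rewrite (block_lbr F) // -etw.
    by rewrite (block_cross F eblk ntw Mv Mu) mem0v.
  have [etw|ntw] := eqVneq w t; first by rewrite -etw (block_lbr_x F).
  by have /blockP[_ -> //] := Mv; rewrite ?mem0v // ejt eq_sym.
move: u Ru; apply: extended_block_ind => [|u Mu|l elt]; first exact: mem_lin_lbrr.
  exact: (block_x_lbr F eblk).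
by rewrite (fr_xx F) mem0v.
Qed.

Lemma xspan_sub t : (xspan t <= fspan x)%VS.
Proof. by apply: fspan_sub => j; apply: mem_fspan. Qed.

Lemma cap_block_xspan t : (M t :&: xspan t)%VS = 0%VS.
Proof.
by apply/eqP; rewrite -subv0 -(capNx F) capvS // ?block_sub ?xspan_sub.
Qed.

Lemma extended_decomposition : ideal_decomposition fullv R.
Proof.
have hM := block_decomposition F eblk.
have sumR : (\sum_t R t)%VS = fullv.
  apply/eqP; rewrite eqEsubv subvf; apply/subvP => v _.
  move: v; apply: fullv_block_ind => [|t v Mv|j]; first exact: memv_lin_closed.
    by rewrite (subvP (sumv_sup t _ (subvv _))) // (subvP (addvSl _ _)).
  by rewrite (subvP (sumv_sup (blk j) _ (subvv _))) // mem_extended_x.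
split=> // [t|].
  split; first exact: subvf.
    by apply/lbrvP => u v Ru _; rewrite (subvP (addvSl _ _)) //; case: (extended_block_lbr v Ru).
  by apply/lbrvP => v u _ Ru; rewrite (subvP (addvSl _ _)) //; case: (extended_block_lbr v Ru).
rewrite directvEgeq /= sumR -(fr_sum F) dimv_disjoint_sum ?(capNx F) //.
rewrite (dim_decomposition hM) dim_fspan ?card_ord; last first.
  by move=> c c0; apply: (fr_xfree F); rewrite c0 mem0v.
rewrite -[X in (_ + X)%N](sum_nb N e blk) -big_split /=; apply: leq_sum => t _.
rewrite dimv_disjoint_sum ?cap_block_xspan // leq_add2l.
by rewrite (leq_trans (dim_span _)) // size_codom card_ord.
Qed.

(** A nilpotent ideal of R_t is an ideal of the whole algebra because brackets with the other
    summands vanish, so it lies in N, where components along the x_j vanish. *)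
Lemma extended_nilradical : lb_nilradical N fullv -> forall t,
  lb_nilradical (M t) (R t) /\ complementary (R t) (M t) (xspan t).
Proof.
move=> [_ _ maxN] t; have MR : (M t <= R t)%VS by apply: addvSl.
split; last by split=> //; apply: cap_block_xspan.
split.
- split=> //; apply/lbrvP => u v.
    by move=> /(subvP MR) Ru _; case: (extended_block_lbr v Ru).
  by move=> Ru _; case: (extended_block_lbr v Ru).
- have [m m0] := fr_nil F; exists m; apply/eqP; rewrite -subv0 -m0.
  by elim: m {m0} => [|m IHm]; rewrite ?block_sub // lbrvS ?block_sub.
move=> I idI nilI; have [IR _ _] := idI.
have IN : (I <= N)%VS by apply: maxN (summand_ideal extended_decomposition idI) nilI.
apply/subvP => v Iv; have /memv_addP[m Mm [q Qq def_v]] := subvP IR _ Iv.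
have Nq : q \in N.
  have -> : q = v - m by rewrite def_v addrAC subrr add0r.
  by rewrite memvB //; [apply: (subvP IN) | apply: (subvP (block_sub _ _ _ _ _) _ Mm)].
have: q \in (N :&: fspan x)%VS by rewrite memv_cap Nq (subvP (xspan_sub t)).
by rewrite (capNx F) memv0 def_v => /eqP ->; rewrite addr0.
Qed.

End MultiplicationTable.

(** * Regrading *)

Section Gradings.
Variables (C : numClosedFieldType) (L : leibnizType C) (N : {vspace L}).
Hypothesis NN : (lbrv N N <= N)%VS.
Hypothesis nilN : lb_nilpotent N.
Variable k : nat.

(** What a frame induces on N alone. Frames of different extensions can thus be compared on the same
    N. *)
Record grading (e : 'I_k -> L) (D : 'I_k -> 'End(L)) : Prop := Grading {
  gd_gen : generates N e;
  gd_free : forall c : 'I_k -> C, \sum_i c i *: e i \in lbrv N N -> forall i, c i = 0;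
  gd_der : forall j, derivation_on N (D j);
  gd_De : forall i j, D j (e i) = (i == j)%:R *: e i
}.

Lemma grading_der e D : grading e D -> derivation_on N (\sum_j D j).
Proof. by move=> G; apply: (lin_closed_sum (derivation_lin N)) => j _; apply: gd_der G j. Qed.

Lemma grading_De e D : grading e D -> forall i, (\sum_j D j) (e i) = e i.
Proof.
move=> G i; rewrite sum_lfunE (bigD1 i) //= (gd_De G) eqxx scale1r big1 ?addr0 // => j nji.
by rewrite (gd_De G) eq_sym (negPf nji) scale0r.
Qed.

(* theta takes the lowest-degree part, with respect to (e, D), of vectors that
   are homogeneous with respect to (e', D'). *)
Lemma exists_regrading e D e' D' : grading e D -> grading e' D' ->
  exists2 theta : 'End(L), lb_iso N N theta & forall i, theta (e' i) \in fspan e.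
Proof.
(* The successor ensures that degree 1 does not exceed [c] even when N = 0. *)
move=> G G'; have [c0 Nc0] := nilN; pose c := c0.+1.
have Nc : lcs N c = 0%VS.
  by apply/eqP; rewrite -subv0 -Nc0; apply: lcsS.
have gen := gd_gen G; have gen' := gd_gen G'.
have der := grading_der G; have der' := grading_der G'.
have De := grading_De G; have De' := grading_De G'.
set D0 := \sum_j D j in der De; set D0' := \sum_j D' j in der' De'.
pose P := degree_proj D0 c; pose P' := degree_proj D0' c.
pose theta : 'End(L) := \sum_(m < c.+1) (P m \o P' m)%VF.
have thetaE m v : (m <= c)%N -> homog N D0' m v -> theta v = P m v.
  move=> mc hv; have ltm : (m < c.+1)%N by [].
  rewrite sum_lfunE (bigD1 (Ordinal ltm)) //= comp_lfunE (degree_projE m hv) // eqxx.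
  rewrite big1 ?addr0 // => n; rewrite -val_eqE /= => nnm.
  by rewrite comp_lfunE (degree_projE n hv) // eq_sym (negPf nnm) linear0.
have PN m v : (m <= c)%N -> v \in N -> homog N D0 m (P m v).
  by move=> mc Nv; apply: (degree_proj_homog NN nilN gen der De Nc).
have thetaN v : v \in N -> theta v \in N.
  move=> Nv; rewrite sum_lfunE memv_suml // => m _; rewrite comp_lfunE.
  have mc : (m <= c)%N by rewrite -ltnS.
  by case: (PN m (P' m v) mc) => //; case: (degree_proj_homog NN nilN gen' der' De' Nc mc Nv).
have he' i : homog N D0' 1 (e' i) by apply: homog_e.
have theta_e i : theta (e' i) = P 1%N (e' i) by apply: thetaE.
have he1 i : homog N D0 1 (theta (e' i)) by rewrite theta_e; apply: PN => //; exact: gn_mem gen' i.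
have tail m v : (0 < m <= c)%N -> homog N D0' m v -> v - P m v \in lcs N m.
  move=> mc hv; apply: (sub_degree_proj NN nilN gen der De Nc) => //.
  by apply: (homog_lcs NN gen' der' De' hv); case/andP: mc => /prednK ->.
have theta_lbr_homog m v i : (0 < m <= c)%N -> homog N D0' m v ->
    theta (lbr v (e' i)) = lbr (theta v) (theta (e' i)).
  move=> /andP[m0 mc] hv; have [Nv _] := hv; have Ne := gn_mem gen' i.
  have hve := homog_lbr NN der' hv (he' i).
  have hPv := PN _ _ mc Nv; have hPP := homog_lbr NN der hPv (he1 i).
  rewrite (thetaE m v) //; have [ltm|] := ltnP m c; last first.
    move=> cm; have lt : (c < m + 1)%N by rewrite addn1 ltnS.
    rewrite (homog_gtn NN gen' der' De' Nc hve lt) linear0.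
    by rewrite (homog_gtn NN gen der De Nc hPP lt).
  have m1c : (m + 1 <= c)%N by rewrite addn1.
  rewrite (thetaE (m + 1)%N (lbr v (e' i))) //.
  (* Passing to lowest-degree parts changes the product by the two last terms, which lie in
     [lcs N m.+1] and so have no component of degree m + 1. *)
  have def_ve : lbr v (e' i) = lbr (P m v) (theta (e' i)) +
      (lbr (v - P m v) (e' i) + lbr (P m v) (e' i - P 1%N (e' i))).
    by rewrite theta_e lbrDl lbrDr lbrNl lbrNr; vring.
  rewrite def_ve linearD /= (degree_projE (m + 1) hPP) // eqxx.
  rewrite [X in _ + X](degree_proj_lcs NN nilN gen der De Nc (l := m.+1)) ?addr0 ?addn1 //.
  rewrite memvD //; first by rewrite mem_lbrv // tail // m0.
  have -> : m.+1 = m.-1.+2 by rewrite prednK.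
  apply: (subvP (lbrv_lcs_sq N m.-1)).
  rewrite mem_lbrv //; last exact: (tail 1%N).
  by apply: (homog_lcs NN gen der De hPv); rewrite prednK.
have theta_e_lbr v i : v \in N -> theta (lbr v (e' i)) = lbr (theta v) (theta (e' i)).
  move=> /(homog_split NN nilN gen' der' De' Nc)[w wP ->].
  rewrite lbr_suml !linear_sum /= lbr_suml; apply: eq_bigr => m _.
  have [m0|m0] := posnP m; last by apply: theta_lbr_homog => //; rewrite m0 -ltnS /=.
  have := wP m; rewrite m0 => w0.
  rewrite (homog_lcs0 NN nilN gen' der' De' w0 (l := 0)) // ?lbr0l ?linear0 ?lbr0l //.
  by case: w0.
exists theta.
  apply: generating_hom_bij => //; first exact: hom_of_generators gen' theta_e_lbr.
  move=> b; rewrite -{1}(gn_gen gen') => /memv_addP[_ /fspanP[a ->] [w NNw ->]].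
  exists (\sum_i a i *: e' i); first by rewrite memv_suml // => i _; rewrite memvZ ?(gn_mem gen').
  rewrite linear_sum addrAC -sumrB /= memvD // memv_suml // => i _.
  by rewrite linearZ /= -scalerBr memvZ // theta_e (tail 1%N).
move=> i; have [+ _] := he1 i; rewrite -{1}(gn_gen gen).
move=> /memv_addP[q Eq [w NNw def_t]]; suff w0 : w = 0 by rewrite def_t w0 addr0.
apply: (homog_lcs0 NN nilN gen der De (m := 1) (l := 1)) => //.
have -> : w = (-1) *: q + theta (e' i) by rewrite def_t; vring.
apply: (homog_lin N D0 1).2 => //; move: q Eq {def_t}.
by apply: fspan_ind; [apply: homog_lin | apply: homog_e].
Qed.

End Gradings.

(** * Lifting matrices to automorphisms *)

Section DerivationAlgebra.
Variables (C : numClosedFieldType) (L : leibnizType C) (N : {vspace L}) (k : nat).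
Hypothesis NN : (lbrv N N <= N)%VS.
Hypothesis nilN : lb_nilpotent N.
Variables (e : 'I_k -> L) (D : 'I_k -> 'End(L)).
Hypothesis G : grading N e D.
Implicit Types y z : 'M[C]_k.

Let gen := gd_gen G.

(** Row [i] of the matrix gives the image of e_i; composing maps therefore multiplies matrices in
    the opposite order. *)
Definition mact y i : L := \sum_j y i j *: e j.

Lemma mact_mul y z i : mact (y *m z) i = \sum_j y i j *: mact z j.
Proof.
rewrite /mact; under [RHS]eq_bigr do rewrite scaler_sumr.
rewrite exchange_big /=; apply: eq_bigr => l _.
by rewrite mxE scaler_suml; apply: eq_bigr => j _; rewrite scalerA.
Qed.

Lemma mactD a y z i : mact (a *: y + z) i = a *: mact y i + mact z i.
Proof.
rewrite scaler_sumr -big_split; apply: eq_bigr => j _.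
by rewrite !mxE scalerDl scalerA.
Qed.

Lemma mactN y i : mact (- y) i = - mact y i.
Proof. by rewrite /mact -sumrN; apply: eq_bigr => j _; rewrite mxE scaleNr. Qed.

Lemma mact1 i : mact 1%:M i = e i.
Proof.
rewrite /mact (bigD1 i) //= mxE eqxx scale1r big1 ?addr0 // => j nji.
by rewrite mxE eq_sym (negPf nji) scale0r.
Qed.

Definition derivation_matrix y : Prop :=
  exists2 delta : 'End(L), derivation_on N delta & forall i, delta (e i) = mact y i.
Notation dm := derivation_matrix.

Lemma lfun_mact (f : 'End(L)) y z i : (forall i, f (e i) = mact z i) ->
  f (mact y i) = mact (y *m z) i.
Proof.
move=> fe; rewrite mact_mul linear_sum; apply: eq_bigr => j _.
by rewrite linearZ /= fe.
Qed.

Lemma dm_lin : lin_closed dm.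
Proof.
split=> [|a y z [f fder fe] [g gder ge]].
  exists 0; first exact: (derivation_lin N).1.
  by move=> i; rewrite zero_lfunE /mact big1 // => j _; rewrite mxE scale0r.
exists (a *: f + g); first exact: (derivation_lin N).2.
by move=> i; rewrite add_lfunE scale_lfunE fe ge mactD.
Qed.

Lemma dm_comm y z : dm y -> dm z -> dm (y *m z - z *m y).
Proof.
move=> [f fder fe] [g gder ge]; exists ((g \o f) - (f \o g))%VF.
  exact: derivation_comm.
move=> i; rewrite add_lfunE opp_lfunE !comp_lfunE fe ge.
rewrite (lfun_mact _ _ ge) (lfun_mact _ _ fe) -scaleN1r addrC -mactD.
by rewrite scaleN1r addrC.
Qed.

Lemma dm_diag i : dm (delta_mx i i).
Proof.
exists (D i); first exact: gd_der G i.
move=> l; rewrite (gd_De G) /mact (bigD1 i) //= mxE eqxx andbT.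
rewrite big1 ?addr0 => [|j nji]; first by case: eqP => [->|]; rewrite ?scale0r.
by rewrite mxE (negPf nji) andbF scale0r.
Qed.

(* Commutators with the diagonal units extract the (i, j) entry. *)
Lemma dm_entry y i j : dm y -> y i j != 0 -> dm (delta_mx i j).
Proof.
move=> dy nz; have [->|nij] := eqVneq i j; first exact: dm_diag.
pose com (a b : 'M[C]_k) := a *m b - b *m a.
have comE l z a b : com z (delta_mx l l) a b = ((b == l)%:R - (a == l)%:R) * z a b.
  rewrite !mxE (bigD1 l) //= mxE eqxx andTb big1 ?addr0 => [|m nml]; last first.
    by rewrite mxE (negPf nml) mulr0.
  rewrite (bigD1 l) //= mxE eqxx andbT big1 ?addr0 => [|m nml]; last first.
    by rewrite mxE (negPf nml) andbF mul0r.
  by case: (eqVneq a l) => [->|_]; case: (eqVneq b l) => [->|_];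
    rewrite ?mulr1n ?mulr0n; ring.
(* [z1] is -(y_ij E_ij + y_ji E_ji). A further commutator with E_ii changes the sign at the entry
   (i, j) only, so subtracting [z1] leaves 2 y_ij E_ij. *)
pose z1 := com (com y (delta_mx j j)) (delta_mx i i).
have dz1 : dm z1 by do 2!apply: dm_comm (dm_diag _).
have dz2 : dm (com z1 (delta_mx i i)) by apply: dm_comm (dm_diag _).
have := lin_closedZ dm_lin (2%:R * y i j)^-1 (dm_lin.2 (-1) _ _ dz1 dz2).
congr dm; apply/matrixP => a b.
have scE (c : C) (X Y : 'M[C]_k) : (c *: (-1 *: X + Y)) a b = c * (Y a b - X a b).
  by rewrite !mxE; ring.
rewrite scE !comE mxE.
case: (eqVneq a i) => [->|_] /=; last first.
  by case: (b == i); rewrite ?mulr1n ?mulr0n; ring.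
rewrite (negPf nij); case: (eqVneq b j) => [->|_]; last by rewrite mulr0n; ring.
rewrite eq_sym (negPf nij) mulr1n mulr0n; field.
by rewrite nz.
Qed.

(** By [dm_entry], derivation matrices are combinations of the matrix units among them. For i
    different from l, the commutator of E_ij and E_jl is E_il, and diagonal units always belong; so
    these units are closed under products. *)
Lemma dm_mul y z : dm y -> dm z -> dm (y *m z).
Proof.
move=> dy dz.
have trans i j l : dm (delta_mx i j) -> dm (delta_mx j l) -> dm (delta_mx i l).
  move=> dij djl; have [->|nil] := eqVneq i l; first exact: dm_diag.
  have := dm_comm dij djl; rewrite mul_delta_mx mul_delta_mx_0 1?eq_sym //.
  by rewrite subr0.
rewrite [y *m z]matrix_sum_delta.
apply: (lin_closed_sum dm_lin) => i _; apply: (lin_closed_sum dm_lin) => l _.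
rewrite mxE scaler_suml; apply: (lin_closed_sum dm_lin) => j _.
have [y0|/(dm_entry dy) dij] := eqVneq (y i j) 0.
  by rewrite y0 mul0r scale0r; exact: dm_lin.1.
have [z0|/(dm_entry dz) djl] := eqVneq (z j l) 0.
  by rewrite z0 mulr0 scale0r; exact: dm_lin.1.
exact/(lin_closedZ dm_lin)/trans/djl.
Qed.

Lemma mact_mem y i : mact y i \in N.
Proof. by rewrite memv_suml // => j _; rewrite memvZ ?(gn_mem gen). Qed.

(** The coefficients of the power series solution of f' = (sum of delta_a z^a) f with f(0) = 1. The
    list [fl] keeps all earlier coefficients for the recursion. *)
Lemma higher_derivation (delta : nat -> 'End(L)) : exists f : nat -> 'End(L),
  f 0%N = \1%VF /\
  forall r, r%:R *: f r = \sum_(a < r) (delta a \o f (r - a.+1)%N)%VF.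
Proof.
pose fl := fix fl n : seq 'End(L) := if n is m.+1 then
  rcons (fl m) (m.+1%:R^-1 *: \sum_(a < m.+1) (delta a \o nth 0 (fl m) (m - a))%VF)
  else [:: \1%VF].
have size_fl n : size (fl n) = n.+1 by elim: n => //= n IHn; rewrite size_rcons IHn.
have nth_fl n m : (m <= n)%N -> nth 0 (fl n) m = nth 0 (fl m) m.
  elim: n => [|n IHn]; first by rewrite leqn0 => /eqP ->.
  rewrite leq_eqVlt => /orP[/eqP -> //|ltm].
  by rewrite /= nth_rcons size_fl ltm IHn.
exists (fun r => nth 0 (fl r) r); split=> // -[|r]; first by rewrite scale0r big_ord0.
rewrite {1}/fl -/fl nth_rcons size_fl ltnn eqxx scalerA divff ?pnatr_eq0 // scale1r.
by apply: eq_bigr => a _; rewrite subSS nth_fl // leq_subr.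
Qed.

Lemma uniform_vanishing (f : nat -> 'End(L)) :
  (forall v, v \in N -> exists R, forall r, (R <= r)%N -> f r v = 0) ->
  exists R, forall r v, v \in N -> (R <= r)%N -> f r v = 0.
Proof.
move=> fv; have /fin_all_exists[R RP] (i : 'I_(\dim N)) :
    exists R, forall r, (R <= r)%N -> f r (vbasis N)`_i = 0.
  by apply: fv; rewrite vbasis_mem // mem_nth ?size_tuple.
exists (\max_i R i) => r v Nv ler; rewrite (coord_vbasis Nv) linear_sum big1 // => i _.
by rewrite linearZ /= RP ?scaler0 // (leq_trans _ ler) // leq_bigmax.
Qed.

(* With v = u - 1, the formal solution of f'(z) = delta_{v (1 + z v)^-1} f(z),
   f(0) = 1 is a family of automorphisms with f(z) = 1 + z v on generators, and u
   is its value at z = 1. *)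
Lemma lift_unit u : dm u -> u \in unitmx ->
  exists2 phi : 'End(L), lb_iso N N phi & forall i, phi (e i) = mact u i.
Proof.
move=> du unit_u; pose v := u - 1%:M.
have dm1 : dm 1%:M.
  rewrite [1%:M]matrix_sum_delta; apply: (lin_closed_sum dm_lin) => i _.
  apply: (lin_closed_sum dm_lin) => j _; rewrite mxE.
  have [->|_] := eqVneq i j; last by rewrite scale0r; exact: dm_lin.1.
  exact/(lin_closedZ dm_lin)/dm_diag.
have dv : dm v by rewrite /v addrC -scaleN1r; apply: dm_lin.2.
(* [vp a] is (-1)^a v^(a+1), the coefficient of z^a in v (1 + z v)^(-1). *)
pose vp a := (-1) ^+ a *: iter a (mulmx v) v.
have vpS a : v *m vp a = - vp a.+1.
  by rewrite /vp -scalemxAr iterS exprS mulN1r scaleNr opprK.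
have dvp a : dm (vp a).
  by apply: (lin_closedZ dm_lin); elim: a => //= a; apply: dm_mul.
have /choice[delta deltaP] a : exists delta : 'End(L), derivation_on N delta /\
    forall i, delta (e i) = mact (vp a) i.
  by have [d ? ?] := dvp a; exists d.
have dN a w : w \in N -> delta a w \in N by apply: (deltaP a).1.1.
have dlbr a w w' : w \in N -> w' \in N ->
    delta a (lbr w w') = lbr (delta a w) w' + lbr w (delta a w').
  exact: (deltaP a).1.2.
pose mv i := mact v i.
have de a i : delta a (e i) = mact (vp a) i by apply: (deltaP a).2.
have de0 i : delta 0%N (e i) = mv i by rewrite de /vp expr0 scale1r.
have dmv a i : delta a (mv i) = - delta a.+1 (e i).
  by rewrite (lfun_mact _ _ (de a)) vpS de mactN.
have [f [f0 frec]] := higher_derivation delta.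
have frecv r w : r%:R *: f r w = \sum_(a < r) delta a (f (r - a.+1)%N w).
  rewrite -scale_lfunE frec sum_lfunE.
  by apply: eq_bigr => a _; rewrite comp_lfunE.
have natK r (w1 w2 : L) : r.+1%:R *: w1 = r.+1%:R *: w2 -> w1 = w2.
  by apply: scalerI; rewrite pnatr_eq0.
have fN r w : w \in N -> f r w \in N.
  elim/ltn_ind: r => -[|r] IHr Nw; first by rewrite f0 id_lfunE.
  have := memvZ r.+1%:R^-1 (_ : r.+1%:R *: f r.+1 w \in N).
  rewrite scalerK ?pnatr_eq0 //; apply; rewrite frecv memv_suml // => a _.
  by rewrite dN // IHr // subSS ltnS leq_subr.
have fe1 i : f 1%N (e i) = mv i.
  by apply: (natK 0%N); rewrite frecv big_ord1 f0 id_lfunE de0 scale1r.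
(* In the recursion the terms delta_r (v e_i) and delta_(r+1) (e_i) cancel; the others involve
   earlier coefficients that vanish. *)
have fe2 r i : f r.+2 (e i) = 0.
  elim/ltn_ind: r => r IHr; apply: (natK r.+1); rewrite frecv !big_ord_recr /=.
  rewrite subnn subSnn f0 id_lfunE fe1 dmv addrNK scaler0 big1 // => a _.
  have ar := ltn_ord a; rewrite !subSS -[(r.+1 - a)%N]/(r.+1 - a)%N subSn; last exact: ltnW.
  by rewrite -[(r - a)%N]prednK ?subn_gt0 // IHr ?linear0 // prednK ?subn_gt0 // leq_subr.
have eN i : e i \in N by apply: gn_mem gen i.
have mvN i : mv i \in N by apply: mact_mem.
(* The coefficient of z^(r+1) in f([w, e_i]) = [f(w), e_i + z v e_i]. The terms
   [f_(r-a) w, delta_a e_i] telescope because delta_a (v e_i) = -delta_(a+1) e_i. *)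
have fHS r w i : w \in N -> f r.+1 (lbr w (e i)) = lbr (f r.+1 w) (e i) + lbr (f r w) (mv i).
  elim/ltn_ind: r => r IHr Nw.
  pose A a := lbr (delta a (f (r - a)%N w)) (e i).
  pose B a := lbr (delta a (f (r - a.+1)%N w)) (mv i).
  pose h a := lbr (f (r - a)%N w) (delta a (e i)).
  have sumh : \sum_(a < r) (h a - h a.+1) + h r = lbr (f r w) (mv i).
    rewrite -(big_mkord xpredT (fun a => h a - h a.+1)).
    under eq_bigr do rewrite -opprB.
    by rewrite sumrN telescope_sumr // opprB subrK /h subn0 de0.
  have lhs : r.+1%:R *: f r.+1 (lbr w (e i)) =
      \sum_(a < r.+1) A a + \sum_(a < r) B a + lbr (f r w) (mv i).
    rewrite frecv big_ord_recr /= subnn f0 id_lfunE dlbr //.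
    have -> : \sum_(a < r) delta a (f (r.+1 - a.+1)%N (lbr w (e i))) =
        \sum_(a < r) (A a + B a + (h a - h a.+1)).
      apply: eq_bigr => a _; rewrite subSS -{1}[(r - a)%N]prednK ?subn_gt0 //.
      rewrite -subnS IHr //; last by rewrite subnS prednK ?subn_gt0 // leq_subr.
      rewrite subnSK // linearD /= !dlbr ?fN // dmv lbrNr /A /B /h; vring.
    have -> : lbr (delta r w) (e i) = A r by rewrite /A subnn f0 id_lfunE.
    have -> : lbr w (delta r (e i)) = h r by rewrite /h subnn f0 id_lfunE.
    by rewrite !big_split /= big_ord_recr /= -sumh big_split /=; vring.
  apply: (natK r); rewrite lhs scalerDr -!lbrZl.
  rewrite -[X in lbr (X *: f r w)]natr1 scalerDl scale1r !frecv lbrDl !lbr_suml addrA.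
  by congr (_ + _ + _); apply: eq_bigr => a _; rewrite ?subSS.
have [w Nw|R RP] := @uniform_vanishing f.
  move: w Nw; apply: (generates_ind NN nilN gen) => [|i|w i Nw [R RP]].
  - split=> [|a w w' [R RP] [R' RP']]; first by exists 0%N => r _; rewrite linear0.
    exists (maxn R R') => r; rewrite geq_max => /andP[Rr Rr'].
    by rewrite linearP /= RP // RP' // scaler0 addr0.
  - by exists 2%N => -[|[|r]] // _; apply: fe2.
  exists R.+1 => -[|r] // Rr.
  by rewrite fHS // RP ?(leq_trans _ Rr) // RP // !lbr0l addr0.
have u_e i : e i + mv i = mact u i.
  by have := mactD 1 v 1%:M i; rewrite !scale1r mact1 subrK addrC => ->.
(* The series is a polynomial in z and this is its value at 1. With [R.+3] terms, degrees 0 and 1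
   are present and the top term is zero. *)
pose phi : 'End(L) := \sum_(r < R.+3) f r.
have phiE w : phi w = \sum_(r < R.+3) f r w by rewrite sum_lfunE.
have phi_e i : phi (e i) = mact u i.
  rewrite phiE !big_ord_recl /= f0 id_lfunE fe1 big1 ?addr0 => [|r _]; last exact: fe2.
  by rewrite [X in _ + (_ + X)](fe2 0%N i) addr0 u_e.
have phi_lbr w i : w \in N -> phi (lbr w (e i)) = lbr (phi w) (phi (e i)).
  move=> Nw; rewrite !(phiE w) phiE big_ord_recl f0 id_lfunE.
  rewrite (eq_bigr (fun r : 'I_R.+2 => lbr (f r.+1 w) (e i) + lbr (f r w) (mv i))) => [|r _].
    rewrite big_split /= -!lbr_suml phi_e.
    rewrite -u_e lbrDr addrA -lbrDl; congr (lbr _ _ + lbr _ _).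
      by rewrite [RHS]big_ord_recl f0 id_lfunE.
    by rewrite [RHS]big_ord_recr /= RP ?addr0 // ltnW // ltnW.
  exact: fHS.
exists phi => //; apply: generating_hom_bij => //.
- by move=> w Nw; rewrite phiE memv_suml // => r _; apply: fN.
- exact: hom_of_generators gen phi_lbr.
move=> b; rewrite -{1}(gn_gen gen) => /memv_addP[_ /fspanP[c ->] [w NNw ->]].
pose d := (\row_j c j) *m invmx u.
exists (\sum_i d 0 i *: e i); first by rewrite memv_suml // => i _; rewrite memvZ.
rewrite linear_sum /=; suff -> : \sum_i phi (d 0 i *: e i) = \sum_i c i *: e i.
  by rewrite addrAC subrr add0r.
under eq_bigr do rewrite linearZ /= phi_e scaler_sumr.
rewrite exchange_big /=; apply: eq_bigr => j _.
have := congr1 (fun m : 'rV[C]_k => m 0 j) (mulmxKV unit_u (\row_j c j)).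
rewrite !mxE => <-; rewrite scaler_suml; apply: eq_bigr => l _.
by rewrite scalerA.
Qed.

End DerivationAlgebra.

(** * Conjugacy of gradings *)

Section Transport.
Variables (K : fieldType) (L L' : leibnizType K).
Variables (U : {vspace L}) (U' : {vspace L'}) (f : 'Hom(L, L')) (g : 'Hom(L', L)).
Hypotheses (isof : lb_iso U U' f) (isog : lb_iso U' U g).
Hypotheses (fK : {in U, cancel f g}) (gK : {in U', cancel g f}).

Lemma iso_mem v : v \in U -> f v \in U'.
Proof. by case: isof => <- _ _; apply: memv_img. Qed.

Lemma conj_derivation D : derivation_on U' D -> derivation_on U (g \o (D \o f))%VF.
Proof.
have gU v : v \in U' -> g v \in U by case: isog => <- _ _; apply: memv_img.
move=> [DU Dlbr]; have [_ _ flbr] := isof; have [_ _ glbr] := isog.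
split=> [u Uu|u v Uu Uv]; first by rewrite !comp_lfunE gU ?DU ?iso_mem.
rewrite !comp_lfunE flbr // Dlbr ?iso_mem // linearD /=.
by rewrite !glbr ?DU ?iso_mem // !fK.
Qed.

End Transport.

Lemma lb_iso_sq (K : fieldType) (L L' : leibnizType K) (U : {vspace L})
    (U' : {vspace L'}) (f : 'Hom(L, L')) : lb_iso U U' f ->
  (f @: lbrv U U)%VS = lbrv U' U'.
Proof.
move=> [imf _ flbr]; apply/eqP; rewrite eqEsubv; apply/andP; split.
  apply/subvP => _ /memv_imgP[u + ->]; move: u.
  apply: (lbrv_ind (P := fun u => f u \in lbrv U' U')) => [|u v Uu Uv].
    by split=> [|a v w Pv Pw]; rewrite ?linear0 ?mem0v // linearP memvD ?memvZ.
  by rewrite flbr // mem_lbrv // -imf memv_img.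
apply/lbrvP => u v; rewrite -{1 2}imf => /memv_imgP[u0 Uu ->] /memv_imgP[v0 Uv ->].
by rewrite -flbr // memv_img // mem_lbrv.
Qed.

Lemma lb_iso_dim (K : fieldType) (L L' : leibnizType K) (U W : {vspace L})
    (U' : {vspace L'}) (f : 'Hom(L, L')) : lb_iso U U' f -> (W <= U)%VS ->
  \dim (f @: W) = \dim W.
Proof.
move=> [_ injf _] WU; apply: limg_dim_eq; apply/eqP; rewrite -subv0.
apply/subvP => v; rewrite memv_cap memv_ker memv0 => /andP[/(subvP WU) Uv /eqP fv].
by apply/eqP/injf; rewrite ?mem0v // linear0.
Qed.

Lemma transport_grading (C : numClosedFieldType) (L L' : leibnizType C)
    (N : {vspace L}) (N' : {vspace L'}) (f : 'Hom(L, L')) (g : 'Hom(L', L)) k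
    (e' : 'I_k -> L') (D' : 'I_k -> 'End(L')) :
  lb_iso N N' f -> lb_iso N' N g -> {in N, cancel f g} -> {in N', cancel g f} ->
  grading N' e' D' ->
  grading N (fun i => g (e' i)) (fun j => (g \o (D' j \o f))%VF).
Proof.
move=> isof isog fK gK [[e'N gen] free der De].
have img : (g @: N')%VS = N by case: isog.
split.
- split; first by move=> i; rewrite -img memv_img.
  rewrite -(lb_iso_sq isog) -[RHS]img -[in RHS]gen limgD; congr (_ + _)%VS.
  by rewrite limg_span /fspan !codomE -(map_comp g e').
- move=> c Nc; apply: free; have := memv_img f Nc.
  rewrite (lb_iso_sq isof) linear_sum /=.
  by under eq_bigr do rewrite linearZ /= gK //.
- by move=> j; apply: conj_derivation (der j).
by move=> i j; rewrite !comp_lfunE gK // De linearZ.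
Qed.

Section Conjugacy.
Variables (C : numClosedFieldType) (L : leibnizType C) (N : {vspace L}) (k : nat).
Hypothesis NN : (lbrv N N <= N)%VS.
Hypothesis nilN : lb_nilpotent N.

Lemma unitmx_perm_entries (b : 'M[C]_k) : b \in unitmx ->
  exists s : 'S_k, forall j, b j (s j) != 0.
Proof.
rewrite unitmxE unitfE => nz; have [/existsP[s /forallP sP]|] :=
  boolP [exists s : 'S_k, [forall j, b j (s j) != 0]]; first by exists s.
rewrite negb_exists => /forallP no; case/eqP: nz.
rewrite /determinant big1 // => s _; have := no s; rewrite negb_forall.
by move=> /existsP[j /negPn/eqP bj]; rewrite (bigD1 j) //= bj mul0r mulr0.
Qed.

Lemma gradings_conjugate (e e' : 'I_k -> L) D D' : grading N e D -> grading N e' D' ->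
  exists (sigma : 'End(L)) (s : 'S_k), lb_iso N N sigma /\
    forall j, sigma (e j) = e' (s j).
Proof.
move=> G G'; have [theta isot te] := exists_regrading NN nilN G G'.
have [g [isog tK gK]] := lb_iso_inv NN isot.
have e'N := gn_mem (gd_gen G').
have tN v : v \in N -> theta v \in N by apply: (iso_mem isot).
pose E i := theta (e' i).
have /fin_all_exists[af afP] i : exists c : 'I_k -> C, E i = \sum_j c j *: e j.
  exact/fspanP/te.
pose a : 'M[C]_k := \matrix_(i, j) af i j.
have Ea i : E i = mact e a i.
  by rewrite afP; apply: eq_bigr => j _; rewrite mxE.
have unit_a : a \in unitmx.
  rewrite -row_free_unit -kermx_eq0; apply/eqP/row_matrixP => m; rewrite row0.
  have /sub_kermxP := row_sub m (kermx a); set r := row m _ => ra.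
  apply/rowP => i; rewrite [RHS]mxE; apply: (gd_free G' (c := fun i => r 0 i)).
  suff -> : \sum_i r 0 i *: e' i = 0 by rewrite mem0v.
  have [_ inj _] := isot; apply: inj; [|exact: mem0v|].
    by apply: memv_suml => l _; rewrite memvZ.
  rewrite linear0 linear_sum /=.
  under eq_bigr do rewrite linearZ /= -/(E _) Ea /mact scaler_sumr.
  rewrite exchange_big big1 // => j _; have := congr1 (fun m : 'rV[C]_k => m 0 j) ra.
  rewrite !mxE => rj; rewrite -[RHS](scale0r (e j)) -{}rj scaler_suml.
  by apply: eq_bigr => l _; rewrite scalerA.
pose b := invmx a; have ba : b *m a = 1%:M by apply: mulVmx.
(* Carried over by [theta], the derivation [D' m] multiplies [E m] by 1 and the other [E i] by 0; in
   the basis [e] its matrix is b E_mm a. *)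
have dm_b m : derivation_matrix N e (b *m delta_mx m m *m a).
  exists (theta \o (D' m \o g))%VF.
    exact: (conj_derivation isog isot gK (gd_der G' m)).
  move=> j; rewrite -{1}(mact1 e j) -ba !mact_mul linear_sum; apply: eq_bigr => i _.
  rewrite linearZ /= -Ea !comp_lfunE tK // (gd_De G') linearZ /= scalerA; congr (_ *: _).
  rewrite mxE (bigD1 m) //= big1 ?addr0 => [|l nlm]; rewrite mxE.
    by rewrite eqxx eq_sym /=; case: eqVneq => [->|_]; rewrite ?mulr1 ?mulr0.
  by rewrite (negPf nlm) mulr0.
have [s sP] : exists s : 'S_k, forall j, b j (s j) != 0.
  by apply: unitmx_perm_entries; rewrite unitmx_inv.
pose u := row_perm s a.
(* The j-th summand before scaling has only its j-th row nonzero, namely b_(j, s j) times row [s j]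
   of [a]. So the normalized sum is [a] with permuted rows, and it is a combination of products of
   derivation matrices. *)
have du : derivation_matrix N e u.
  have -> : u = \sum_j (b j (s j))^-1 *:
      (delta_mx j j *m (b *m delta_mx (s j) (s j) *m a)).
    apply/matrixP => p q; rewrite mxE summxE (bigD1 p) //= big1 ?addr0 => [|j njp].
      rewrite !mxE (bigD1 p) //= big1 ?addr0 => [|l nlp]; last first.
        by rewrite [delta_mx _ _ _ _]mxE (negPf nlp) andbF mul0r.
      rewrite [delta_mx _ _ _ _]mxE !eqxx mul1r mxE (bigD1 (s p)) //= big1 ?addr0 => [|l nls].
        rewrite mxE (bigD1 (s p)) //= big1 ?addr0 => [|l nls].
          by rewrite [delta_mx _ _ _ _]mxE !eqxx mulr1 mulKf ?sP // mxE.
        by rewrite mxE (negPf nls) mulr0.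
      rewrite mxE big1 ?mul0r // => l' _.
      by rewrite mxE (negPf nls) andbF mulr0.
    rewrite !mxE big1 ?mulr0 // => l _.
    by rewrite mxE eq_sym (negPf njp) mul0r.
  apply: (lin_closed_sum (dm_lin N e)) => j _; apply: (lin_closedZ (dm_lin N e)).
  exact: (dm_mul G (dm_diag G j) (dm_b (s j))).
have unit_u : u \in unitmx by rewrite /u row_permE unitmx_mul unitmx_perm.
have [phi isophi phi_e] := lift_unit NN nilN G du unit_u.
have phi_E j : phi (e j) = E (s j).
  by rewrite phi_e Ea /mact; apply: eq_bigr => l _; rewrite mxE.
have phiN v : v \in N -> phi v \in N by apply: (iso_mem isophi).
exists (g \o phi)%VF, s; split; last first.
  by move=> j; rewrite comp_lfunE phi_E tK.
have [imphi injphi philbr] := isophi; have [img injg glbr] := isog.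
split; first by rewrite limg_comp imphi.
  by move=> v w Nv Nw; rewrite !comp_lfunE => /injg-/(_ (phiN _ Nv) (phiN _ Nw)); apply: injphi.
by move=> v w Nv Nw; rewrite !comp_lfunE philbr // glbr ?phiN.
Qed.

End Conjugacy.

(** * Uniqueness of the extension *)

Lemma lb_iso_center (K : fieldType) (L L' : leibnizType K) (U : {vspace L})
    (U' : {vspace L'}) (f : 'Hom(L, L')) : (lbrv U U <= U)%VS -> lb_iso U U' f ->
  center_in_sq U -> center_in_sq U'.
Proof.
move=> UU isof ZU; have [imf injf flbr] := isof; move=> z; rewrite -{1}imf.
move=> /memv_imgP[z0 Uz ->] zC; rewrite -(lb_iso_sq isof) memv_img // ZU // => v Uv.
have [|zv vz] := zC (f v); first by rewrite -imf memv_img.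
have Ulbr a b : a \in U -> b \in U -> lbr a b \in U.
  by move=> Ua Ub; rewrite (subvP UU) ?mem_lbrv.
by split; apply: injf; rewrite ?mem0v ?Ulbr // flbr // linear0.
Qed.

Section ExtendIsomorphism.
Variables (C : numClosedFieldType) (L L' : leibnizType C).
Variables (N : {vspace L}) (N' : {vspace L'}) (k : nat).
Variables (e x : 'I_k -> L) (e' x' : 'I_k -> L') (s : 'S_k) (sigma : 'Hom(L, L')).
Hypotheses (F : frame N e x) (F' : frame N' e' x').
Hypotheses (ZN : center_in_sq N) (ZN' : center_in_sq N').
Hypothesis isos : lb_iso N N' sigma.
Hypothesis se : forall i, sigma (e i) = e' (s i).

Let eN := fr_mem F.
Let LN := fr_lbr F.

Lemma annr_iso i : annr N' e' (s i) = annr N e i.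
Proof.
have [ims injs slbr] := isos.
apply/asboolP/asboolP => -[_ ann]; split; rewrite ?(fr_mem F) ?(fr_mem F') // => y Ny.
  apply: injs; rewrite ?mem0v ?LN // slbr // se linear0 ann //.
  by rewrite -ims memv_img.
move: Ny; rewrite -{1}ims => /memv_imgP[y0 Ny0 ->].
by rewrite -se -slbr // ann // linear0.
Qed.

Lemma adr_iso v j : v \in N -> sigma (lbr v (x j)) = lbr (sigma v) (x' (s j)).
Proof.
have [_ _ slbr] := isos; move: v; apply: (frame_ind F) => [|i|v i Nv Pv].
- split=> [|a u v Pu Pv]; first by rewrite lbr0l !linear0 lbr0l.
  by rewrite lbrDl lbrZl !linearP /= lbrDl lbrZl Pu Pv.
- by rewrite (fr_ex F) linearZ /= !se (fr_ex F') (inj_eq perm_inj).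
rewrite (slbr v (e i)) // lbr_leibniz linearD /= (slbr (lbr v (x j))) //
  (slbr v (lbr (e i) (x j))) // Pv.
rewrite [RHS]lbr_leibniz; congr (_ + lbr _ _).
by rewrite (fr_ex F) linearZ /= !se (fr_ex F') (inj_eq perm_inj).
Qed.

(** By [lbr_xe], [x_j, e_i] depends only on whether i = j and whether e_i lies in Ann_r(N), which an
    isomorphism of the nilradicals preserves. *)
Lemma adl_iso v j : v \in N -> sigma (lbr (x j) v) = lbr (x' (s j)) (sigma v).
Proof.
have [_ _ slbr] := isos.
have xe i : sigma (lbr (x j) (e i)) = lbr (x' (s j)) (e' (s i)).
  rewrite (lbr_xe F ZN) (lbr_xe F' ZN') (inj_eq perm_inj) annr_iso.
  by case: ifP => _; rewrite ?linear0 // linearN /= se.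
move: v; apply: (frame_ind F) => [|i|v i Nv Pv].
- split=> [|a u v Pu Pv]; first by rewrite lbr0r !linear0.
  by rewrite lbrDr lbrZr !linearP /= Pu Pv ?lbrDr ?lbrZr.
- by rewrite xe se.
rewrite (slbr v (e i)) // se !lbr_lbr linearB /=.
by rewrite (slbr (lbr (x j) v)) // (slbr (lbr (x j) (e i))) // Pv xe se.
Qed.

Definition extend v : L' :=
  sigma (daddv_pi N (fspan x) v) +
  \sum_j fcoord x j (daddv_pi (fspan x) N v) *: x' (s j).

Lemma extend_linear : linear extend.
Proof.
move=> a u v; rewrite /extend !linearP /= scalerDr scaler_sumr addrACA -big_split /=.
congr (_ + _); apply: eq_bigr => j _.
by rewrite fcoord_scalar scalerDl scalerA.
Qed.

Definition extend_fun : L -> L' := extend.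
HB.instance Definition _ := GRing.isLinear.Build C L L' *:%R extend_fun extend_linear.
Definition extend_hom : 'Hom(L, L') := linfun extend_fun.

Lemma extend_N v : v \in N -> extend_hom v = sigma v.
Proof.
move=> Nv; rewrite lfunE /= /extend_fun /extend daddv_pi_id ?(capNx F) //.
have -> : daddv_pi (fspan x) N v = 0.
  apply: (addrI (daddv_pi N (fspan x) v)); rewrite addr0.
  by rewrite daddv_pi_add ?(capNx F) ?(fr_sum F) ?memvf // daddv_pi_id ?(capNx F).
rewrite big1 ?addr0 // => j _; have := fcoord_scalar x j (-1) 0 0.
by rewrite scaler0 addr0 mulN1r addNr => ->; rewrite scale0r.
Qed.

Lemma extend_x j : extend_hom (x j) = x' (s j).
Proof.
have lfx : lindep_free x.
  by move=> c c0; apply: (fr_xfree F); rewrite c0 mem0v.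
have cap : (fspan x :&: N)%VS = 0%VS by rewrite capvC (capNx F).
rewrite lfunE /= /extend_fun /extend.
rewrite [X in \sum_j fcoord x j X *: _]daddv_pi_id ?mem_fspan //.
have -> : daddv_pi N (fspan x) (x j) = 0.
  apply: (addIr (daddv_pi (fspan x) N (x j))); rewrite add0r.
  by rewrite daddv_pi_add ?(capNx F) ?(fr_sum F) ?memvf // daddv_pi_id ?mem_fspan.
have {1}-> : x j = \sum_i (i == j)%:R *: x i.
  by rewrite (bigD1 j) //= eqxx scale1r big1 ?addr0 // => i /negPf ->; rewrite scale0r.
rewrite linear0 add0r (bigD1 j) //= fcoordE // eqxx scale1r big1 ?addr0 // => i nij.
by rewrite fcoordE // (negPf nij) scale0r.
Qed.

Lemma extend_iso : lb_isomorphic (fullv : {vspace L}) (fullv : {vspace L'}).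
Proof.
have [ims injs slbr] := isos.
have fullind (P : L -> Prop) : lin_closed P -> (forall v, v \in N -> P v) ->
    (forall j, P (x j)) -> forall v, P v.
  move=> linP PN Px v; have : v \in (N + fspan x)%VS by rewrite (fr_sum F) memvf.
  by apply: addv_ind => // u; apply: fspan_ind.
have dimL (M : leibnizType C) (N0 : {vspace M}) (e0 x0 : 'I_k -> M) :
    frame N0 e0 x0 -> \dim {:M} = (\dim N0 + k)%N.
  move=> F0; rewrite -(fr_sum F0) dimv_disjoint_sum ?(capNx F0) // dim_fspan ?card_ord //.
  by move=> c c0; apply: (fr_xfree F0); rewrite c0 mem0v.
have img : (extend_hom @: fullv)%VS = fullv.
  apply/eqP; rewrite eqEsubv subvf -(fr_sum F') subv_add /=; apply/andP; split.
    apply/subvP => v; rewrite -ims => /memv_imgP[u Nu ->].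
    by rewrite -extend_N // memv_img ?memvf.
  by apply: fspan_sub => j; rewrite -[j](permKV s) -extend_x memv_img ?memvf.
exists extend_hom; split=> // [u v _ _ fuv|u v _ _].
  apply/eqP; rewrite -subr_eq0 -memv0.
  have <- : (fullv :&: lker extend_hom)%VS = 0%VS.
    apply/eqP; rewrite -dimv_eq0; have /eqP := limg_ker_dim extend_hom fullv.
    rewrite img (dimL _ _ _ _ F) (dimL _ _ _ _ F') -ims (lb_iso_dim isos) //.
    by rewrite -[X in _ == X]add0n eqn_add2r.
  by rewrite memv_cap memvf memv_ker linearB /= fuv subrr.
move: v; apply: (fullind _) => [|v Nv|j].
- split=> [|a v w Pv Pw]; first by rewrite lbr0r linear0 lbr0r.
  by rewrite lbrDr lbrZr !linearP /= Pv Pw ?lbrDr ?lbrZr.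
- move: u; apply: (fullind _) => [|u Nu|j].
  + split=> [|a u w Pu Pw]; first by rewrite lbr0l !linear0 lbr0l.
    by rewrite lbrDl lbrZl !linearP /= Pu Pw lbrDl lbrZl.
  + by rewrite !extend_N ?LN // slbr.
  + by rewrite extend_N ?LN // extend_x extend_N // adl_iso.
move: u; apply: (fullind _) => [|u Nu|l].
- split=> [|a u w Pu Pw]; first by rewrite lbr0l !linear0 lbr0l.
  by rewrite lbrDl lbrZl !linearP /= Pu Pw lbrDl lbrZl.
- by rewrite extend_N ?LN // extend_x extend_N // adr_iso.
by rewrite (fr_xx F) linear0 !extend_x (fr_xx F').
Qed.

End ExtendIsomorphism.

Lemma frame_grading (C : numClosedFieldType) (L : leibnizType C) (N : {vspace L})
    k (e x : 'I_k -> L) : frame N e x -> grading N e (fun j => adr (x j)).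
Proof.
move=> F; split.
- exact: (frame_generates F).
- exact: fr_free F.
- by move=> j; apply: (adr_derivationN F).
by move=> i j; rewrite adrE (fr_ex F).
Qed.

(** Both extensions become gradings of the same N, the second one through [f]. The automorphism
    conjugating them, followed by [f], matches the generators of the two frames and so extends to
    the [x j]. *)
Lemma maximal_extension_unique (C : numClosedFieldType) (R R' : leibnizType C)
    (N Q : {vspace R}) (N' Q' : {vspace R'}) k k' :
  center_in_sq N -> maximal_extension N Q k -> maximal_extension N' Q' k' ->
  lb_isomorphic N N' ->
  lb_isomorphic (fullv : {vspace R}) (fullv : {vspace R'}).
Proof.
move=> ZN hR hR' [f isof].
have kk' : k' = k.
  have [_ _ _ _ <-] := hR; have [_ _ _ _ <-] := hR'; have [imf _ _] := isof.
  have [e [x F]] := exists_frame hR.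
  by rewrite -(lb_iso_sq isof) -{1}imf !(lb_iso_dim isof) // (frame_sub F).
rewrite {}kk' in hR'.
have [e [x F]] := exists_frame hR; have [e' [x' F']] := exists_frame hR'.
have [g [isog fK gK]] := lb_iso_inv (frame_sub F) isof.
have G := frame_grading F; have G' := transport_grading isof isog fK gK (frame_grading F').
have [sigma [s [isos se]]] := gradings_conjugate (frame_sub F) (fr_nil F) G G'.
have [imf injf flbr] := isof; have [ims injs slbr] := isos.
have sN v : v \in N -> sigma v \in N by apply: (iso_mem isos).
have ZN' := lb_iso_center (frame_sub F) isof ZN.
apply: (extend_iso (s := s) (sigma := (f \o sigma)%VF) F F' ZN ZN').
  split; first by rewrite limg_comp ims.
    by move=> u v Nu Nv; rewrite !comp_lfunE => /injf-/(_ (sN _ Nu) (sN _ Nv)); apply: injs.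
  by move=> u v Nu Nv; rewrite !comp_lfunE slbr // flbr ?sN.
by move=> i; rewrite comp_lfunE se gK // (fr_mem F').
Qed.

Theorem theorem4p2 (F : realType) (R : leibnizType F[i])
    (N Q : {vspace R}) (k s : nat) (Nt : 'I_s -> {vspace R})
    (hR : maximal_extension N Q k)
    (hN : ideal_decomposition N Nt)
    (hnonsplit : forall t, lb_nonsplit (Nt t))
    (hnonabelian : forall t, ~ lb_abelian (Nt t)) :
  (exists Mt : 'I_s -> {vspace R},
    [/\ equivalent_decompositions N Nt Mt,
        (forall t, lb_ideal (Nt t) fullv) -> forall t, Mt t = Nt t,
        exists B : basis_data R s,
          adapted_basis B N Mt /\ multiplication_table B
      & exists Rt Qt : 'I_s -> {vspace R},
          ideal_decomposition fullv Rt
          /\ forall t, lb_nilradical (Mt t) (Rt t)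
                       /\ complementary (Rt t) (Mt t) (Qt t)])
  /\ (forall (R' : leibnizType F[i]) (N' Q' : {vspace R'}) (k' : nat),
        maximal_extension N' Q' k' -> lb_isomorphic N N' ->
        lb_isomorphic (fullv : {vspace R}) (fullv : {vspace R'})).
Proof.
have ZN := decomposition_center hN hnonsplit hnonabelian.
split; last by move=> R' N' Q' k' hR'; apply: maximal_extension_unique ZN hR hR'.
have [e [x fr]] := exists_frame hR.
have [blk blkP] := exists_block_index fr ZN hN.
have eblk := block_index_cross fr hN blkP.
have [ws wsP] := exists_basis_words fr eblk.
exists (block N e x blk); split.
- exact: (blocks_equivalent fr hN blkP).
- exact: (blocks_of_ideals fr hN blkP).
- exists (block_basis x ws); split; first exact: (block_basis_adapted fr eblk wsP).
  exact: (block_basis_table fr ZN eblk wsP).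
exists (extended_block N e x blk), (xspan N e x blk).
split; first exact: (extended_decomposition fr eblk).
by move=> t; apply: (extended_nilradical fr eblk); case: hR.
Qed.
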